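(* Let $q\ge1$, let $A=(a_1,\ldots,a_q)$ and $B=(b_1,\ldots,b_q)$ be vectors of positive real numbers, let $\sigma>0$, and suppose that $v(t)=\sum_{j=1}^{q}(t^{a_j}-t^{b_j})\ge 0$ for all $t\in(0,1]$ (in particular, this holds if $B\prec^W A$). Then the function $$x\mapsto x^{-\sigma}\,{}_{q+1}F_q\!\left(\sigma,A;B;-\frac1x\right)$$ is completely monotone on $(0,\infty)$. If $0<\sigma\le 1$, then it is logarithmically completely monotone.
   Context: ${}_{q+1}F_q(\sigma,A;B;z)=\sum_{n\ge 0}\frac{(\sigma)_n(a_1)_n\cdots(a_q)_n}{(b_1)_n\cdots(b_q)_n\,n!}z^n$ for $|z|<1$, where $(a)_0=1$, $(a)_n=a(a+1)\cdots(a+n-1)$; the same symbol denotes the holomorphic extension to $\mathbb{C}\setminus[1,\infty)$. A nonnegative function $f$ on $(0,\infty)$ is completely monotone if it has derivatives of all orders and $(-1)^nf^{(n)}(x)\ge0$ for all $n\ge0$ and $x>0$. A positive function $f$ on $(0,\infty)$ is logarithmically completely monotone if $-(\log f)'$ is completely monotone. Weak supermajorization $B\prec^W A$ (with $A$, $B$ each arranged in ascending order) means: $0<a_1\le a_2\le\cdots\le a_q$, $0<b_1\le b_2\le\cdots\le b_q$ and $\sum_{i=1}^{k}a_i\le\sum_{i=1}^{k}b_i$ for $k=1,2,\ldots,q$. *)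

(* Defs.v *)
From Stdlib Require Import Reals Factorial List Permutation Sorted ClassicalEpsilon.
From Coquelicot Require Import Coquelicot.

Open Scope R_scope.

Definition list_Rsum (l : list R) : R := fold_right Rplus 0 l.
Definition list_Rprod (l : list R) : R := fold_right Rmult 1 l.

Fixpoint pochhammer (a : R) (n : nat) : R :=
  match n with
  | O => 1
  | S m => pochhammer a m * (a + INR m)
  end.

Definition hyp_coef (sigma : R) (A B : list R) (n : nat) : R :=
  pochhammer sigma n * list_Rprod (map (fun a => pochhammer a n) A)
  / (list_Rprod (map (fun b => pochhammer b n) B) * INR (fact n)).

(* Complex differentiability on the open set C \ [1,oo) is holomorphy there.
   The values of F on the cut [1,oo) are left unconstrained. *)
Definition is_hyp_extension (sigma : R) (A B : list R) (F : C -> C) : Prop :=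
  (forall z : C, Cmod z < 1 ->
     is_pseries (K := C_AbsRing) (V := C_NormedModule)
       (fun n => RtoC (hyp_coef sigma A B n)) z (F z)) /\
  (forall z : C, ~ (Im z = 0 /\ 1 <= Re z) ->
     ex_derive (K := C_AbsRing) (V := C_NormedModule) F z).

(* Off the cut the extension is unique by the identity theorem. [epsilon]
   yields an unspecified function when there is no extension. *)
Definition hypF (sigma : R) (A B : list R) : C -> C :=
  epsilon (inhabits (fun _ : C => RtoC 0)) (is_hyp_extension sigma A B).

(* Functions on (0,oo) are total functions R -> R whose values at x <= 0 are
   irrelevant: derivatives at x > 0 depend only on values near x. *)
Definition completely_monotone (f : R -> R) : Prop :=
  forall (n : nat) (x : R), 0 < x ->
    ex_derive_n f n x /\ 0 <= (-1) ^ n * Derive_n f n x.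

Definition log_completely_monotone (f : R -> R) : Prop :=
  (forall x : R, 0 < x -> 0 < f x) /\
  (forall x : R, 0 < x -> ex_derive (fun t => ln (f t)) x) /\
  completely_monotone (fun x => - Derive (fun t => ln (f t)) x).

(* Reads B ≺^W A; prefix sums are compared after rearranging both vectors in
   ascending order. *)
Definition weak_supermajorization (B A : list R) : Prop :=
  length A = length B /\
  List.Forall (fun a => 0 < a) A /\ List.Forall (fun b => 0 < b) B /\
  exists A' B' : list R,
    Permutation A A' /\ Permutation B B' /\ Sorted Rle A' /\ Sorted Rle B' /\
    forall k : nat, (1 <= k <= length A)%nat ->
      list_Rsum (firstn k A') <= list_Rsum (firstn k B').

Definition v_fun (A B : list R) (t : R) : R :=
  list_Rsum (map (fun ab => Rpower t (fst ab) - Rpower t (snd ab))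
                 (combine A B)).

(* Main.v *)
(* The moments m_n = prod_j (a_j)_n / (b_j)_n form a completely monotone sequence:
   m_n = m_(n+1) exp(p_n) with p_n = sum_j ln((b_j + n) / (a_j + n)), and the
   differences of p are nonnegative since those of
   sum_j 1 / (a_j + x) - 1 / (b_j + x) = int_0^1 t^(x - 1) v(t) dt are.
   With d_n = (Delta^n m)_0 >= 0, expanding at 1 instead of 0 (Pfaff's
   transformation) gives
     x^(-sigma) F(-1/x) = sum_n ((sigma)_n / n!) d_n (x + 1)^(-sigma - n),
   a convergent series of completely monotone functions on all of (0,oo).
   The sequence d is log-convex, and so is (sigma)_n / n! when sigma <= 1; by a
   Kaluza-type argument the logarithmic derivative of a power series with
   log-convex coefficients has nonnegative coefficients, hence logarithmic
   complete monotonicity.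

   Expanding at a complex pivot p with Re p >= 1/2 continues F to the half-plane
   Re (p z) < 1/2: the coefficients are bounded by |p|^n because the functional
   t^k (1 - t)^i |-> (Delta^i m)_k is nonnegative and |1 - p| <= |p|. The
   half-planes with Re p = 1/2 cover C \ [1,oo); the continuations are glued, and
   identified with the extension of the statement, by the identity theorem, which
   is derived from Goursat's lemma because only complex differentiability is
   assumed. *)
Require Import Defs.
From Stdlib Require Import Reals List Permutation Sorted Lra Lia.
From Stdlib Require Import ClassicalEpsilon.
From Coquelicot Require Import Coquelicot.

Open Scope R_scope.

(** * Weak supermajorization *)

(** No representing measure is ever constructed. The positive functional behind a completely
    monotone sequence appears only through its values on t^n (1 - t)^k, the numbers [fdiff k u n],
    and each use of a measure becomes a finite-difference argument; even the log-convexity of d,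
    otherwise the Cauchy-Schwarz inequality, is obtained in this way. The defining series at z =
    -1/x is available only for x > 1, which forces the change of pivot: z -> z / (1 - p z) sends Re
    (p z) < 1/2 to the disc |w| < 1/|p|, where the re-expanded series converges. Pivot 1 already
    covers the negative axis. The other pivots serve [hypF]: a function picked by [epsilon] has the
    defining property only once an extension to all of C \ [1,oo) has been exhibited. An arbitrary
    extension is only known to be complex differentiable, so uniqueness cannot start from power
    series expansions. The contour argument uses just the imaginary part of the boundary integral,
    the part in which the 2 pi i of Cauchy's formula shows. *)

Lemma list_Rsum_Permutation (l l' : list R) :
  Permutation l l' -> list_Rsum l = list_Rsum l'.
Proof.
  unfold list_Rsum; induction 1; simpl; lra.
Qed.

Lemma v_fun_sums (A B : list R) (t : R) :
  length A = length B ->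
  v_fun A B t = list_Rsum (map (Rpower t) A) - list_Rsum (map (Rpower t) B).
Proof.
  unfold v_fun, list_Rsum; revert B.
  induction A as [|a A IH]; intros [|b B] H; simpl in *; try discriminate; [lra|].
  rewrite IH; [lra|lia].
Qed.

(** Convexity of a -> t^a: its graph lies above the tangent at b. *)
Lemma Rpower_tangent (t a b : R) :
  - ln t * Rpower t b * (b - a) <= Rpower t a - Rpower t b.
Proof.
  replace (Rpower t a) with (Rpower t b * exp ((a - b) * ln t)).
  - pose proof (exp_ineq1_le ((a - b) * ln t)).
    assert (0 < Rpower t b) by apply exp_pos. nra.
  - unfold Rpower; rewrite <- exp_plus; f_equal; ring.
Qed.

(* Abel summation: [s] is the surplus of the prefix sums of [B] over those of
   [A] accumulated so far, weighted by the slope at the last point [c]. *)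
Lemma Rpower_sum_surplus (t : R) (A B : list R) (c s : R) :
  0 < t <= 1 -> length A = length B -> Sorted Rle (c :: B) -> 0 <= s ->
  (forall k, (1 <= k <= length A)%nat ->
     list_Rsum (firstn k A) <= s + list_Rsum (firstn k B)) ->
  0 <= list_Rsum (map (Rpower t) A) - list_Rsum (map (Rpower t) B)
       + - ln t * Rpower t c * s.
Proof.
  intros Ht; assert (Hl : 0 <= - ln t).
  { destruct (Rle_lt_or_eq_dec t 1) as [h|h]; [lra| |].
    - pose proof (ln_increasing t 1); rewrite ln_1 in *; lra.
    - rewrite h, ln_1; lra. }
  revert B c s; induction A as [|a A IH]; intros [|b B] c s HL HS Hs HP;
    try discriminate.
  - simpl; assert (0 < Rpower t c) by apply exp_pos; assert (0 <= - ln t * Rpower t c) by nra.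
    unfold list_Rsum; simpl; nra.
  - inversion HS as [|? ? HS' HR]; subst. inversion HR; subst.
    assert (H1 := HP 1%nat ltac:(simpl; lia)). unfold list_Rsum in H1; simpl in H1.
    (* The surplus after this pair is s + b - a, nonnegative by the prefix inequality for k = 1. As
       c <= b and t <= 1, the slope - t^b ln t is at most the slope at c, so the part due to s only
       gains when valued at c. *)
    specialize (IH B b (s + b - a) ltac:(simpl in HL; lia) HS' ltac:(lra)).
    assert (IH' : 0 <= list_Rsum (map (Rpower t) A) - list_Rsum (map (Rpower t) B)
              + - ln t * Rpower t b * (s + b - a)).
    { apply IH; intros k Hk. specialize (HP (S k) ltac:(simpl; lia)).
      unfold list_Rsum in *; simpl in HP. lra. }
    pose proof (Rpower_tangent t a b) as HT.
    assert (Hbc : Rpower t b <= Rpower t c).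
    { unfold Rpower. destruct (Req_dec ((b - c) * ln t) 0).
      - right; f_equal; nra.
      - left; apply exp_increasing; nra. }
    assert (- ln t * Rpower t b * s <= - ln t * Rpower t c * s).
    { apply Rmult_le_compat_r; [lra|]. apply Rmult_le_compat_l; lra. }
    unfold list_Rsum in *; simpl. lra.
Qed.

Lemma weak_supermajorization_v_fun (A B : list R) (t : R) :
  weak_supermajorization B A -> 0 < t <= 1 -> 0 <= v_fun A B t.
Proof.
  intros [HL [_ [_ [A' [B' [HA [HB [_ [SB HP]]]]]]]]] Ht.
  assert (HLA := Permutation_length HA). assert (HLB := Permutation_length HB).
  rewrite v_fun_sums by assumption.
  rewrite (list_Rsum_Permutation _ _ (Permutation_map (Rpower t) HA)).
  rewrite (list_Rsum_Permutation _ _ (Permutation_map (Rpower t) HB)).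
  destruct B' as [|b B'].
  - destruct A'; simpl in *; [unfold list_Rsum; simpl; lra|lia].
  - enough (0 <= list_Rsum (map (Rpower t) A') - list_Rsum (map (Rpower t) (b :: B'))
       + - ln t * Rpower t b * 0) by lra.
    apply Rpower_sum_surplus; try lia; try lra.
    + constructor; [assumption|constructor; lra].
    + intros k Hk. specialize (HP k ltac:(lia)). lra.
Qed.

(** * Complex differentiability *)

(** The derivative condition written with [Cmod], free of filters and of the choice of a
    normed-module structure on C. *)
Definition cderiv (f : C -> C) (z l : C) : Prop :=
  forall eps, 0 < eps -> exists delta, 0 < delta /\
    forall w : C, Cmod (w - z) < delta ->
      Cmod (f w - f z - l * (w - z))%C <= eps * Cmod (w - z).

Definition cdiff (f : C -> C) (z : C) : Prop := exists l, cderiv f z l.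

Lemma cderiv_is_derive (f : C -> C) (z l : C) :
  cderiv f z l <->
  is_derive (K := C_AbsRing) (V := AbsRing_NormedModule C_AbsRing) f z l.
Proof.
  split.
  - intros H. split; [apply is_linear_scal_l|].
    intros x Hx.
    assert (x = z) as ->.
    { symmetry. apply (is_filter_lim_locally_unique (V := AbsRing_NormedModule C_AbsRing)) in Hx. exact Hx. }
    intros eps. destruct (H eps (cond_pos eps)) as [d [Hd Hd']].
    exists (mkposreal d Hd). intros w Hw.
    specialize (Hd' w Hw).
    change (Cmod ((f w - f z) - (w - z) * l)%C <= eps * Cmod (w - z)).
    replace ((f w - f z) - (w - z) * l)%C with (f w - f z - l * (w - z))%C by ring.
    exact Hd'.
  - intros [_ H] eps He.
    assert (HH : is_filter_lim (locally (T := AbsRing_NormedModule C_AbsRing) z) z) by (intros P HP; exact HP).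
    specialize (H z HH (mkposreal eps He)). destruct H as [d Hd].
    exists d; split; [apply cond_pos|]. intros w Hw. specialize (Hd w Hw).
    change (Cmod ((f w - f z) - (w - z) * l)%C <= eps * Cmod (w - z)) in Hd.
    replace ((f w - f z) - l * (w - z))%C with (f w - f z - (w - z) * l)%C by ring.
    exact Hd.
Qed.

(** The two normed-module structures on C agree up to conversion, but linearity is a record indexed
    by them, so it is rebuilt field by field. *)
Lemma cdiff_ex_derive (f : C -> C) (z : C) :
  cdiff f z <-> ex_derive (K := C_AbsRing) (V := C_NormedModule) f z.
Proof.
  split; intros [l H]; exists l.
  - apply cderiv_is_derive in H. destruct H as [H1 H2]. split.
    + destruct H1 as [Ha Hb Hc]. constructor; assumption.
    + exact H2.
  - apply cderiv_is_derive. destruct H as [H1 H2]. split.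
    + destruct H1 as [Ha Hb Hc]. constructor; assumption.
    + exact H2.
Qed.

Lemma cderiv_const (k z : C) : cderiv (fun _ => k) z 0.
Proof. apply cderiv_is_derive, (is_derive_const (K := C_AbsRing) (V := AbsRing_NormedModule C_AbsRing)). Qed.

Lemma cderiv_id (z : C) : cderiv (fun w => w) z 1.
Proof. apply cderiv_is_derive, (is_derive_id (K := C_AbsRing)). Qed.

Lemma cderiv_plus (f g : C -> C) (z l m : C) :
  cderiv f z l -> cderiv g z m -> cderiv (fun w => f w + g w)%C z (l + m)%C.
Proof.
  intros Hf Hg; apply cderiv_is_derive in Hf, Hg; apply cderiv_is_derive.
  exact (is_derive_plus _ _ _ _ _ Hf Hg).
Qed.

Lemma cderiv_mult (f g : C -> C) (z l m : C) :
  cderiv f z l -> cderiv g z m ->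
  cderiv (fun w => f w * g w)%C z (l * g z + f z * m)%C.
Proof.
  intros Hf Hg; apply cderiv_is_derive in Hf, Hg; apply cderiv_is_derive.
  exact (is_derive_mult (K := C_AbsRing) f g z l m Hf Hg Cmult_comm).
Qed.

Lemma cderiv_comp (f g : C -> C) (z l m : C) :
  cderiv f (g z) l -> cderiv g z m -> cderiv (fun w => f (g w)) z (m * l)%C.
Proof.
  intros Hf Hg; apply cderiv_is_derive in Hf, Hg; apply cderiv_is_derive.
  exact (is_derive_comp (K := C_AbsRing) (V := AbsRing_NormedModule C_AbsRing) f g z l m Hf Hg).
Qed.

Lemma Cmod_minus_sym (z w : C) : Cmod (z - w) = Cmod (w - z).
Proof. rewrite <- Cmod_opp; f_equal; ring. Qed.

Lemma Cmod_triangle_minus (z w : C) : Cmod z - Cmod w <= Cmod (z - w).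
Proof.
  pose proof (Cmod_triangle (z - w) w). replace (z - w + w)%C with z in H by ring. lra.
Qed.

Lemma Cmod_minus_le (z w : C) : Cmod (z - w) <= Cmod z + Cmod w.
Proof. unfold Cminus. rewrite <- (Cmod_opp w). apply Cmod_triangle. Qed.

(** With h = w - z the remainder is h^2 / (w z^2). The radius m / 2 keeps |w| above m / 2, and the
    other bound makes 2 |h| / m^3 at most eps. *)
Lemma cderiv_inv (z : C) : z <> 0 -> cderiv Cinv z (- (/ z * / z))%C.
Proof.
  intros Hz eps He. assert (Hm : 0 < Cmod z) by now apply Cmod_gt_0.
  set (m := Cmod z) in *.
  exists (Rmin (m / 2) (eps * (m * m * m) / 2)). split.
  { apply Rmin_glb_lt; [lra|]. assert (0 < m * m * m) by (repeat apply Rmult_lt_0_compat; lra). nra. }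
  intros w Hw.
  assert (H1 : Cmod (w - z) < m / 2) by (eapply Rlt_le_trans; [exact Hw|apply Rmin_l]).
  assert (H2 : Cmod (w - z) < eps * (m * m * m) / 2) by (eapply Rlt_le_trans; [exact Hw|apply Rmin_r]).
  pose proof (Cmod_triangle_minus z w) as H3. rewrite Cmod_minus_sym in H3. fold m in H3.
  assert (Hw0 : w <> 0) by (apply Cmod_gt_0; lra).
  replace (/ w - / z - - (/ z * / z) * (w - z))%C with ((w - z) * (w - z) * (/ w * (/ z * / z)))%C
    by (field; auto).
  rewrite !Cmod_mult, !Cmod_inv by assumption. fold m.
  set (h := Cmod (w - z)) in *. assert (0 <= h) by apply Cmod_ge_0.
  rewrite Rmult_assoc, Rmult_comm. apply Rmult_le_compat_r; [assumption|].
  assert (/ Cmod w <= 2 / m).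
  { replace (2 / m) with (/ (m / 2)) by (field; lra). apply Rinv_le_contravar; lra. }
  assert (0 < / m) by now apply Rinv_0_lt_compat.
  apply Rle_trans with (h * (2 / m * (/ m * / m))).
  - apply Rmult_le_compat_l; [assumption|]. apply Rmult_le_compat_r; nra.
  - replace eps with (eps * (m * m * m) / 2 * (2 / m * (/ m * / m))) by (field; lra).
    apply Rmult_le_compat_r; [|lra]. unfold Rdiv. repeat apply Rmult_le_pos; lra.
Qed.

Lemma cderiv_ext_loc (f g : C -> C) (z l : C) (d : R) :
  0 < d -> (forall w, Cmod (w - z) < d -> f w = g w) ->
  cderiv f z l -> cderiv g z l.
Proof.
  intros Hd E H eps He. destruct (H eps He) as [d' [Hd' H']].
  exists (Rmin d d'); split; [now apply Rmin_glb_lt|]. intros w Hw.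
  rewrite <- !E.
  - apply H'. eapply Rlt_le_trans; [exact Hw|apply Rmin_r].
  - replace (z - z)%C with (RtoC 0) by ring. now rewrite Cmod_0.
  - eapply Rlt_le_trans; [exact Hw|apply Rmin_l].
Qed.

Lemma cdiff_ext_loc (f g : C -> C) (z : C) (d : R) :
  0 < d -> (forall w, Cmod (w - z) < d -> f w = g w) -> cdiff f z -> cdiff g z.
Proof. intros Hd E [l H]; exists l; exact (cderiv_ext_loc f g z l d Hd E H). Qed.

Lemma cdiff_const (k z : C) : cdiff (fun _ => k) z.
Proof. eexists; apply cderiv_const. Qed.

Lemma cdiff_id (z : C) : cdiff (fun w => w) z.
Proof. eexists; apply cderiv_id. Qed.

Lemma cdiff_plus (f g : C -> C) (z : C) :
  cdiff f z -> cdiff g z -> cdiff (fun w => f w + g w)%C z.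
Proof. intros [l Hl] [m Hm]; eexists; apply cderiv_plus; eassumption. Qed.

Lemma cdiff_mult (f g : C -> C) (z : C) :
  cdiff f z -> cdiff g z -> cdiff (fun w => f w * g w)%C z.
Proof. intros [l Hl] [m Hm]; eexists; apply cderiv_mult; eassumption. Qed.

Lemma cdiff_opp (f : C -> C) (z : C) : cdiff f z -> cdiff (fun w => - f w)%C z.
Proof.
  intros Hf. apply cdiff_ext_loc with (fun w => (- RtoC 1) * f w)%C 1; [lra| |].
  - intros w _. ring.
  - apply cdiff_mult; [apply cdiff_const|exact Hf].
Qed.

Lemma cdiff_minus (f g : C -> C) (z : C) :
  cdiff f z -> cdiff g z -> cdiff (fun w => f w - g w)%C z.
Proof. intros Hf Hg. apply cdiff_plus; [exact Hf|now apply cdiff_opp]. Qed.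

Lemma cdiff_comp (f g : C -> C) (z : C) :
  cdiff f (g z) -> cdiff g z -> cdiff (fun w => f (g w)) z.
Proof. intros [l Hl] [m Hm]; eexists; apply cderiv_comp; eassumption. Qed.

Lemma cdiff_div (f g : C -> C) (z : C) :
  g z <> 0 -> cdiff f z -> cdiff g z -> cdiff (fun w => f w / g w)%C z.
Proof.
  intros Hz Hf Hg. apply cdiff_mult; [exact Hf|].
  apply (cdiff_comp Cinv); [eexists; now apply cderiv_inv|exact Hg].
Qed.

Lemma cdiff_pow (f : C -> C) (z : C) (n : nat) :
  cdiff f z -> cdiff (fun w => f w ^ n)%C z.
Proof.
  intros Hf; induction n as [|n IH]; simpl; [apply cdiff_const|now apply cdiff_mult].
Qed.

Definition ccont (f : C -> C) (z : C) : Prop :=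
  forall eps, 0 < eps -> exists delta, 0 < delta /\
    (forall w : C, Cmod (w - z) < delta -> Cmod (f w - f z)%C < eps).

Lemma cdiff_ccont (f : C -> C) (z : C) : cdiff f z -> ccont f z.
Proof.
  intros [l H] eps He. destruct (H 1 Rlt_0_1) as [d [Hd Hd']].
  assert (Hl := Cmod_ge_0 l).
  exists (Rmin d (eps / (Cmod l + 2))). split.
  { apply Rmin_glb_lt; [assumption|]. apply Rdiv_lt_0_compat; lra. }
  intros w Hw.
  specialize (Hd' w ltac:(eapply Rlt_le_trans; [exact Hw|apply Rmin_l])).
  assert (H2 : Cmod (w - z) < eps / (Cmod l + 2)) by (eapply Rlt_le_trans; [exact Hw|apply Rmin_r]).
  replace (f w - f z)%C with (f w - f z - l * (w - z) + l * (w - z))%C by ring.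
  eapply Rle_lt_trans; [apply Cmod_triangle|]. rewrite Cmod_mult.
  apply Rle_lt_trans with ((Cmod l + 2) * Cmod (w - z)).
  - pose proof (Cmod_ge_0 (w - z)). lra.
  - apply Rmult_lt_compat_l with (r := Cmod l + 2) in H2; [|lra].
    replace ((Cmod l + 2) * (eps / (Cmod l + 2))) with eps in H2 by (field; lra). exact H2.
Qed.

(** * Goursat's lemma *)

Lemma im_le_Cmod (z : C) : Rabs (Im z) <= Cmod z.
Proof. eapply Rle_trans; [apply Rmax_r|apply Rmax_Cmod]. Qed.

Lemma Cmod_le_sum (z : C) : Cmod z <= Rabs (Re z) + Rabs (Im z).
Proof.
  destruct z as [x y]. unfold Cmod; simpl. rewrite !Rmult_1_r.
  pose proof (Rabs_pos x). pose proof (Rabs_pos y).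
  rewrite <- (sqrt_square (Rabs x + Rabs y)) by lra.
  apply sqrt_le_1_alt.
  assert (x * x = Rabs x * Rabs x) by (rewrite <- Rabs_mult, Rabs_pos_eq; nra).
  assert (y * y = Rabs y * Rabs y) by (rewrite <- Rabs_mult, Rabs_pos_eq; nra).
  nra.
Qed.

Lemma Cmod_hor (s t y : R) : Cmod ((s, y) - (t, y))%C = Rabs (s - t).
Proof. replace ((s, y) - (t, y))%C with (RtoC (s - t)); [apply Cmod_R|]. apply injective_projections; simpl; ring. Qed.

Lemma Cmod_ver (s t x : R) : Cmod ((x, s) - (x, t))%C = Rabs (s - t).
Proof.
  replace ((x, s) - (x, t))%C with (Ci * RtoC (s - t))%C; [|apply injective_projections; simpl; ring].
  rewrite Cmod_mult, Cmod_Ci, Cmod_R; ring.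
Qed.

Lemma ccont_path (f : C -> C) (g : R -> C) (s : R) :
  (forall t, Cmod (g t - g s)%C <= Rabs (t - s)) -> ccont f (g s) ->
  continuous (fun t => Re (f (g t))) s /\ continuous (fun t => Im (f (g t))) s.
Proof.
  intros Hg Hf.
  assert (H : forall (pr : C -> R), (forall z w, Rabs (pr z - pr w) <= Cmod (z - w)%C) ->
     continuous (fun t => pr (f (g t))) s).
  { intros pr Hpr P [e He]. destruct (Hf e (cond_pos e)) as [d [Hd Hd']].
    exists (mkposreal d Hd). intros t Ht. apply He.
    change (Rabs (pr (f (g t)) - pr (f (g s))) < e).
    eapply Rle_lt_trans; [apply Hpr|]. apply Hd'.
    eapply Rle_lt_trans; [apply Hg|]. exact Ht. }
  split; apply H; intros z w.
  - apply (re_le_Cmod (z - w)).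
  - apply (im_le_Cmod (z - w)).
Qed.

Definition rect_cont (f : C -> C) (a b c d : R) : Prop :=
  forall x y, a <= x <= b -> c <= y <= d -> ccont f (x, y).

(* Imaginary part of the integral of [f] along the boundary of the rectangle
   [a,b] x [c,d], traversed counterclockwise. *)
Definition rect_int (f : C -> C) (a b c d : R) : R :=
  RInt (fun x => Im (f (x, c)) - Im (f (x, d))) a b +
  RInt (fun y => Re (f (b, y)) - Re (f (a, y))) c d.

Lemma ex_RInt_hor (f : C -> C) (a b y : R) :
  a <= b -> (forall x, a <= x <= b -> ccont f (x, y)) ->
  ex_RInt (fun x => Im (f (x, y))) a b.
Proof.
  intros Hab H. apply (ex_RInt_continuous (V := R_CompleteNormedModule)).
  rewrite Rmin_left, Rmax_right by assumption. intros x Hx.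
  apply (ccont_path f (fun t => (t, y))); [|now apply H].
  intros t; rewrite Cmod_hor; apply Rle_refl.
Qed.

Lemma ex_RInt_ver (f : C -> C) (c d x : R) :
  c <= d -> (forall y, c <= y <= d -> ccont f (x, y)) ->
  ex_RInt (fun y => Re (f (x, y))) c d.
Proof.
  intros Hab H. apply (ex_RInt_continuous (V := R_CompleteNormedModule)).
  rewrite Rmin_left, Rmax_right by assumption. intros y Hx.
  apply (ccont_path f (fun t => (x, t))); [|now apply H].
  intros t; rewrite Cmod_ver; apply Rle_refl.
Qed.

Lemma ex_RInt_Rminus (f g : R -> R) (a b : R) :
  ex_RInt f a b -> ex_RInt g a b -> ex_RInt (fun x => f x - g x) a b.
Proof. intros Hf Hg; exact (ex_RInt_minus f g a b Hf Hg). Qed.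

Lemma RInt_Rminus (f g : R -> R) (a b : R) :
  ex_RInt f a b -> ex_RInt g a b ->
  RInt (fun x => f x - g x) a b = RInt f a b - RInt g a b.
Proof. intros Hf Hg; exact (RInt_minus f g a b Hf Hg). Qed.

Lemma RInt_Chasles_R (f : R -> R) (a m b : R) :
  ex_RInt f a m -> ex_RInt f m b -> RInt f a b = RInt f a m + RInt f m b.
Proof. intros H1 H2; symmetry; exact (RInt_Chasles f a m b H1 H2). Qed.

Lemma rect_int_split_x (f : C -> C) (a m b c d : R) :
  a <= m <= b -> c <= d -> rect_cont f a b c d ->
  rect_int f a b c d = rect_int f a m c d + rect_int f m b c d.
Proof.
  intros Hm Hcd Hf. unfold rect_int.
  assert (Hh : forall y s t, c <= y <= d -> a <= s -> s <= t -> t <= b -> ex_RInt (fun x => Im (f (x, y))) s t).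
  { intros; apply ex_RInt_hor; [lra|]; intros; apply Hf; lra. }
  assert (Hv : forall x, a <= x <= b -> ex_RInt (fun y => Re (f (x, y))) c d).
  { intros; apply ex_RInt_ver; [lra|]; intros; apply Hf; lra. }
  rewrite (RInt_Chasles_R (fun x => Im (f (x, c)) - Im (f (x, d))) a m b)
    by (apply ex_RInt_Rminus; apply Hh; lra).
  rewrite !(RInt_Rminus (fun y => Re (f (_, y)))) by (apply Hv; lra). ring.
Qed.

Lemma rect_int_split_y (f : C -> C) (a b c m d : R) :
  a <= b -> c <= m <= d -> rect_cont f a b c d ->
  rect_int f a b c d = rect_int f a b c m + rect_int f a b m d.
Proof.
  intros Hab Hm Hf. unfold rect_int.
  assert (Hh : forall y, c <= y <= d -> ex_RInt (fun x => Im (f (x, y))) a b).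
  { intros; apply ex_RInt_hor; [lra|]; intros; apply Hf; lra. }
  assert (Hv : forall x s t, a <= x <= b -> c <= s -> s <= t -> t <= d -> ex_RInt (fun y => Re (f (x, y))) s t).
  { intros; apply ex_RInt_ver; [lra|]; intros; apply Hf; lra. }
  rewrite (RInt_Chasles_R (fun y => Re (f (b, y)) - Re (f (a, y))) c m d)
    by (apply ex_RInt_Rminus; apply Hv; lra).
  rewrite !(RInt_Rminus (fun x => Im (f (x, _)))) by (apply Hh; lra). ring.
Qed.

Lemma RInt_near_const (f : R -> R) (a b k M : R) :
  a <= b -> ex_RInt f a b -> (forall x, a <= x <= b -> Rabs (f x - k) <= M) ->
  Rabs (RInt f a b - k * (b - a)) <= M * (b - a).
Proof.
  intros Hab Hf HM. rewrite (Rmult_comm M), (Rmult_comm k).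
  apply (norm_RInt_le_const (V := R_NormedModule) (fun x => f x - k) a b); [assumption|exact HM|].
  apply (is_RInt_minus (V := R_NormedModule) f (fun _ => k) a b (RInt f a b) ((b - a) * k)).
  - now apply (RInt_correct (V := R_CompleteNormedModule)).
  - apply (is_RInt_const (V := R_NormedModule)).
Qed.

(* Affine functions have boundary integral zero, so only the distance to one matters. *)
Lemma rect_int_near_affine (f : C -> C) (a b c d M : R) (u l v : C) :
  a <= b -> c <= d -> rect_cont f a b c d ->
  (forall x y, a <= x <= b -> c <= y <= d -> (x = a \/ x = b \/ y = c \/ y = d) ->
     Cmod (f (x, y) - u - l * ((x, y) - v))%C <= M) ->
  Rabs (rect_int f a b c d) <= 2 * M * ((b - a) + (d - c)).
Proof.
  intros Hab Hcd Hf HM. unfold rect_int.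
  assert (Hh : forall y, c <= y <= d -> ex_RInt (fun x => Im (f (x, y))) a b).
  { intros; apply ex_RInt_hor; [lra|]; intros; apply Hf; lra. }
  assert (Hv : forall x, a <= x <= b -> ex_RInt (fun y => Re (f (x, y))) c d).
  { intros; apply ex_RInt_ver; [lra|]; intros; apply Hf; lra. }
  pose proof (RInt_near_const (fun x => Im (f (x, c)) - Im (f (x, d))) a b (Re l * (c - d)) (2 * M) Hab) as H1.
  pose proof (RInt_near_const (fun y => Re (f (b, y)) - Re (f (a, y))) c d (Re l * (b - a)) (2 * M) Hcd) as H2.
  (* The main terms Re l (c - d) (b - a) and Re l (b - a) (d - c) cancel; only the two errors
     remain. *)
  cut (Rabs (RInt (fun x => Im (f (x, c)) - Im (f (x, d))) a b - Re l * (c - d) * (b - a)) <= 2 * M * (b - a)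
     /\ Rabs (RInt (fun y => Re (f (b, y)) - Re (f (a, y))) c d - Re l * (b - a) * (d - c)) <= 2 * M * (d - c)).
  { intros [E1 E2]. apply Rabs_le_between in E1, E2. apply Rabs_le_between. nra. }
  split; [apply H1|apply H2].
  - apply ex_RInt_Rminus; apply Hh; lra.
  - intros x Hx.
    assert (P := HM x c Hx ltac:(lra) ltac:(auto)). assert (Q := HM x d Hx ltac:(lra) ltac:(auto)).
    set (p := (f (x, c) - u - l * ((x, c) - v))%C) in *.
    set (q := (f (x, d) - u - l * ((x, d) - v))%C) in *.
    replace (Im (f (x, c)) - Im (f (x, d)) - Re l * (c - d)) with (Im (p - q)%C).
    { eapply Rle_trans; [apply im_le_Cmod|]. eapply Rle_trans; [apply Cmod_minus_le|]. lra. }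
    unfold p, q, Cminus, Cplus, Copp, Cmult, Re, Im; simpl; ring.
  - apply ex_RInt_Rminus; apply Hv; lra.
  - intros y Hy.
    assert (P := HM a y ltac:(lra) Hy ltac:(auto)). assert (Q := HM b y ltac:(lra) Hy ltac:(auto)).
    set (p := (f (a, y) - u - l * ((a, y) - v))%C) in *.
    set (q := (f (b, y) - u - l * ((b, y) - v))%C) in *.
    replace (Re (f (b, y)) - Re (f (a, y)) - Re l * (b - a)) with (Re (q - p)%C).
    { eapply Rle_trans; [apply re_le_Cmod|]. eapply Rle_trans; [apply Cmod_minus_le|]. lra. }
    unfold p, q, Cminus, Cplus, Copp, Cmult, Re, Im; simpl; ring.
Qed.

Lemma half_pow_small (K e : R) : 0 < e -> exists n : nat, K / 2 ^ n < e.
Proof.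
  intros He. destruct (pow_lt_1_zero (/ 2) ltac:(rewrite Rabs_pos_eq; lra) (e / (Rabs K + 1))) as [n Hn].
  { pose proof (Rabs_pos K). apply Rdiv_lt_0_compat; lra. }
  exists n. specialize (Hn n (le_n n)). pose proof (Rabs_pos K).
  rewrite Rabs_pos_eq in Hn by (apply pow_le; lra).
  apply Rle_lt_trans with ((Rabs K + 1) * (/ 2) ^ n).
  - unfold Rdiv. rewrite pow_inv. apply Rmult_le_compat_r.
    + left; apply Rinv_0_lt_compat, pow_lt; lra.
    + pose proof (Rle_abs K); lra.
  - apply Rmult_lt_compat_l with (r := Rabs K + 1) in Hn; [|lra].
    replace ((Rabs K + 1) * (e / (Rabs K + 1))) with e in Hn by (field; lra). exact Hn.
Qed.

(** [x n] is the left end of the n-th of nested intervals of length w / 2^n, and l is a common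
    point. *)
Lemma nested_limit (x : nat -> R) (w : R) :
  0 <= w -> (forall n, x n <= x (S n) <= x n + w / 2 ^ (S n)) ->
  exists l, forall n, x n <= l <= x n + w / 2 ^ n.
Proof.
  intros Hw Hx.
  assert (H : forall n k, x n <= x (n + k)%nat <= x n + w / 2 ^ n - w / 2 ^ (n + k)).
  { intros n k; induction k as [|k IH].
    - rewrite Nat.add_0_r; lra.
    - rewrite Nat.add_succ_r. specialize (Hx (n + k)%nat).
      replace (w / 2 ^ (n + k)) with (2 * (w / 2 ^ S (n + k))) in IH
        by (simpl; field; apply pow_nonzero; lra). lra. }
  assert (Hpos : forall n, 0 <= w / 2 ^ n).
  { intros n; apply Rdiv_le_0_compat; [lra|apply pow_lt; lra]. }
  destruct (ex_finite_lim_seq_incr x (x 0%nat + w)) as [l Hl].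
  - intros n; apply Hx.
  - intros n; specialize (H 0%nat n); simpl in H. specialize (Hpos n). lra.
  - exists l; intros n. apply (is_lim_seq_incr_n x n) in Hl. split.
    + refine (is_lim_seq_le (fun _ => x n) _ (x n) l _ (is_lim_seq_const _) Hl).
      intros k; rewrite Nat.add_comm; apply H.
    + refine (is_lim_seq_le _ (fun _ => x n + w / 2 ^ n) l (x n + w / 2 ^ n) _ Hl (is_lim_seq_const _)).
      intros k; rewrite Nat.add_comm; destruct (H n k); specialize (Hpos (n + k)%nat); lra.
Qed.

(** Bisection: an integral exceeding e times the squared half-perimeter hands this property down to
    one of the four quarters, while differentiability at the common point rules it out for small
    rectangles. *)
Lemma goursat (f : C -> C) (a b c d : R) :
  a <= b -> c <= d ->
  (forall x y, a <= x <= b -> c <= y <= d -> cdiff f (x, y)) ->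
  rect_int f a b c d = 0.
Proof.
  intros Hab Hcd Hf. destruct (Req_dec (rect_int f a b c d) 0) as [h|h]; [exact h|exfalso].
  assert (Hc : rect_cont f a b c d) by (intros x y Hx Hy; now apply cdiff_ccont, Hf).
  set (w := b - a). set (t := d - c). set (L := w + t).
  assert (Hw : 0 <= w) by (unfold w; lra). assert (Ht : 0 <= t) by (unfold t; lra).
  assert (He : exists e, 0 < e /\ e * L ^ 2 < Rabs (rect_int f a b c d)).
  { apply Rabs_pos_lt in h. exists (Rabs (rect_int f a b c d) / (2 * (L ^ 2 + 1))).
    assert (0 <= L ^ 2) by apply pow2_ge_0. split; [apply Rdiv_lt_0_compat; lra|].
    set (Q := L ^ 2) in *. set (A := Rabs _) in *.
    assert (0 < A / (2 * (Q + 1))) by (apply Rdiv_lt_0_compat; lra).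
    assert (A / (2 * (Q + 1)) * (2 * (Q + 1)) = A) by (field; lra).
    nra. }
  destruct He as [e [He HeL]].
  (* p is the lower left corner of a rectangle of generation n. *)
  set (bad := fun (n : nat) (p : R * R) =>
     a <= fst p /\ fst p + w / 2 ^ n <= b /\ c <= snd p /\ snd p + t / 2 ^ n <= d /\
     e * (L / 2 ^ n) ^ 2 <
       Rabs (rect_int f (fst p) (fst p + w / 2 ^ n) (snd p) (snd p + t / 2 ^ n))).
  assert (step : forall n p, bad n p -> exists p', bad (S n) p' /\
     fst p <= fst p' <= fst p + w / 2 ^ (S n) /\ snd p <= snd p' <= snd p + t / 2 ^ (S n)).
  { intros n [x y] (B1 & B2 & B3 & B4 & B5); simpl fst in *; simpl snd in *.
    assert (P2 : 0 < 2 ^ S n) by (apply pow_lt; lra).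
    assert (W : w / 2 ^ n = w / 2 ^ S n + w / 2 ^ S n) by (simpl; field; apply pow_nonzero; lra).
    assert (T : t / 2 ^ n = t / 2 ^ S n + t / 2 ^ S n) by (simpl; field; apply pow_nonzero; lra).
    assert (LL : L / 2 ^ n = L / 2 ^ S n + L / 2 ^ S n) by (simpl; field; apply pow_nonzero; lra).
    rewrite W in B2, B5. rewrite T in B4, B5. rewrite LL in B5.
    assert (W0 : 0 <= w / 2 ^ S n) by (apply Rdiv_le_0_compat; lra).
    assert (T0 : 0 <= t / 2 ^ S n) by (apply Rdiv_le_0_compat; lra).
    unfold bad.
    set (W1 := w / 2 ^ S n) in *. set (T1 := t / 2 ^ S n) in *. set (L1 := L / 2 ^ S n) in *.
    clearbody W1 T1 L1.
    rewrite <- !Rplus_assoc in B5.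
    rewrite (rect_int_split_x f x (x + W1)) in B5 by (try lra; intros u v Hu Hv; apply Hc; lra).
    rewrite (rect_int_split_y f x (x + W1) y (y + T1)) in B5
      by (try lra; intros u v Hu Hv; apply Hc; lra).
    rewrite (rect_int_split_y f (x + W1) (x + W1 + W1) y (y + T1)) in B5
      by (try lra; intros u v Hu Hv; apply Hc; lra).
    apply NNPP; intros N.
    assert (N' : forall p : R * R, fst p = x \/ fst p = x + W1 -> snd p = y \/ snd p = y + T1 ->
      Rabs (rect_int f (fst p) (fst p + W1) (snd p) (snd p + T1)) <= e * L1 ^ 2).
    { intros p Hp1 Hp2. apply Rnot_lt_le; intros K. apply N. exists p. repeat split; lra. }
    pose proof (N' (x, y)) as N1; pose proof (N' (x + W1, y)) as N2.
    pose proof (N' (x, y + T1)) as N3; pose proof (N' (x + W1, y + T1)) as N4.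
    simpl fst in *; simpl snd in *.
    specialize (N1 ltac:(auto) ltac:(auto)). specialize (N2 ltac:(auto) ltac:(auto)).
    specialize (N3 ltac:(auto) ltac:(auto)). specialize (N4 ltac:(auto) ltac:(auto)).
    apply Rabs_le_between in N1, N2, N3, N4.
    (* 4 e L1^2 = e (2 L1)^2, so the four quarters cannot all be small. *)
    apply Rlt_not_le in B5; apply B5. apply Rabs_le_between. nra. }
  assert (bad0 : bad 0%nat (a, c)).
  { unfold bad; simpl fst; simpl snd. rewrite !pow_O, !Rdiv_1_r.
    replace (a + w) with b by (unfold w; ring). replace (c + t) with d by (unfold t; ring).
    repeat split; lra. }
  (* Dependent choice: each corner travels with its proof of [bad], which [step] requires. *)
  set (next := fun n (p : {p | bad n p}) =>
    exist (bad (S n)) (proj1_sig (constructive_indefinite_description _ (step n _ (proj2_sig p))))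
      (proj1 (proj2_sig (constructive_indefinite_description _ (step n _ (proj2_sig p)))))).
  set (sq := nat_rect (fun n => {p | bad n p}) (exist _ (a, c) bad0) next).
  set (P := fun n => proj1_sig (sq n)).
  assert (HP : forall n, bad n (P n)) by (intros n; exact (proj2_sig (sq n))).
  assert (HS : forall n, fst (P n) <= fst (P (S n)) <= fst (P n) + w / 2 ^ (S n) /\
                         snd (P n) <= snd (P (S n)) <= snd (P n) + t / 2 ^ (S n)).
  { intros n. exact (proj2 (proj2_sig (constructive_indefinite_description _ (step n _ (proj2_sig (sq n)))))). }
  destruct (nested_limit (fun n => fst (P n)) w Hw (fun n => proj1 (HS n))) as [x0 Hx0].
  destruct (nested_limit (fun n => snd (P n)) t Ht (fun n => proj2 (HS n))) as [y0 Hy0].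
  clearbody P. clear sq next step h HeL bad0 HS.
  assert (Hz : cdiff f (x0, y0)).
  { apply Hf; [destruct (HP 0%nat) as (?&?&?&?&?), (Hx0 0%nat)|destruct (HP 0%nat) as (?&?&?&?&?), (Hy0 0%nat)]; lra. }
  (* [rect_int_near_affine] doubles the deviation, hence e / 2: with M = (e / 2) (L / 2^n) its bound
     is exactly e (L / 2^n)^2. *)
  destruct Hz as [l Hl]. destruct (Hl (e / 2) ltac:(lra)) as [dl [Hdl Hl']].
  destruct (half_pow_small L dl Hdl) as [n Hn].
  destruct (HP n) as (B1 & B2 & B3 & B4 & B5). specialize (Hx0 n). specialize (Hy0 n). simpl in Hx0, Hy0.
  assert (P2 : 0 < 2 ^ n) by (apply pow_lt; lra).
  assert (W0 : 0 <= w / 2 ^ n) by (apply Rdiv_le_0_compat; lra).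
  assert (T0 : 0 <= t / 2 ^ n) by (apply Rdiv_le_0_compat; lra).
  assert (LL : L / 2 ^ n = w / 2 ^ n + t / 2 ^ n) by (unfold L; field; lra).
  pose proof (rect_int_near_affine f (fst (P n)) (fst (P n) + w / 2 ^ n) (snd (P n)) (snd (P n) + t / 2 ^ n)
     (e / 2 * (L / 2 ^ n)) (f (x0, y0)) l (x0, y0) ltac:(lra) ltac:(lra)) as K.
  apply Rlt_not_le in B5; apply B5.
  replace (e * (L / 2 ^ n) ^ 2) with (2 * (e / 2 * (L / 2 ^ n)) *
     (fst (P n) + w / 2 ^ n - fst (P n) + (snd (P n) + t / 2 ^ n - snd (P n)))) by (rewrite LL; field; lra).
  apply K.
  - intros u v Hu Hv; apply Hc; lra.
  - intros x y Hx Hy _.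
    assert (D : Cmod ((x, y) - (x0, y0))%C <= L / 2 ^ n).
    { eapply Rle_trans; [apply Cmod_le_sum|]. simpl. rewrite LL.
      apply Rplus_le_compat; apply Rabs_le_between; lra. }
    eapply Rle_trans; [apply Hl'; lra|]. apply Rmult_le_compat_l; lra.
Qed.

(** * The identity theorem *)

(** A square of side 2h around (p, q) is cut out. The four rectangles left over contribute nothing
    by Goursat's lemma, and the square at most 8 M h by continuity, for arbitrarily small h. *)
Lemma goursat_except_point (f : C -> C) (a b c d p q : R) :
  a < p < b -> c < q < d -> rect_cont f a b c d ->
  (forall x y, a <= x <= b -> c <= y <= d -> x <> p \/ y <> q -> cdiff f (x, y)) ->
  rect_int f a b c d = 0.
Proof.
  intros Hp Hq Hc Hf.
  destruct (Hc p q ltac:(lra) ltac:(lra) 1 Rlt_0_1) as [d0 [Hd0 Hd]].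
  set (M := Cmod (f (p, q)) + 1). assert (HM : 1 <= M) by (unfold M; pose proof (Cmod_ge_0 (f (p, q))); lra).
  (* m keeps the square inside the rectangle and inside the disc of radius d0, where |f| <= M. *)
  set (m := Rmin (Rmin (p - a) (b - p)) (Rmin (Rmin (q - c) (d - q)) (d0 / 4))).
  assert (Hm : 0 < m /\ m <= p - a /\ m <= b - p /\ m <= q - c /\ m <= d - q /\ m <= d0 / 4).
  { unfold m; repeat split.
    - repeat apply Rmin_glb_lt; lra.
    - eapply Rle_trans; [apply Rmin_l|apply Rmin_l].
    - eapply Rle_trans; [apply Rmin_l|apply Rmin_r].
    - eapply Rle_trans; [apply Rmin_r|]. eapply Rle_trans; [apply Rmin_l|apply Rmin_l].
    - eapply Rle_trans; [apply Rmin_r|]. eapply Rle_trans; [apply Rmin_l|apply Rmin_r].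
    - eapply Rle_trans; [apply Rmin_r|apply Rmin_r]. }
  clearbody m.
  assert (K : forall h, 0 < h <= m -> Rabs (rect_int f a b c d) <= 8 * M * h).
  { intros h Hh.
    rewrite (rect_int_split_x f a (p - h) b c d) by (try lra; intros u v Hu Hv; apply Hc; lra).
    rewrite (rect_int_split_x f (p - h) (p + h) b c d) by (try lra; intros u v Hu Hv; apply Hc; lra).
    rewrite (rect_int_split_y f (p - h) (p + h) c (q - h) d) by (try lra; intros u v Hu Hv; apply Hc; lra).
    rewrite (rect_int_split_y f (p - h) (p + h) (q - h) (q + h) d) by (try lra; intros u v Hu Hv; apply Hc; lra).
    rewrite (goursat f a (p - h) c d), (goursat f (p + h) b c d), (goursat f (p - h) (p + h) c (q - h)),
      (goursat f (p - h) (p + h) (q + h) d) by (try lra; intros; apply Hf; lra).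
    pose proof (rect_int_near_affine f (p - h) (p + h) (q - h) (q + h) M 0 0 0 ltac:(lra) ltac:(lra)) as B.
    replace (8 * M * h) with (2 * M * (p + h - (p - h) + (q + h - (q - h)))) by ring.
    rewrite !Rplus_0_l, !Rplus_0_r. apply B.
    - intros u v Hu Hv; apply Hc; lra.
    - intros x y Hx Hy _. replace (f (x, y) - 0 - 0 * ((x, y) - 0))%C with (f (p, q) + (f (x, y) - f (p, q)))%C by ring.
      eapply Rle_trans; [apply Cmod_triangle|]. unfold M. apply Rplus_le_compat_l.
      left; apply Hd. eapply Rle_lt_trans; [apply Cmod_le_sum|]. simpl.
      apply Rle_lt_trans with (h + h); [|lra]. apply Rplus_le_compat; apply Rabs_le_between; lra. }
  destruct (Req_dec (rect_int f a b c d) 0) as [E|E]; [exact E|exfalso].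
  apply Rabs_pos_lt in E. set (J := Rabs (rect_int f a b c d)) in *.
  assert (Hk := K (Rmin m (J / (16 * M)))).
  assert (0 < J / (16 * M)) by (apply Rdiv_lt_0_compat; lra).
  assert (0 < Rmin m (J / (16 * M)) <= m) by (split; [apply Rmin_glb_lt; lra|apply Rmin_l]).
  specialize (Hk H0). pose proof (Rmin_r m (J / (16 * M))) as R1.
  apply Rmult_le_compat_l with (r := 8 * M) in R1; [|lra].
  replace (8 * M * (J / (16 * M))) with (J / 2) in R1 by (field; lra). lra.
Qed.

Definition diff_quot (h : C -> C) (w l z : C) : C :=
  if excluded_middle_informative (z = w) then l else ((h z - h w) / (z - w))%C.

Lemma diff_quot_neq (h : C -> C) (w l z : C) :
  z <> w -> diff_quot h w l z = ((h z - h w) / (z - w))%C.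
Proof.
  intros N; unfold diff_quot; destruct (excluded_middle_informative (z = w)); [contradiction|reflexivity].
Qed.

Lemma diff_quot_ccont (h : C -> C) (w l : C) : cderiv h w l -> ccont (diff_quot h w l) w.
Proof.
  intros H e He. destruct (H (e / 2) ltac:(lra)) as [d [Hd Hd']].
  exists d; split; [exact Hd|]. intros z Hz. unfold diff_quot at 2.
  destruct (excluded_middle_informative (w = w)) as [_|N]; [|now elim N].
  unfold diff_quot. destruct (excluded_middle_informative (z = w)) as [_|N].
  - replace (l - l)%C with (RtoC 0) by ring. rewrite Cmod_0; lra.
  - assert (N' : (z - w)%C <> 0).
    { intros E; apply N. replace z with (z - w + w)%C by ring. rewrite E; ring. }
    replace ((h z - h w) / (z - w) - l)%C with ((h z - h w - l * (z - w)) / (z - w))%C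
      by (field; exact N').
    rewrite Cmod_div by exact N'. assert (0 < Cmod (z - w)) by now apply Cmod_gt_0.
    apply Rle_lt_trans with (e / 2); [|lra].
    apply Rmult_le_reg_r with (Cmod (z - w)); [assumption|].
    unfold Rdiv at 1. rewrite Rmult_assoc, Rinv_l by lra. rewrite Rmult_1_r. now apply Hd'.
Qed.

Lemma diff_quot_cdiff (h : C -> C) (w l z : C) : z <> w -> cdiff h z -> cdiff (diff_quot h w l) z.
Proof.
  intros N H.
  assert (N' : (z - w)%C <> 0).
  { intros E; apply N. replace z with (z - w + w)%C by ring. rewrite E; ring. }
  apply cdiff_ext_loc with (fun z => (h z - h w) / (z - w))%C (Cmod (z - w)).
  - now apply Cmod_gt_0.
  - intros u Hu. unfold diff_quot. destruct (excluded_middle_informative (u = w)) as [E|_]; [|reflexivity].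
    exfalso. subst u. rewrite Cmod_minus_sym in Hu. lra.
  - apply cdiff_div; [exact N'| |]; apply cdiff_minus; (apply cdiff_const || apply cdiff_id || exact H).
Qed.

Lemma continuous_segment_bounded (f : R -> R) (a b : R) :
  (forall x, a <= x <= b -> continuous f x) -> exists M, forall x, a <= x <= b -> Rabs (f x) <= M.
Proof.
  intros H. destruct (bounded_continuity (V := R_NormedModule) f a b H) as [M HM].
  exists M; intros x Hx; left; now apply HM.
Qed.

Lemma path_bounded (f : C -> C) (g : R -> C) (a b : R) :
  (forall s t, Cmod (g t - g s)%C <= Rabs (t - s)) ->
  (forall s, a <= s <= b -> ccont f (g s)) -> exists M, forall s, a <= s <= b -> Cmod (f (g s)) <= M.
Proof.
  intros Hg Hf.
  destruct (continuous_segment_bounded (fun t => Re (f (g t))) a b) as [M1 H1].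
  { intros x Hx; now apply ccont_path; [|apply Hf]. }
  destruct (continuous_segment_bounded (fun t => Im (f (g t))) a b) as [M2 H2].
  { intros x Hx; now apply ccont_path; [|apply Hf]. }
  exists (M1 + M2); intros s Hs. eapply Rle_trans; [apply Cmod_le_sum|].
  apply Rplus_le_compat; auto.
Qed.

(** Only the boundary has to be controlled, so compactness of a real interval, used on each side,
    suffices. *)
Lemma rect_boundary_bounded (f : C -> C) (a b c d : R) :
  a <= b -> c <= d -> rect_cont f a b c d ->
  exists M, forall x y, a <= x <= b -> c <= y <= d ->
    (x = a \/ x = b \/ y = c \/ y = d) -> Cmod (f (x, y)) <= M.
Proof.
  intros Hab Hcd Hf.
  assert (Hh : forall y, c <= y <= d -> exists M, forall x, a <= x <= b -> Cmod (f (x, y)) <= M).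
  { intros y Hy; apply (path_bounded f (fun t => (t, y))).
    - intros s t; rewrite Cmod_hor; lra.
    - intros s Hs; now apply Hf. }
  assert (Hv : forall x, a <= x <= b -> exists M, forall y, c <= y <= d -> Cmod (f (x, y)) <= M).
  { intros x Hx; apply (path_bounded f (fun t => (x, t))).
    - intros s t; rewrite Cmod_ver; lra.
    - intros s Hs; now apply Hf. }
  destruct (Hh c ltac:(lra)) as [M1 H1], (Hh d ltac:(lra)) as [M2 H2],
    (Hv a ltac:(lra)) as [M3 H3], (Hv b ltac:(lra)) as [M4 H4].
  exists (Rmax (Rmax M1 M2) (Rmax M3 M4)).
  pose proof (Rmax_l (Rmax M1 M2) (Rmax M3 M4)). pose proof (Rmax_r (Rmax M1 M2) (Rmax M3 M4)).
  pose proof (Rmax_l M1 M2). pose proof (Rmax_r M1 M2). pose proof (Rmax_l M3 M4). pose proof (Rmax_r M3 M4).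
  intros x y Hx Hy [-> | [-> | [-> | ->]]];
    [specialize (H3 y Hy)|specialize (H4 y Hy)|specialize (H1 x Hx)|specialize (H2 x Hx)]; lra.
Qed.

Lemma Cinv_re (x y : R) : Re (/ (x, y))%C = x / (x * x + y * y).
Proof. unfold Cinv, Re; simpl. now rewrite !Rmult_1_r. Qed.

Lemma Cinv_im (x y : R) : Im (/ (x, y))%C = - y / (x * x + y * y).
Proof. unfold Cinv, Im; simpl. now rewrite !Rmult_1_r. Qed.

(* Cauchy's formula at [w] for [f z = H z / H w * ((w - c) / (z - c)) ^ n]
   gives [f w = 1], while [f] is as small as we like on the boundary. *)
Lemma vanish_near (H : C -> C) (w c : C) (rho r : R) :
  0 < rho -> 0 < r -> (forall z, Cmod (z - w)%C <= 2 * rho -> cdiff H z) ->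
  Cmod (c - w)%C <= rho / 4 -> (forall z, Cmod (z - c)%C < r -> H z = 0) -> H w = 0.
Proof.
  intros Hrho Hr Hd Hcw H0.
  destruct (excluded_middle_informative (H w = 0)) as [h|h]; [exact h|exfalso].
  assert (Hwc : w <> c).
  { intros ->. apply h, H0. replace (c - c)%C with (RtoC 0) by ring. now rewrite Cmod_0. }
  assert (Hwc' : (w - c)%C <> 0).
  { intros E; apply Hwc. replace w with (w - c + c)%C by ring. rewrite E; ring. }
  destruct w as [p q] eqn:Ew. rewrite <- Ew in *.
  set (a := p - rho). set (b := p + rho). set (c' := q - rho). set (d := q + rho).
  assert (Hin : forall x y, a <= x <= b -> c' <= y <= d -> Cmod ((x, y) - w)%C <= 2 * rho).
  { intros x y Hx Hy. eapply Rle_trans; [apply Cmod_le_sum|]. rewrite Ew; simpl. unfold a, b, c', d in *.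
    replace (2 * rho) with (rho + rho) by ring. apply Rplus_le_compat; apply Rabs_le_between; lra. }
  assert (Hout : forall x y, a <= x <= b -> c' <= y <= d -> (x = a \/ x = b \/ y = c' \/ y = d) ->
     rho <= Cmod ((x, y) - w)%C).
  { intros x y Hx Hy E. assert (E' : (Rabs (x - p) = rho \/ Rabs (y - q) = rho)).
    { unfold a, b, c', d in E. destruct E as [-> | [-> | [-> | ->]]]; [left|left|right|right];
      [rewrite Rabs_left1|rewrite Rabs_pos_eq|rewrite Rabs_left1|rewrite Rabs_pos_eq]; lra. }
    rewrite Ew. destruct E' as [<-|<-].
    - apply (re_le_Cmod ((x, y) - (p, q))).
    - apply (im_le_Cmod ((x, y) - (p, q))). }
  destruct (rect_boundary_bounded H a b c' d) as [M HM].
  { unfold a, b; lra. } { unfold c', d; lra. }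
  { intros x y Hx Hy; apply cdiff_ccont, Hd, Hin; assumption. }
  assert (Hm : 0 < Cmod (H w)) by now apply Cmod_gt_0.
  (* This n makes |f| at most 1/4 on the boundary, where |w - c| / |z - c| is at most 1/2. *)
  destruct (half_pow_small (4 * M / Cmod (H w)) 1 Rlt_0_1) as [n Hn].
  set (f := fun z => (H z / H w * ((w - c) / (z - c)) ^ n)%C).
  assert (Hfw : f w = 1).
  { unfold f. replace ((w - c) / (w - c))%C with (RtoC 1) by (field; exact Hwc').
    rewrite Cpow_1_l. field. exact h. }
  assert (Hfd : forall z, Cmod (z - w)%C <= 2 * rho -> cdiff f z).
  (* The apparent pole at c is harmless: H vanishes on a disc around c, hence so does f. *)
  { intros z Hz. destruct (excluded_middle_informative (z = c)) as [->|N].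
    - apply cdiff_ext_loc with (fun _ => RtoC 0) r; [exact Hr| |apply cdiff_const].
      intros u Hu. unfold f. rewrite (H0 u Hu). unfold Cdiv. ring.
    - apply cdiff_mult.
      + apply cdiff_div; [exact h|now apply Hd|apply cdiff_const].
      + apply cdiff_pow, cdiff_div; [|apply cdiff_const|apply cdiff_minus; [apply cdiff_id|apply cdiff_const]].
        intros E; apply N. replace z with (z - c + c)%C by ring. rewrite E; ring. }
  assert (Hfb : forall x y, a <= x <= b -> c' <= y <= d -> (x = a \/ x = b \/ y = c' \/ y = d) ->
     Cmod (f (x, y) / ((x, y) - w))%C <= / (4 * rho)).
  { intros x y Hx Hy E. specialize (HM x y Hx Hy E). specialize (Hout x y Hx Hy E).
    set (z := (x, y)) in *.
    assert (Hzw : (z - w)%C <> 0) by (apply Cmod_gt_0; lra).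
    assert (Hzc : 3 * rho / 4 <= Cmod (z - c)%C).
    { pose proof (Cmod_triangle (z - c) (c - w)). replace (z - c + (c - w))%C with (z - w)%C in H1 by ring. lra. }
    assert (Hzc' : (z - c)%C <> 0) by (apply Cmod_gt_0; lra).
    rewrite Cmod_div by exact Hzw. unfold f. rewrite Cmod_mult, Cmod_pow, !Cmod_div by assumption.
    assert (R1 : Cmod (w - c)%C / Cmod (z - c)%C <= / 2).
    { apply Rmult_le_reg_r with (Cmod (z - c)); [lra|]. unfold Rdiv. rewrite Rmult_assoc, Rinv_l by lra.
      rewrite Cmod_minus_sym in Hcw. lra. }
    assert (R0 : 0 <= Cmod (w - c)%C / Cmod (z - c)%C) by (apply Rdiv_le_0_compat; [apply Cmod_ge_0|lra]).
    assert (R2 : (Cmod (w - c)%C / Cmod (z - c)%C) ^ n <= / 2 ^ n).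
    { rewrite <- pow_inv. apply pow_incr. lra. }
    assert (R3 : 0 <= (Cmod (w - c)%C / Cmod (z - c)%C) ^ n) by now apply pow_le.
    assert (M0 : 0 <= M) by (pose proof (Cmod_ge_0 (H z)); lra).
    assert (P2 : 0 < / 2 ^ n) by (apply Rinv_0_lt_compat, pow_lt; lra).
    assert (R4 : Cmod (H z) / Cmod (H w) * (Cmod (w - c)%C / Cmod (z - c)%C) ^ n <= / 4).
    { apply Rle_trans with (M / Cmod (H w) * / 2 ^ n).
      - apply Rmult_le_compat; [apply Rdiv_le_0_compat; [apply Cmod_ge_0|lra]|assumption| |assumption].
        apply Rmult_le_compat_r; [left; now apply Rinv_0_lt_compat|exact HM].
      - replace (4 * M / Cmod (H w) / 2 ^ n) with (4 * (M / Cmod (H w) * / 2 ^ n)) in Hn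
          by (field; split; try apply pow_nonzero; lra). lra. }
    unfold Rdiv at 1. rewrite Rinv_mult. apply Rmult_le_compat; [|left; apply Rinv_0_lt_compat; lra|exact R4|].
    - apply Rmult_le_pos; [apply Rdiv_le_0_compat; [apply Cmod_ge_0|lra]|assumption].
    - apply Rinv_le_contravar; lra. }
  destruct (Hfd w) as [l Hl].
  { replace (w - w)%C with (RtoC 0) by ring. rewrite Cmod_0; lra. }
  (* g is (f - 1) / (z - w) with its singularity removed, so its boundary integral is 0; but on the
     boundary it is close to -1 / (z - w), whose integral is -2 pi i. *)
  set (g := diff_quot f w l).
  assert (Hgc : rect_cont g a b c' d).
  { intros x y Hx Hy. destruct (excluded_middle_informative ((x, y) = w)) as [->|N].
    - now apply diff_quot_ccont.
    - now apply cdiff_ccont, diff_quot_cdiff; [|apply Hfd, Hin]. }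
  assert (Hint : rect_int g a b c' d = 0).
  { apply (goursat_except_point g a b c' d p q); [unfold a, b; lra|unfold c', d; lra|exact Hgc|].
    intros x y Hx Hy N. apply diff_quot_cdiff; [|now apply Hfd, Hin].
    rewrite Ew; intros E; injection E; intros; lra. }
  assert (Hg : forall x y, a <= x <= b -> c' <= y <= d -> (x = a \/ x = b \/ y = c' \/ y = d) ->
     Cmod (g (x, y) - - / (x - p, y - q)%R)%C <= / (4 * rho)).
  { intros x y Hx Hy E. assert (O := Hout x y Hx Hy E).
    assert (N : ((x, y) - w)%C <> 0) by (apply Cmod_gt_0; lra).
    unfold g. rewrite diff_quot_neq by (intros E'; apply N; rewrite E'; ring). rewrite Hfw. replace (x - p, y - q) with ((x, y) - w)%C by (rewrite Ew; apply injective_projections; simpl; ring).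
    replace ((f (x, y) - 1) / ((x, y) - w) - - / ((x, y) - w))%C with (f (x, y) / ((x, y) - w))%C by (field; exact N).
    now apply Hfb. }
  (* On a pair of opposite sides -1 / (z - w) contributes -2 rho / (s^2 + rho^2) <= -1 / rho, and
     the two errors add up to at most 1 / (2 rho). Over the length 2 rho each pair gives at most -1,
     so the total cannot be 0. *)
  assert (key : forall s, - rho <= s <= rho -> / rho <= 2 * rho / (s * s + rho * rho)).
  { intros s Hs. assert (0 < s * s + rho * rho) by nra.
    apply Rmult_le_reg_r with (s * s + rho * rho); [assumption|].
    unfold Rdiv. rewrite Rmult_assoc, Rinv_l by lra. rewrite Rmult_1_r.
    apply Rmult_le_reg_l with rho; [assumption|]. rewrite <- Rmult_assoc, Rinv_r by lra. nra. }
  assert (H4 : / (4 * rho) = / rho / 4) by (field; lra). rewrite H4 in Hg.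
  assert (Hir : 0 < / rho) by now apply Rinv_0_lt_compat.
  assert (I1 : RInt (fun x => Im (g (x, c')) - Im (g (x, d))) a b <= RInt (fun _ => - (/ rho / 2)) a b).
  { apply RInt_le; [unfold a, b; lra| |apply ex_RInt_const|].
    - apply ex_RInt_Rminus; (apply ex_RInt_hor; [unfold a, b; lra|]; intros x Hx; apply Hgc; [assumption|unfold c', d; lra]).
    - intros x Hx.
      assert (G1 := Hg x c' ltac:(lra) ltac:(unfold c', d; lra) ltac:(auto)).
      assert (G2 := Hg x d ltac:(lra) ltac:(unfold c', d; lra) ltac:(auto)).
      apply (Rle_trans _ _ _ (im_le_Cmod _)), Rabs_le_between in G1, G2.
      assert (D : forall z u : C, Im (z - - u)%C = Im z + Im u) by (intros; unfold Im; simpl; ring).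
      rewrite D, Cinv_im in G1, G2.
      replace (c' - q) with (- rho) in G1 by (unfold c'; ring). replace (d - q) with rho in G2 by (unfold d; ring).
      specialize (key (x - p) ltac:(unfold a, b in Hx; lra)).
      replace (- rho * - rho) with (rho * rho) in G1 by ring.
      assert (X : 0 < (x - p) * (x - p) + rho * rho).
      { pose proof (Rle_0_sqr (x - p)). pose proof (Rmult_lt_0_compat rho rho Hrho Hrho). unfold Rsqr in *; lra. }
      replace (- - rho / ((x - p) * (x - p) + rho * rho)) with (2 * rho / ((x - p) * (x - p) + rho * rho) / 2) in G1 by (field; lra).
      replace (- rho / ((x - p) * (x - p) + rho * rho)) with (- (2 * rho / ((x - p) * (x - p) + rho * rho) / 2)) in G2 by (field; lra).
      lra. }
  assert (I2 : RInt (fun y => Re (g (b, y)) - Re (g (a, y))) c' d <= RInt (fun _ => - (/ rho / 2)) c' d).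
  { apply RInt_le; [unfold c', d; lra| |apply ex_RInt_const|].
    - apply ex_RInt_Rminus; (apply ex_RInt_ver; [unfold c', d; lra|]; intros y Hy; apply Hgc; [unfold a, b; lra|assumption]).
    - intros y Hy.
      assert (G1 := Hg a y ltac:(unfold a, b; lra) ltac:(lra) ltac:(auto)).
      assert (G2 := Hg b y ltac:(unfold a, b; lra) ltac:(lra) ltac:(auto)).
      apply (Rle_trans _ _ _ (re_le_Cmod _)), Rabs_le_between in G1, G2.
      assert (D : forall z u : C, Re (z - - u)%C = Re z + Re u) by (intros; unfold Re; simpl; ring).
      rewrite D, Cinv_re in G1, G2.
      replace (a - p) with (- rho) in G1 by (unfold a; ring). replace (b - p) with rho in G2 by (unfold b; ring).
      specialize (key (y - q) ltac:(unfold c', d in Hy; lra)).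
      replace (- rho * - rho) with (rho * rho) in G1 by ring.
      rewrite (Rplus_comm (rho * rho)) in G1, G2.
      assert (X : 0 < (y - q) * (y - q) + rho * rho).
      { pose proof (Rle_0_sqr (y - q)). pose proof (Rmult_lt_0_compat rho rho Hrho Hrho). unfold Rsqr in *; lra. }
      replace (rho / ((y - q) * (y - q) + rho * rho)) with (2 * rho / ((y - q) * (y - q) + rho * rho) / 2) in G2 by (field; lra).
      replace (- rho / ((y - q) * (y - q) + rho * rho)) with (- (2 * rho / ((y - q) * (y - q) + rho * rho) / 2)) in G1 by (field; lra).
      lra. }
  rewrite RInt_const in I1, I2. unfold rect_int in Hint.
  unfold scal in I1, I2; simpl in I1, I2; unfold mult in I1, I2; simpl in I1, I2.
  replace ((b - a) * - (/ rho / 2)) with (-1) in I1 by (unfold a, b; field; lra).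
  replace ((d - c') * - (/ rho / 2)) with (-1) in I2 by (unfold c', d; field; lra).
  lra.
Qed.

Definition cconvex (U : C -> Prop) : Prop :=
  forall u v s, U u -> U v -> 0 <= s <= 1 -> U (RtoC (1 - s) * u + RtoC s * v)%C.

Definition copen (U : C -> Prop) : Prop :=
  forall z, U z -> exists d, 0 < d /\ (forall w, Cmod (w - z)%C < d -> U w).

(** Vanishing is carried by [vanish_near] along the segment from 0 to z, through a chain of small
    discs. *)
Lemma identity_theorem_zero (U : C -> Prop) (H : C -> C) (r : R) :
  cconvex U -> copen U -> U 0 -> (forall z, U z -> cdiff H z) -> 0 < r ->
  (forall z, Cmod z < r -> H z = 0) -> forall z, U z -> H z = 0.
Proof.
  intros Hconv Hopen U0 Hd Hr H0 z Uz.
  destruct (Hopen 0 U0) as [d0 [Hd0 B0]]. destruct (Hopen z Uz) as [d1 [Hd1 B1]].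
  set (dl := Rmin d0 d1). assert (Hdl : 0 < dl) by now apply Rmin_glb_lt.
  (* With v = w - s z, the point w is a convex combination of v, near 0, and z + v, near z. *)
  assert (tube : forall s w, 0 <= s <= 1 -> Cmod (w - RtoC s * z)%C < dl -> U w).
  { intros s w Hs Hw. set (v := (w - RtoC s * z)%C) in *.
    replace w with (RtoC (1 - s) * v + RtoC s * (z + v))%C
      by (unfold v; rewrite RtoC_minus; ring).
    apply Hconv; [apply B0|apply B1|exact Hs].
    - replace (v - 0)%C with v by ring. eapply Rlt_le_trans; [exact Hw|apply Rmin_l].
    - replace (z + v - z)%C with v by ring. eapply Rlt_le_trans; [exact Hw|apply Rmin_r]. }
  (* Centres will be at most rho / 8 apart, so a point of the next disc of radius rho / 8 is within
     rho / 4 of the previous centre, as [vanish_near] asks; 2 rho + rho / 8 < dl keeps its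
     neighbourhood in the tube. *)
  set (rho := dl / 4).
  destruct (nfloor_ex (Cmod z * 8 / rho)) as [N0 [_ HN]].
  { apply Rdiv_le_0_compat; [pose proof (Cmod_ge_0 z); lra|unfold rho; lra]. }
  set (N := S N0). assert (HN0 : 0 < INR N) by (apply lt_0_INR; unfold N; lia).
  assert (HzN : Cmod z / INR N <= rho / 8).
  { apply Rmult_le_reg_r with (INR N * 8 / rho).
    - apply Rdiv_lt_0_compat; [lra|unfold rho; lra].
    - replace (Cmod z / INR N * (INR N * 8 / rho)) with (Cmod z * 8 / rho) by (field; unfold rho; lra).
      replace (rho / 8 * (INR N * 8 / rho)) with (INR N) by (field; unfold rho; lra).
      unfold N; rewrite S_INR; lra. }
  assert (step : forall k, (k <= N)%nat -> forall w, Cmod (w - RtoC (INR k / INR N) * z)%C < rho / 8 -> H w = 0).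
  { induction k as [|k IH]; intros Hk w Hw.
    - replace (w - RtoC (INR 0 / INR N) * z)%C with w in Hw
        by (simpl; unfold Rdiv; rewrite Rmult_0_l; ring).
      apply (vanish_near H w 0 rho r); [unfold rho; lra|exact Hr| | |].
      + intros u Hu. apply Hd, (tube 0); [lra|]. replace (u - RtoC 0 * z)%C with ((u - w) + w)%C by ring.
        eapply Rle_lt_trans; [apply Cmod_triangle|]. unfold rho in *; lra.
      + replace (0 - w)%C with (- w)%C by ring. rewrite Cmod_opp. unfold rho in *; lra.
      + intros u Hu. apply H0. now replace u with (u - 0)%C by ring.
    - assert (Hs : 0 <= INR (S k) / INR N <= 1).
      { split; [apply Rdiv_le_0_compat; [apply pos_INR|exact HN0]|].
        apply Rmult_le_reg_r with (INR N); [exact HN0|]. unfold Rdiv. rewrite Rmult_assoc, Rinv_l by lra.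
        rewrite Rmult_1_r, Rmult_1_l. now apply le_INR. }
      apply (vanish_near H w (RtoC (INR k / INR N) * z)%C rho (rho / 8)); [unfold rho; lra|unfold rho; lra| | |].
      + intros u Hu. apply Hd, (tube (INR (S k) / INR N)); [exact Hs|].
        replace (u - RtoC (INR (S k) / INR N) * z)%C with ((u - w) + (w - RtoC (INR (S k) / INR N) * z))%C by ring.
        eapply Rle_lt_trans; [apply Cmod_triangle|]. unfold rho in *; lra.
      + rewrite Cmod_minus_sym.
        replace (w - RtoC (INR k / INR N) * z)%C with
          ((w - RtoC (INR (S k) / INR N) * z) + RtoC (/ INR N) * z)%C.
        * eapply Rle_trans; [apply Cmod_triangle|]. rewrite (Cmod_mult (RtoC _)), Cmod_R, Rabs_pos_eq
            by (left; now apply Rinv_0_lt_compat).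
          unfold Rdiv in HzN. rewrite Rmult_comm in HzN. lra.
        * replace (INR (S k) / INR N) with (INR k / INR N + / INR N) by (rewrite S_INR; field; lra).
          rewrite RtoC_plus; ring.
      + intros u Hu. apply IH; [lia|exact Hu]. }
  apply (step N (le_n N)). replace (INR N / INR N) with 1 by (field; lra).
  replace (z - RtoC 1 * z)%C with (RtoC 0) by ring. rewrite Cmod_0. unfold rho; lra.
Qed.

Lemma identity_theorem (U : C -> Prop) (F G : C -> C) (r : R) :
  cconvex U -> copen U -> U 0 -> (forall z, U z -> cdiff F z) -> (forall z, U z -> cdiff G z) -> 0 < r ->
  (forall z, Cmod z < r -> F z = G z) -> forall z, U z -> F z = G z.
Proof.
  intros Hconv Hopen U0 HF HG Hr E z Uz.
  assert (K : (F z - G z)%C = 0).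
  { apply (identity_theorem_zero U (fun z => F z - G z)%C r); try assumption.
    - intros u Hu; apply cdiff_minus; auto.
    - intros u Hu. rewrite (E u Hu); ring. }
  replace (F z) with (F z - G z + G z)%C by ring. rewrite K; ring.
Qed.

(** * Complex power series *)

Definition cseries (a : nat -> C) (l : C) : Prop :=
  is_series (K := C_AbsRing) (V := C_NormedModule) a l.

Lemma csum_Re (a : nat -> C) (n : nat) : Re (sum_n a n) = sum_n (fun k => Re (a k)) n.
Proof. induction n as [|n IH]; [now rewrite !sum_O|]. rewrite !sum_Sn, <- IH. reflexivity. Qed.

Lemma csum_Im (a : nat -> C) (n : nat) : Im (sum_n a n) = sum_n (fun k => Im (a k)) n.
Proof. induction n as [|n IH]; [now rewrite !sum_O|]. rewrite !sum_Sn, <- IH. reflexivity. Qed.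

Lemma cseries_components (a : nat -> C) (l : C) :
  cseries a l <-> is_series (fun n => Re (a n)) (Re l) /\ is_series (fun n => Im (a n)) (Im l).
Proof.
  split.
  - intros Hs; split; intros P [e He].
    + destruct (Hs (fun z => P (Re z))) as [N HN].
      * exists e; intros y Hy; apply He; apply Hy.
      * exists N; intros n Hn. rewrite <- csum_Re. now apply HN.
    + destruct (Hs (fun z => P (Im z))) as [N HN].
      * exists e; intros y Hy; apply He; apply Hy.
      * exists N; intros n Hn. rewrite <- csum_Im. now apply HN.
  - intros [H1 H2] P [e He].
    destruct (H1 (ball (Re l) e)) as [N1 HN1]; [now exists e|].
    destruct (H2 (ball (Im l) e)) as [N2 HN2]; [now exists e|].
    exists (max N1 N2); intros n Hn. apply He. split.
    + change (ball (Re l) e (Re (sum_n a n))). rewrite csum_Re. apply HN1; lia.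
    + change (ball (Im l) e (Im (sum_n a n))). rewrite csum_Im. apply HN2; lia.
Qed.

Lemma cseries_eps (a : nat -> C) (l : C) :
  cseries a l <-> (forall eps, 0 < eps -> exists N, forall n, (N <= n)%nat -> Cmod (sum_n a n - l)%C < eps).
Proof.
  split.
  - intros H eps He. apply cseries_components in H as [H1 H2].
    destruct (H1 (ball (Re l) (eps / 2))) as [N1 HN1]; [exists (mkposreal (eps / 2) ltac:(lra)); auto|].
    destruct (H2 (ball (Im l) (eps / 2))) as [N2 HN2]; [exists (mkposreal (eps / 2) ltac:(lra)); auto|].
    exists (max N1 N2); intros n Hn. eapply Rle_lt_trans; [apply Cmod_le_sum|].
    specialize (HN1 n ltac:(lia)). specialize (HN2 n ltac:(lia)).
    rewrite <- csum_Re in HN1. rewrite <- csum_Im in HN2.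
    replace eps with (eps / 2 + eps / 2) by lra. apply Rplus_lt_compat; [exact HN1|exact HN2].
  - intros H. apply cseries_components; split; intros P [e He];
      destruct (H e (cond_pos e)) as [N HN]; exists N; intros n Hn; apply He;
      specialize (HN n Hn); (rewrite <- csum_Re || rewrite <- csum_Im).
    + eapply Rle_lt_trans; [apply (re_le_Cmod (sum_n a n - l))|exact HN].
    + eapply Rle_lt_trans; [apply (im_le_Cmod (sum_n a n - l))|exact HN].
Qed.

(** A total sum, meaningful only under convergence, so that [cps] is a function on all of C. *)
Definition Cser (a : nat -> C) : C := (Series (fun n => Re (a n)), Series (fun n => Im (a n))).

Lemma Cser_unique (a : nat -> C) (l : C) : cseries a l -> Cser a = l.
Proof.
  intros H; apply cseries_components in H as [H1 H2]. apply injective_projections; simpl;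
    now apply is_series_unique.
Qed.

Lemma cseries_unique (a : nat -> C) (l m : C) : cseries a l -> cseries a m -> l = m.
Proof. intros H1 H2; apply Cser_unique in H1, H2; congruence. Qed.

Lemma cseries_ext (a b : nat -> C) (l : C) : (forall n, a n = b n) -> cseries a l -> cseries b l.
Proof. apply is_series_ext. Qed.

Lemma cseries_minus (a b : nat -> C) (l m : C) :
  cseries a l -> cseries b m -> cseries (fun n => a n - b n)%C (l - m)%C.
Proof. intros H1 H2; exact (is_series_minus a b l m H1 H2). Qed.

Lemma cseries_scal (k : C) (a : nat -> C) (l : C) :
  cseries a l -> cseries (fun n => k * a n)%C (k * l)%C.
Proof. intros H1; exact (is_series_scal k a l H1). Qed.

Lemma cseries_Cser (a : nat -> C) : ex_series (fun n => Cmod (a n)) -> cseries a (Cser a).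
Proof.
  intros H. apply cseries_components; simpl; split; apply Series_correct;
    apply (ex_series_le (V := R_CompleteNormedModule)) with (2 := H); intros n.
  - apply re_le_Cmod.
  - apply im_le_Cmod.
Qed.

Lemma Cmod_csum_le (a : nat -> C) (b : nat -> R) (n : nat) :
  (forall k, (k <= n)%nat -> Cmod (a k) <= b k) -> Cmod (sum_n a n) <= sum_n b n.
Proof.
  induction n as [|n IH]; intros H.
  - rewrite !sum_O; now apply H.
  - rewrite !sum_Sn. eapply Rle_trans; [apply Cmod_triangle|].
    apply Rplus_le_compat; [apply IH; intros; apply H; lia|apply H; lia].
Qed.

Lemma cseries_le (a : nat -> C) (b : nat -> R) (l : C) (L : R) :
  cseries a l -> is_series b L -> (forall n, Cmod (a n) <= b n) -> Cmod l <= L.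
Proof.
  intros Ha Hb Hab. apply Rnot_lt_le; intros N.
  apply cseries_eps with (eps := (Cmod l - L) / 2) in Ha; [|lra]. destruct Ha as [N1 H1].
  destruct (Hb (ball L ((Cmod l - L) / 2))) as [N2 H2]; [exists (mkposreal ((Cmod l - L) / 2) ltac:(lra)); auto|].
  set (n := max N1 N2). specialize (H1 n ltac:(lia)). specialize (H2 n ltac:(lia)).
  pose proof (Cmod_csum_le a b n (fun k _ => Hab k)).
  pose proof (Cmod_triangle_minus l (sum_n a n)) as K. rewrite Cmod_minus_sym in K.
  change (Rabs (sum_n b n - L) < (Cmod l - L) / 2) in H2. apply Rabs_def2 in H2. lra.
Qed.

(** Abel's bounded-terms condition; it gives absolute convergence for |z| < r and follows directly
    from explicit coefficient bounds. *)
Definition growth (c : nat -> C) (r : R) : Prop := exists M, forall n, Cmod (c n) * r ^ n <= M.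

Lemma CV_radius_bounded_ge (a : nat -> R) (r M : R) :
  (forall n, Rabs (a n) * r ^ n <= M) -> 0 <= r -> Rbar_le r (CV_radius a).
Proof.
  intros H Hr. apply (CV_radius_bounded a). exists M; intros n.
  rewrite Rabs_mult, (Rabs_pos_eq (r ^ n)) by now apply pow_le. apply H.
Qed.

Definition nmul (a : nat -> R) (n : nat) : R := INR n * a n.

Lemma CV_radius_nmul (a : nat -> R) : CV_radius (nmul a) = CV_radius a.
Proof.
  rewrite <- (CV_radius_derive a), <- (CV_radius_incr_1 (PS_derive a)).
  apply CV_radius_ext. intros [|n]; unfold nmul, PS_incr_1, PS_derive; simpl; [|reflexivity].
  change (zero : R) with 0. ring.
Qed.

Lemma growth_CV_radius (c : nat -> C) (r : R) :
  0 <= r -> growth c r -> Rbar_le r (CV_radius (fun n => Cmod (c n))).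
Proof.
  intros Hr [M HM]. apply CV_radius_bounded_ge with M; [|exact Hr].
  intros n; rewrite Rabs_pos_eq by apply Cmod_ge_0. apply HM.
Qed.

(** The weights 1, n and n^2 serve the sum, its derivative and the second-order remainder. *)
Lemma growth_series (c : nat -> C) (r s : R) :
  0 <= s < r -> growth c r ->
  ex_series (fun n => Cmod (c n) * s ^ n) /\
  ex_series (fun n => INR n * Cmod (c n) * s ^ n) /\
  ex_series (fun n => INR n * (INR n * Cmod (c n)) * s ^ n).
Proof.
  intros Hs Hc. apply growth_CV_radius in Hc; [|lra].
  set (a := fun n => Cmod (c n)) in *.
  assert (K : forall b, (forall n, 0 <= b n) -> CV_radius b = CV_radius a -> ex_series (fun n => b n * s ^ n)).
  { intros b Hb E. apply ex_series_ext with (fun n => Rabs (b n * s ^ n)).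
    - intros n; apply Rabs_pos_eq, Rmult_le_pos; [apply Hb|apply pow_le; lra].
    - apply CV_disk_inside. rewrite E, Rabs_pos_eq by lra. eapply Rbar_lt_le_trans; [|exact Hc]. simpl; lra. }
  assert (A : forall n, 0 <= a n) by (intros; apply Cmod_ge_0).
  repeat split.
  - apply (K a); auto.
  - apply (K (nmul a)); [|apply CV_radius_nmul]. intros n; apply Rmult_le_pos; [apply pos_INR|apply A].
  - apply (K (nmul (nmul a))); [|now rewrite !CV_radius_nmul].
    intros n; repeat apply Rmult_le_pos; try apply pos_INR; apply A.
Qed.

Definition cps (c : nat -> C) (z : C) : C := Cser (fun n => c n * z ^ n)%C.

Lemma cps_cseries (c : nat -> C) (r : R) (z : C) :
  growth c r -> Cmod z < r -> cseries (fun n => c n * z ^ n)%C (cps c z).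
Proof.
  intros Hc Hz. apply cseries_Cser.
  apply ex_series_ext with (fun n => Cmod (c n) * Cmod z ^ n).
  - intros n; now rewrite Cmod_mult, Cmod_pow.
  - apply (growth_series c r); [split; [apply Cmod_ge_0|exact Hz]|exact Hc].
Qed.

(** The remainders satisfy e_(n+1) = w e_n + n z^(n-1) h^2. The factor s^2 on the left avoids the
    exponent n - 2; at n = 0 the [pred] is multiplied by 0. *)
Lemma Cpow_taylor2 (z w : C) (s : R) (n : nat) :
  0 < s -> Cmod z <= s -> Cmod w <= s ->
  Cmod (w ^ n - z ^ n - RtoC (INR n) * z ^ pred n * (w - z))%C * s ^ 2
   <= INR n * INR n * s ^ n * Cmod (w - z) ^ 2.
Proof.
  intros Hs Hz Hw. set (h := (w - z)%C).
  assert (Hh : 0 <= Cmod h ^ 2) by apply pow2_ge_0.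
  induction n as [|n IH].
  - replace (w ^ 0 - z ^ 0 - RtoC (INR 0) * z ^ Init.Nat.pred 0 * h)%C with (RtoC 0) by (simpl; ring).
    rewrite Cmod_0; simpl. nra.
  - set (e := (w ^ n - z ^ n - RtoC (INR n) * z ^ pred n * h)%C) in *.
    assert (Z : (RtoC (INR n) * z ^ n = RtoC (INR n) * z ^ pred n * z)%C).
    { destruct n; simpl; ring. }
    replace (w ^ S n - z ^ S n - RtoC (INR (S n)) * z ^ pred (S n) * h)%C
      with (w * e + RtoC (INR n) * z ^ pred n * h * h)%C.
    + assert (P : INR n * Cmod z ^ pred n * s <= INR n * s ^ n).
      { destruct n; [simpl; lra|]. simpl pred. rewrite Rmult_assoc. apply Rmult_le_compat_l; [apply pos_INR|].
        simpl. rewrite Rmult_comm. apply Rmult_le_compat_l; [lra|]. apply pow_incr; split; [apply Cmod_ge_0|exact Hz]. }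
      apply Rle_trans with ((s * Cmod e + INR n * Cmod z ^ pred n * Cmod h ^ 2) * s ^ 2).
      * apply Rmult_le_compat_r; [apply pow2_ge_0|]. eapply Rle_trans; [apply Cmod_triangle|].
        rewrite !Cmod_mult, Cmod_pow, Cmod_R, (Rabs_pos_eq (INR n)) by apply pos_INR.
        assert (Cmod w * Cmod e <= s * Cmod e) by (apply Rmult_le_compat_r; [apply Cmod_ge_0|exact Hw]). lra.
      * rewrite S_INR. assert (0 <= INR n) by apply pos_INR. assert (0 <= s ^ n) by (apply pow_le; lra).
        assert (A1 : s * (Cmod e * s ^ 2) <= s * (INR n * INR n * s ^ n * Cmod h ^ 2)) by (apply Rmult_le_compat_l; [lra|exact IH]).
        assert (A2 : INR n * Cmod z ^ pred n * s * (s * Cmod h ^ 2) <= INR n * s ^ n * (s * Cmod h ^ 2))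
          by (apply Rmult_le_compat_r; [nra|exact P]).
        assert (A3 : 0 <= s ^ n * (s * Cmod h ^ 2)) by (apply Rmult_le_pos; [assumption|nra]).
        simpl (s ^ S n).
        assert (A4 : 0 <= INR n * (s ^ n * (s * Cmod h ^ 2))) by (apply Rmult_le_pos; assumption).
        lra.
    + simpl pred. rewrite S_INR, RtoC_plus.
      replace ((RtoC (INR n) + RtoC 1) * z ^ n * h)%C with (RtoC (INR n) * z ^ n * h + z ^ n * h)%C by ring.
      rewrite Z. unfold e, h. simpl. ring.
Qed.

(** Summing [Cpow_taylor2] bounds the remainder by K |w - z|^2; s lies halfway between |z| and r to
    leave room for w. *)
Lemma cps_cdiff (c : nat -> C) (r : R) (z : C) : growth c r -> Cmod z < r -> cdiff (cps c) z.
Proof.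
  intros Hc Hz. set (s := (Cmod z + r) / 2). pose proof (Cmod_ge_0 z) as Z0.
  destruct (growth_series c r s ltac:(unfold s; lra) Hc) as (S0 & S1 & S2).
  set (a := fun n => (c n * (RtoC (INR n) * z ^ pred n))%C).
  assert (Ha : cseries a (Cser a)).
  { apply cseries_Cser.
    apply (ex_series_le (V := R_CompleteNormedModule)) with (fun n => / s * (INR n * Cmod (c n) * s ^ n)).
    - intros n. change (norm (Cmod (a n))) with (Rabs (Cmod (a n))). rewrite Rabs_pos_eq by apply Cmod_ge_0.
      unfold a. rewrite !Cmod_mult, Cmod_pow, Cmod_R, Rabs_pos_eq by apply pos_INR.
      destruct n as [|n]; [simpl; lra|]. simpl pred.
      replace (/ s * (INR (S n) * Cmod (c (S n)) * s ^ S n)) with (Cmod (c (S n)) * (INR (S n) * s ^ n))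
        by (simpl (s ^ S n); field; unfold s; lra).
      apply Rmult_le_compat_l; [apply Cmod_ge_0|]. apply Rmult_le_compat_l; [apply pos_INR|].
      apply pow_incr; unfold s; lra.
    - apply (ex_series_scal (V := R_NormedModule)); exact S1. }
  set (K := Series (fun n => INR n * (INR n * Cmod (c n)) * s ^ n) / s ^ 2).
  assert (s0 : 0 < s) by (unfold s; lra).
  assert (s2 : 0 < s ^ 2) by (apply pow_lt; exact s0).
  assert (HK : forall w, Cmod w <= s -> Cmod (cps c w - cps c z - Cser a * (w - z))%C <= K * Cmod (w - z) ^ 2).
  { intros w Hw.
    assert (Sw := cps_cseries c r w Hc ltac:(unfold s in *; lra)).
    assert (Sz := cps_cseries c r z Hc Hz).
    assert (Sd := cseries_minus _ _ _ _ (cseries_minus _ _ _ _ Sw Sz) (cseries_scal (w - z) _ _ Ha)).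
    replace (Cser a * (w - z))%C with ((w - z) * Cser a)%C by ring.
    refine (cseries_le _ (fun n => Cmod (w - z) ^ 2 / s ^ 2 * (INR n * (INR n * Cmod (c n)) * s ^ n)) _ _ Sd _ _).
    - replace (K * Cmod (w - z) ^ 2) with (Cmod (w - z) ^ 2 / s ^ 2 * Series (fun n => INR n * (INR n * Cmod (c n)) * s ^ n))
        by (unfold K; field; lra).
      apply (is_series_scal (V := R_NormedModule)), Series_correct, S2.
    - intros n. unfold a.
      replace (c n * w ^ n - c n * z ^ n - (w - z) * (c n * (RtoC (INR n) * z ^ pred n)))%C
        with (c n * (w ^ n - z ^ n - RtoC (INR n) * z ^ pred n * (w - z)))%C by ring.
      rewrite Cmod_mult. pose proof (Cpow_taylor2 z w s n s0 ltac:(unfold s; lra) Hw) as T.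
      apply Rmult_le_reg_r with (s ^ 2); [exact s2|].
      replace (Cmod (w - z) ^ 2 / s ^ 2 * (INR n * (INR n * Cmod (c n)) * s ^ n) * s ^ 2)
        with (Cmod (c n) * (INR n * INR n * s ^ n * Cmod (w - z) ^ 2)) by (field; lra).
      rewrite Rmult_assoc. apply Rmult_le_compat_l; [apply Cmod_ge_0|exact T]. }
  exists (Cser a). intros eps He.
  assert (K0 : 0 <= K).
  { apply Rdiv_le_0_compat; [|lra].
    apply Rle_trans with (Series (fun _ : nat => 0)).
    - right. symmetry. rewrite (Series_ext _ (fun n => 0 * 0)) by (intros; ring). rewrite Series_scal_l; ring.
    - apply Series_le; [|exact S2]. intros n; split; [lra|]. repeat apply Rmult_le_pos; try apply pos_INR; try apply Cmod_ge_0.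
      apply pow_le; lra. }
  exists (Rmin (s - Cmod z) (eps / (K + 1))). split.
  { apply Rmin_glb_lt; [unfold s; lra|]. apply Rdiv_lt_0_compat; lra. }
  intros w Hw.
  assert (W1 : Cmod (w - z) < s - Cmod z) by (eapply Rlt_le_trans; [exact Hw|apply Rmin_l]).
  assert (W2 : Cmod (w - z) < eps / (K + 1)) by (eapply Rlt_le_trans; [exact Hw|apply Rmin_r]).
  pose proof (Cmod_triangle_minus w z).
  eapply Rle_trans; [apply HK; lra|]. simpl. rewrite Rmult_1_r, <- Rmult_assoc.
  pose proof (Cmod_ge_0 (w - z)).
  apply Rmult_le_compat_r; [assumption|].
  apply Rmult_lt_compat_l with (r := K + 1) in W2; [|lra].
  replace ((K + 1) * (eps / (K + 1))) with eps in W2 by (field; lra). lra.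
Qed.

Lemma geometric_tail (a : nat -> C) (l : C) (K th : R) (n : nat) :
  0 <= th < 1 -> cseries a l -> (forall i, Cmod (a i) <= K * th ^ i) ->
  Cmod (l - sum_n a n)%C <= K * th ^ S n / (1 - th).
Proof.
  intros Hth Ha Hb.
  assert (K0 : 0 <= K) by (specialize (Hb 0%nat); simpl in Hb; pose proof (Cmod_ge_0 (a 0%nat)); lra).
  assert (P : forall m, Cmod (sum_n a (n + m)%nat - sum_n a n)%C <= K * (th ^ S n - th ^ S (n + m)) / (1 - th)).
  { induction m as [|m IH].
    - rewrite Nat.add_0_r. replace (sum_n a n - sum_n a n)%C with (RtoC 0) by ring. rewrite Cmod_0. right; field; lra.
    - rewrite Nat.add_succ_r, sum_Sn.
      replace (plus (sum_n a (n + m)%nat) (a (S (n + m))) - sum_n a n)%C with ((sum_n a (n + m)%nat - sum_n a n) + a (S (n + m)))%C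
        by (change plus with Cplus; ring).
      eapply Rle_trans; [apply Cmod_triangle|]. specialize (Hb (S (n + m))).
      replace (K * (th ^ S n - th ^ S (S (n + m))) / (1 - th))
        with (K * (th ^ S n - th ^ S (n + m)) / (1 - th) + K * th ^ S (n + m)) by (simpl; field; lra). lra. }
  apply Rnot_lt_le; intros N. set (B := K * th ^ S n / (1 - th)) in *.
  apply cseries_eps with (eps := Cmod (l - sum_n a n)%C - B) in Ha; [|lra]. destruct Ha as [m Hm].
  specialize (Hm (n + m)%nat ltac:(lia)). specialize (P m).
  pose proof (Cmod_triangle (sum_n a (n + m)%nat - sum_n a n) (l - sum_n a (n + m)%nat)) as T.
  replace (sum_n a (n + m)%nat - sum_n a n + (l - sum_n a (n + m)%nat))%C with (l - sum_n a n)%C in T by ring.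
  rewrite (Cmod_minus_sym l (sum_n a (n + m)%nat)) in T.
  assert (K * (th ^ S n - th ^ S (n + m)) / (1 - th) <= B).
  { unfold B, Rdiv. apply Rmult_le_compat_r; [left; apply Rinv_0_lt_compat; lra|].
    apply Rmult_le_compat_l; [exact K0|]. assert (0 <= th ^ S (n + m)) by (apply pow_le; lra). lra. }
  lra.
Qed.

(** Both sides sum over i + j <= N. *)
Lemma csum_triangle (a : nat -> nat -> C) (N : nat) :
  sum_n (fun k => sum_n (fun j => a (k - j)%nat j) k) N = sum_n (fun j => sum_n (fun i => a i j) (N - j)) N.
Proof.
  induction N as [|N IH]; [now rewrite !sum_O|].
  rewrite sum_Sn, IH, (sum_Sn (fun j => a (S N - j)%nat j)),
    (sum_Sn (fun j => sum_n (fun i => a i j) (S N - j))).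
  rewrite Nat.sub_diag, sum_O, plus_assoc. f_equal.
  rewrite <- (sum_n_plus (fun j => sum_n (fun i => a i j) (N - j)) (fun j => a (S N - j)%nat j)).
  apply sum_n_ext_loc. intros j Hj. rewrite Nat.sub_succ_l by exact Hj. now rewrite sum_Sn.
Qed.

Lemma csum_minus (a b : nat -> C) (n : nat) :
  sum_n (fun k => a k - b k)%C n = (sum_n a n - sum_n b n)%C.
Proof.
  induction n as [|n IH]; [now rewrite !sum_O|]. rewrite !sum_Sn, IH.
  change ((sum_n a n - sum_n b n + (a (S n) - b (S n)))%C = (sum_n a n + a (S n) - (sum_n b n + b (S n)))%C). ring.
Qed.

Lemma INR_pow_lim (K th eps : R) : 0 <= th < 1 -> 0 < eps ->
  exists N, forall n, (N <= n)%nat -> K * (INR (S n) * th ^ S n) < eps.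
Proof.
  intros Hth He.
  assert (G : growth (fun _ => RtoC 1) 1) by (exists 1; intros n; rewrite Cmod_1, pow1; lra).
  destruct (growth_series _ 1 th ltac:(lra) G) as (_ & S1 & _).
  apply ex_series_lim_0 in S1. apply is_lim_seq_incr_1 in S1.
  apply (is_lim_seq_scal_l _ K) in S1. simpl in S1. rewrite Rmult_0_r in S1.
  destruct (S1 (ball 0 eps)) as [N HN]; [exists (mkposreal eps He); auto|].
  exists N; intros n Hn. specialize (HN n Hn).
  change (Rabs (K * (INR (S n) * Cmod 1 * th ^ S n) - 0) < eps) in HN.
  rewrite Cmod_1, Rmult_1_r in HN. apply Rabs_def2 in HN. lra.
Qed.

(** Rearrangement of a double series: replacing the triangle i + j <= n by the full sums over i
    costs n + 1 tails of size K th^(n+1) / (1 - th), and (n + 1) th^(n+1) tends to 0. *)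
Lemma cseries_triangle (a : nat -> nat -> C) (r : nat -> C) (K th : R) (s : C) :
  0 <= th < 1 -> (forall i j, Cmod (a i j) <= K * th ^ (i + j)) ->
  (forall j, cseries (fun i => a i j) (r j)) ->
  cseries (fun k => sum_n (fun j => a (k - j)%nat j) k) s -> cseries r s.
Proof.
  intros Hth Ha Hr Hs. apply cseries_eps; intros eps He.
  apply cseries_eps with (eps := eps / 2) in Hs; [|lra]. destruct Hs as [N1 H1].
  destruct (INR_pow_lim (K / (1 - th)) th (eps / 2) Hth ltac:(lra)) as [N2 H2].
  exists (max N1 N2); intros n Hn. specialize (H1 n ltac:(lia)). specialize (H2 n ltac:(lia)).
  rewrite csum_triangle in H1. set (T := sum_n (fun j => sum_n (fun i => a i j) (n - j)) n) in *.
  assert (E : Cmod (sum_n r n - T)%C <= sum_n (fun _ => K * th ^ S n / (1 - th)) n).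
  { unfold T; rewrite <- csum_minus. apply Cmod_csum_le. intros j Hj.
    replace (K * th ^ S n / (1 - th)) with (K * th ^ j * th ^ S (n - j) / (1 - th)).
    - apply geometric_tail; [exact Hth|apply Hr|]. intros i. rewrite Rmult_assoc, <- pow_add, Nat.add_comm. apply Ha.
    - rewrite (Rmult_assoc K), <- pow_add. do 3 f_equal. lia. }
  rewrite sum_n_const in E.
  replace (sum_n r n - s)%C with (sum_n r n - T + (T - s))%C by ring.
  eapply Rle_lt_trans; [apply Cmod_triangle|].
  replace (INR (S n) * (K * th ^ S n / (1 - th))) with (K / (1 - th) * (INR (S n) * th ^ S n)) in E by (field; lra).
  lra.
Qed.

(** * Completely monotone sequences *)

Fixpoint fdiff (k : nat) (u : nat -> R) (n : nat) : R :=
  match k with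
  | O => u n
  | S k => fdiff k u n - fdiff k u (S n)
  end.

(** Bounding the order permits the induction of [cm_seq_exp_ratio], where m is controlled by its own
    shift at one order less. *)
Definition cm_upto (j : nat) (u : nat -> R) : Prop :=
  forall k n, (k <= j)%nat -> 0 <= fdiff k u n.

Definition cm_seq (u : nat -> R) : Prop := forall k n, 0 <= fdiff k u n.

Lemma fdiff_ext (u v : nat -> R) (k n : nat) : (forall n, u n = v n) -> fdiff k u n = fdiff k v n.
Proof. intros E; revert n; induction k as [|k IH]; intros n; simpl; [apply E|now rewrite !IH]. Qed.

Lemma fdiff_shift (u : nat -> R) (k n : nat) : fdiff k (fun n => u (S n)) n = fdiff k u (S n).
Proof. revert n; induction k as [|k IH]; intros n; simpl; [reflexivity|now rewrite !IH]. Qed.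

Lemma fdiff_succ (u : nat -> R) (k n : nat) : fdiff (S k) u n = fdiff k (fun n => u n - u (S n)) n.
Proof. revert n; induction k as [|k IH]; intros n; [reflexivity|].
  change (fdiff (S k) u n - fdiff (S k) u (S n) = fdiff (S k) (fun n => u n - u (S n)) n). now rewrite !IH. Qed.

Lemma fdiff_plus (u v : nat -> R) (k n : nat) : fdiff k (fun n => u n + v n) n = fdiff k u n + fdiff k v n.
Proof. revert n; induction k as [|k IH]; intros n; simpl; [reflexivity|rewrite !IH; ring]. Qed.

Lemma fdiff_scal (c : R) (u : nat -> R) (k n : nat) : fdiff k (fun n => c * u n) n = c * fdiff k u n.
Proof. revert n; induction k as [|k IH]; intros n; simpl; [reflexivity|rewrite !IH; ring]. Qed.

Lemma fdiff_lim (U : nat -> nat -> R) (u : nat -> R) (k n : nat) :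
  (forall n, is_lim_seq (fun N => U N n) (u n)) -> is_lim_seq (fun N => fdiff k (U N) n) (fdiff k u n).
Proof.
  intros H; revert n; induction k as [|k IH]; intros n; simpl; [apply H|].
  now apply is_lim_seq_minus'.
Qed.

Lemma cm_upto_plus (j : nat) (u v : nat -> R) :
  cm_upto j u -> cm_upto j v -> cm_upto j (fun n => u n + v n).
Proof. intros Hu Hv k n Hk. rewrite fdiff_plus. specialize (Hu k n Hk). specialize (Hv k n Hk). lra. Qed.

Lemma cm_upto_scal (j : nat) (c : R) (u : nat -> R) :
  0 <= c -> cm_upto j u -> cm_upto j (fun n => c * u n).
Proof. intros Hc Hu k n Hk. rewrite fdiff_scal. apply Rmult_le_pos; auto. Qed.

(** Discrete Leibniz rule: the difference of u v is (difference of u) v + (shift of u) (difference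
    of v). *)
Lemma cm_upto_mult (j : nat) (u v : nat -> R) :
  cm_upto j u -> cm_upto j v -> cm_upto j (fun n => u n * v n).
Proof.
  revert u v; induction j as [|j IH]; intros u v Hu Hv k n Hk.
  - replace k with 0%nat by lia. simpl. apply Rmult_le_pos; [apply (Hu 0%nat)|apply (Hv 0%nat)]; lia.
  - destruct k as [|k]; [simpl; apply Rmult_le_pos; [apply (Hu 0%nat)|apply (Hv 0%nat)]; lia|].
    rewrite fdiff_succ.
    rewrite (fdiff_ext _ (fun n => (u n - u (S n)) * v n + u (S n) * (v n - v (S n)))) by (intros; ring).
    apply (cm_upto_plus j (fun n => (u n - u (S n)) * v n)); [apply IH|apply IH|lia].
    + intros i m Hi. rewrite <- fdiff_succ. apply Hu; lia.
    + intros i m Hi. apply Hv; lia.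
    + intros i m Hi. rewrite fdiff_shift. apply Hu; lia.
    + intros i m Hi. rewrite <- fdiff_succ. apply Hv; lia.
Qed.

Lemma cm_upto_pow (j : nat) (u : nat -> R) (i : nat) :
  cm_upto j u -> cm_upto j (fun n => u n ^ S i).
Proof.
  intros Hu; induction i as [|i IH].
  - intros k n Hk. rewrite (fdiff_ext _ u) by (intros; ring). now apply Hu.
  - exact (cm_upto_mult j u _ Hu IH).
Qed.

(** exp u - 1 is a power series in u with nonnegative coefficients; its partial sums are covered by
    the closure lemmas, and the sign survives the pointwise limit. *)
Lemma cm_upto_expm1 (j : nat) (u : nat -> R) :
  cm_upto j u -> cm_upto j (fun n => exp (u n) - 1).
Proof.
  intros Hu k n Hk.
  set (U := fun N n => sum_n (fun i => / INR (Factorial.fact (S i)) * u n ^ S i) N).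
  assert (HU : forall n, is_lim_seq (fun N => U N n) (exp (u n) - 1)).
  { intros m. pose proof (is_exp_Reals (u m)) as E. unfold is_pseries in E.
    replace (exp (u m)) with (plus (exp (u m) - 1) (scal (pow_n (u m) 0) (/ INR (Factorial.fact 0)))) in E.
    2:{ change (exp (u m) - 1 + 1 * / INR 1 = exp (u m)). simpl; field. }
    apply (is_series_incr_1 (fun k => scal (pow_n (u m) k) (/ INR (Factorial.fact k)))) in E.
    apply (is_series_ext _ (fun i => / INR (Factorial.fact (S i)) * u m ^ S i)) in E; [exact E|].
    intros i. rewrite pow_n_pow. apply Rmult_comm. }
  refine (is_lim_seq_le (fun _ => 0) (fun N => fdiff k (U N) n) 0 (fdiff k (fun n => exp (u n) - 1) n) _ (is_lim_seq_const 0) _).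
  - intros N. enough (K : cm_upto j (U N)) by now apply K.
    unfold U. induction N as [|N IH].
    + intros i m Hi. rewrite (fdiff_ext _ (fun n => / INR (Factorial.fact 1) * u n ^ 1)) by (intros; apply sum_O).
      apply (cm_upto_scal j); [|now apply cm_upto_pow|exact Hi].
      left; apply Rinv_0_lt_compat, INR_fact_lt_0.
    + intros i m Hi.
      rewrite (fdiff_ext _ (fun n => U N n + / INR (Factorial.fact (S (S N))) * u n ^ S (S N))) by (intros; unfold U; rewrite sum_Sn; reflexivity).
      apply (cm_upto_plus j (U N)); [exact IH| |exact Hi].
      apply cm_upto_scal; [|now apply cm_upto_pow]. left; apply Rinv_0_lt_compat, INR_fact_lt_0.
  - now apply fdiff_lim.
Qed.

(** m_n - m_(n+1) = m_(n+1) (exp (p_n) - 1), so order j + 1 for m follows from order j. *)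
Lemma cm_seq_exp_ratio (m p : nat -> R) :
  cm_seq p -> (forall n, 0 <= m n) -> (forall n, m n = m (S n) * exp (p n)) -> cm_seq m.
Proof.
  intros Hp Hm E. enough (K : forall j, cm_upto j m) by (intros k n; now apply (K k)).
  induction j as [|j IH]; intros k n Hk.
  - replace k with 0%nat by lia. apply Hm.
  - destruct k as [|k]; [apply Hm|]. rewrite fdiff_succ.
    rewrite (fdiff_ext _ (fun n => m (S n) * (exp (p n) - 1)))
      by (intros i; rewrite (E i) at 1; ring).
    apply (cm_upto_mult j (fun n => m (S n))); [| |lia].
    + intros i l Hi. rewrite fdiff_shift. now apply IH.
    + apply cm_upto_expm1. intros i l _; apply Hp.
Qed.

(* If Y is the number of steps [n -> n+1] in a path of r steps, each either
   [k -> k+1] or [n -> n+1], weighted by [fdiff] at its end point, the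
   expression below is the total weight of Q(c + Y) for Q y = al y^2 + be y + ga. *)
Lemma cm_seq_quadratic (u : nat -> R) (al be ga : R) :
  cm_seq u -> (forall y, 0 <= al * y ^ 2 + be * y + ga) ->
  forall r c i k, 0 <= al * (INR r * (INR r - 1) * fdiff i u (S (S k)) + INR r * fdiff i u (S k))
     + (2 * al * c + be) * INR r * fdiff i u (S k) + (al * c ^ 2 + be * c + ga) * fdiff i u k.
Proof.
  intros Hu HQ; induction r as [|r IH]; intros c i k.
  - simpl. pose proof (Rmult_le_pos _ _ (HQ c) (Hu i k)). nra.
  (* Split by the first step of the path: raising the index adds 1 to c, raising the order leaves c
     alone. *)
  - pose proof (IH (c + 1) i (S k)) as H1. pose proof (IH c (S i) k) as H2.
    simpl fdiff in H2. rewrite S_INR. simpl in *. nra.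
Qed.

(** The form X = u_(k+2) - 2 la u_(k+1) + la^2 u_k plays the integral of t^k (t - la)^2. Paths of
    length r with Q y = (y - la r)^2 give r X + (u_(k+1) - u_(k+2)) >= 0 for every r >= 1, so X >=
    0; then la = u_(k+1) / u_k. *)
Lemma cm_seq_log_convex (u : nat -> R) (k : nat) :
  cm_seq u -> u (S k) * u (S k) <= u k * u (S (S k)).
Proof.
  intros Hu.
  assert (P0 := Hu 0%nat k). assert (P1 := Hu 0%nat (S k)). assert (P2 := Hu 0%nat (S (S k))).
  assert (D := Hu 1%nat k). assert (D1 := Hu 1%nat (S k)). simpl in P0, P1, P2, D, D1.
  assert (HQ : forall la, 0 <= u (S (S k)) - 2 * la * u (S k) + la ^ 2 * u k).
  { intros la. apply Rnot_lt_le; intros N. set (X := u (S (S k)) - 2 * la * u (S k) + la ^ 2 * u k) in *.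
    destruct (nfloor_ex ((u (S k) - u (S (S k))) / - X)) as [n0 [_ Hn]].
    { apply Rdiv_le_0_compat; lra. }
    set (r := INR (S n0)). assert (Hr : 0 < r) by (apply lt_0_INR; lia).
    pose proof (cm_seq_quadratic u 1 (- 2 * la * r) (la ^ 2 * r ^ 2) Hu
       ltac:(intros y; pose proof (pow2_ge_0 (y - la * r)); nra) (S n0) 0 0%nat k) as Q.
    fold r in Q. simpl fdiff in Q.
    assert (Q' : 0 <= r * (r * X + (u (S k) - u (S (S k))))) by (unfold X; nra).
    apply Rmult_lt_compat_r with (r := - X) in Hn; [|lra].
    replace ((u (S k) - u (S (S k))) / - X * - X) with (u (S k) - u (S (S k))) in Hn by (field; lra).
    replace (INR n0 + 1) with r in Hn by (unfold r; now rewrite S_INR). nra. }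
  destruct (Rle_lt_or_eq_dec 0 (u k) P0) as [H|H].
  - specialize (HQ (u (S k) / u k)).
    apply Rmult_le_compat_l with (r := u k) in HQ; [|lra].
    replace (u k * (u (S (S k)) - 2 * (u (S k) / u k) * u (S k) + (u (S k) / u k) ^ 2 * u k))
      with (u k * u (S (S k)) - u (S k) * u (S k)) in HQ by (field; lra). lra.
  - assert (u (S k) = 0) by lra. rewrite H0, <- H. lra.
Qed.

(** The reflection t -> 1 - t: it exchanges index and order of difference. *)
Lemma fdiff_swap (u : nat -> R) (i n : nat) : fdiff i (fun n => fdiff n u 0%nat) n = fdiff n u i.
Proof. revert n; induction i as [|i IH]; intros n; simpl; [reflexivity|]. rewrite !IH. simpl; ring. Qed.

Lemma cm_seq_fdiff0 (u : nat -> R) : cm_seq u -> cm_seq (fun n => fdiff n u 0%nat).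
Proof. intros Hu i n. rewrite fdiff_swap. apply Hu. Qed.

(** * The moments *)

(** Unit-step differences at a real argument, so that signs can be read off derivatives;
    [fdiff_rdiff] returns to sequences. *)
Fixpoint rdiff (k : nat) (f : R -> R) (x : R) : R :=
  match k with
  | O => f x
  | S k => rdiff k f x - rdiff k f (x + 1)
  end.

Lemma fdiff_rdiff (f : R -> R) (k n : nat) : fdiff k (fun n => f (INR n)) n = rdiff k f (INR n).
Proof. revert n; induction k as [|k IH]; intros n; simpl fdiff; simpl rdiff; [reflexivity|]. now rewrite !IH, S_INR. Qed.

Lemma rdiff_opp (f : R -> R) (k : nat) (x : R) : rdiff k (fun x => - f x) x = - rdiff k f x.
Proof. revert x; induction k as [|k IH]; intros x; simpl; [reflexivity|rewrite !IH; ring]. Qed.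

Definition lsum {T : Type} (f : T -> R) (l : list T) : R := list_Rsum (map f l).

Lemma is_derive_lsum (f df : R -> R -> R) (l : list R) (x : R) :
  (forall a, In a l -> is_derive (f a) x (df a x)) ->
  is_derive (fun x => lsum (fun a => f a x) l) x (lsum (fun a => df a x) l).
Proof.
  induction l as [|a l IH]; intros H.
  - unfold lsum, list_Rsum; simpl. apply (is_derive_const (V := R_NormedModule)).
  - apply (is_derive_plus (V := R_NormedModule) (f a) (fun x => lsum (fun a => f a x) l)).
    + apply H; now left.
    + apply IH; intros b Hb; apply H; now right.
Qed.

Lemma lsum_ext_in {T : Type} (f g : T -> R) (l : list T) : (forall a, In a l -> f a = g a) -> lsum f l = lsum g l.
Proof. intros H; unfold lsum; f_equal; now apply map_ext_in. Qed.

Lemma lsum_scal {T : Type} (c : R) (f : T -> R) (l : list T) : lsum (fun a => c * f a) l = c * lsum f l.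
Proof. unfold lsum, list_Rsum; induction l as [|a l IH]; simpl; [ring|rewrite IH; ring]. Qed.

Lemma incr_of_derive (f df : R -> R) (a b : R) :
  a <= b -> (forall x, a <= x <= b -> is_derive f x (df x)) -> (forall x, a <= x <= b -> 0 <= df x) -> f a <= f b.
Proof.
  intros Hab Hd Hp.
  destruct (MVT_gen f a b df) as [c [Hc E]].
  - rewrite Rmin_left, Rmax_right by exact Hab. intros x Hx; apply Hd; lra.
  - rewrite Rmin_left, Rmax_right by exact Hab. intros x Hx.
    apply derivable_continuous_pt. exists (df x). apply is_derive_Reals, Hd, Hx.
  - rewrite Rmin_left, Rmax_right in Hc by exact Hab. specialize (Hp c Hc). nra.
Qed.

Lemma is_derive_rdiff (F G : R -> R -> R) (k : nat) (t : R) :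
  (forall x, 0 <= x -> is_derive (F x) t (G x t)) ->
  forall x, 0 <= x -> is_derive (fun t => rdiff k (fun x => F x t) x) t (rdiff k (fun x => G x t) x).
Proof.
  intros H; induction k as [|k IH]; intros x Hx; simpl; [now apply H|].
  apply (is_derive_minus (V := R_NormedModule)); apply IH; lra.
Qed.

Lemma is_derive_rdiff_diag (f df : R -> R) (k : nat) :
  (forall x, 0 <= x -> is_derive f x (df x)) ->
  forall x, 0 <= x -> is_derive (rdiff k f) x (rdiff k df x).
Proof.
  intros H; induction k as [|k IH]; intros x Hx; simpl; [now apply H|].
  apply (is_derive_minus (V := R_NormedModule)); [now apply IH|].
  replace (rdiff k df (x + 1)) with (scal 1 (rdiff k df (x + 1))) by apply Rmult_1_l.
  apply (is_derive_comp (V := R_NormedModule) (rdiff k f) (fun x => x + 1)); [apply IH; lra|].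
  auto_derive; [exact I|ring].
Qed.

Definition vanishes_at_0 (f : R -> R) : Prop :=
  forall eps, 0 < eps -> exists d, 0 < d /\ (forall t, 0 < t < d -> Rabs (f t) < eps).

Definition vanishes_at_oo (f : R -> R) : Prop :=
  forall eps, 0 < eps -> exists X, 0 < X /\ (forall t, X < t -> Rabs (f t) < eps).

Lemma vanishes_at_0_minus (f g : R -> R) :
  vanishes_at_0 f -> vanishes_at_0 g -> vanishes_at_0 (fun t => f t - g t).
Proof.
  intros Hf Hg eps He. destruct (Hf (eps / 2) ltac:(lra)) as [d1 [P1 H1]], (Hg (eps / 2) ltac:(lra)) as [d2 [P2 H2]].
  exists (Rmin d1 d2); split; [now apply Rmin_glb_lt|]. intros t Ht.
  pose proof (Rmin_l d1 d2). pose proof (Rmin_r d1 d2).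
  specialize (H1 t ltac:(lra)). specialize (H2 t ltac:(lra)).
  apply Rabs_def2 in H1, H2. apply Rabs_def1; lra.
Qed.

Lemma vanishes_at_oo_minus (f g : R -> R) :
  vanishes_at_oo f -> vanishes_at_oo g -> vanishes_at_oo (fun t => f t - g t).
Proof.
  intros Hf Hg eps He. destruct (Hf (eps / 2) ltac:(lra)) as [d1 [P1 H1]], (Hg (eps / 2) ltac:(lra)) as [d2 [P2 H2]].
  exists (Rmax d1 d2); pose proof (Rmax_l d1 d2); pose proof (Rmax_r d1 d2). split; [lra|]. intros t Ht.
  specialize (H1 t ltac:(lra)). specialize (H2 t ltac:(lra)).
  apply Rabs_def2 in H1, H2. apply Rabs_def1; lra.
Qed.

Lemma vanishes_at_0_lsum (f : R -> R -> R) (l : list R) :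
  (forall a, In a l -> vanishes_at_0 (f a)) -> vanishes_at_0 (fun t => lsum (fun a => f a t) l).
Proof.
  induction l as [|a l IH]; intros H.
  - intros eps He; exists 1; split; [lra|]. intros t _. unfold lsum, list_Rsum; simpl. rewrite Rabs_R0; exact He.
  - assert (Ha : vanishes_at_0 (f a)) by (apply H; now left).
    assert (Hl : vanishes_at_0 (fun t => lsum (fun a => f a t) l)) by (apply IH; intros; apply H; now right).
    intros eps He. destruct (Ha (eps / 2) ltac:(lra)) as [d1 [P1 H1]], (Hl (eps / 2) ltac:(lra)) as [d2 [P2 H2]].
    exists (Rmin d1 d2); split; [now apply Rmin_glb_lt|]. intros t Ht.
    pose proof (Rmin_l d1 d2). pose proof (Rmin_r d1 d2).
    specialize (H1 t ltac:(lra)). specialize (H2 t ltac:(lra)).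
    apply Rabs_def2 in H1, H2. unfold lsum, list_Rsum in *; simpl. apply Rabs_def1; lra.
Qed.

Lemma vanishes_at_0_Rpower (c : R) : 0 < c -> vanishes_at_0 (fun t => Rpower t c / c).
Proof.
  intros Hc eps He. exists (Rpower (eps * c) (/ c)); split; [apply exp_pos|]. intros t Ht.
  assert (0 < Rpower t c) by apply exp_pos.
  rewrite Rabs_pos_eq by (apply Rdiv_le_0_compat; lra).
  apply Rmult_lt_reg_r with c; [exact Hc|]. unfold Rdiv; rewrite Rmult_assoc, Rinv_l, Rmult_1_r by lra.
  replace (eps * c) with (Rpower (Rpower (eps * c) (/ c)) c).
  - apply Rlt_Rpower_l; [exact Hc|exact Ht].
  - rewrite Rpower_mult, Rinv_l, Rpower_1; [reflexivity|nra|lra].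
Qed.

Lemma vanishes_at_0_rdiff (F : R -> R -> R) (k : nat) :
  (forall x, 0 <= x -> vanishes_at_0 (F x)) ->
  forall x, 0 <= x -> vanishes_at_0 (fun t => rdiff k (fun x => F x t) x).
Proof.
  intros H; induction k as [|k IH]; intros x Hx; simpl; [now apply H|].
  apply vanishes_at_0_minus; apply IH; lra.
Qed.

Lemma vanishes_at_oo_rdiff (f : R -> R) (k : nat) : vanishes_at_oo f -> vanishes_at_oo (rdiff k f).
Proof.
  intros H; induction k as [|k IH]; simpl; [exact H|].
  apply vanishes_at_oo_minus; [exact IH|]. intros eps He. destruct (IH eps He) as [X [PX HX]].
  exists X; split; [exact PX|]. intros t Ht; apply HX; lra.
Qed.

(** The improper integral of t^(x-1) v(t) is replaced by a primitive F in t: its k-th difference in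
    x increases on (0,1], tends to 0 at 0, and takes the wanted value at t = 1. *)
Lemma rdiff_inv_nonneg (A B : list R) (k : nat) (x : R) :
  length A = length B -> List.Forall (fun a => 0 < a) A -> List.Forall (fun b => 0 < b) B ->
  (forall t, 0 < t <= 1 -> 0 <= v_fun A B t) -> 0 <= x ->
  0 <= rdiff k (fun x => lsum (fun a => / (a + x)) A - lsum (fun b => / (b + x)) B) x.
Proof.
  intros HL PA PB Hv Hx. rewrite Forall_forall in PA, PB.
  set (F := fun x t => lsum (fun a => Rpower t (a + x) / (a + x)) A - lsum (fun b => Rpower t (b + x) / (b + x)) B).
  set (G := fun x t => lsum (fun a => Rpower t (a + x - 1)) A - lsum (fun b => Rpower t (b + x - 1)) B).
  (* Each difference in x multiplies t^(x-1) by 1 - t. *)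
  assert (HG : forall t, 0 < t -> forall x, rdiff k (fun x => G x t) x = (1 - t) ^ k * (Rpower t (x - 1) * v_fun A B t)).
  { intros t Ht; induction k as [|k' IH]; intros y; simpl.
    - rewrite Rmult_1_l. rewrite v_fun_sums by exact HL. unfold G.
      rewrite (lsum_ext_in (fun a => Rpower t (a + y - 1)) (fun a => Rpower t (y - 1) * Rpower t a)) by (intros; rewrite <- Rpower_plus; f_equal; ring).
      rewrite (lsum_ext_in (fun a => Rpower t (a + y - 1)) (fun a => Rpower t (y - 1) * Rpower t a) B) by (intros; rewrite <- Rpower_plus; f_equal; ring).
      rewrite !lsum_scal. unfold lsum. ring.
    - rewrite !IH. replace (y + 1 - 1) with (1 + (y - 1)) by ring. rewrite Rpower_plus, Rpower_1 by exact Ht. ring. }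
  assert (HF : forall t, 0 < t -> forall x, 0 <= x -> is_derive (F x) t (G x t)).
  { intros t Ht y Hy. unfold F, G.
    assert (D : forall a, 0 < a -> is_derive (fun t => Rpower t (a + y) / (a + y)) t (Rpower t (a + y - 1))).
    { intros a Ha. unfold Rpower. auto_derive; [exact Ht|].
      replace ((a + y - 1) * ln t) with ((a + y) * ln t + - ln t) by ring.
      rewrite exp_plus, exp_Ropp, exp_ln by exact Ht. field; lra. }
    apply (is_derive_minus (V := R_NormedModule));
      [apply (is_derive_lsum (fun a t => Rpower t (a + y) / (a + y)) (fun a t => Rpower t (a + y - 1)))
      |apply (is_derive_lsum (fun a t => Rpower t (a + y) / (a + y)) (fun a t => Rpower t (a + y - 1)))];
      intros a Ha; apply D; auto. }
  assert (H1 : rdiff k (fun x => lsum (fun a => / (a + x)) A - lsum (fun b => / (b + x)) B) x = rdiff k (fun x => F x 1) x).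
  { assert (E : forall x, lsum (fun a => / (a + x)) A - lsum (fun b => / (b + x)) B = F x 1).
    { intros y. unfold F. f_equal; apply lsum_ext_in; intros a _; unfold Rpower;
        rewrite ln_1, Rmult_0_r, exp_0; unfold Rdiv; ring. }
    clear - E. revert x; induction k as [|k IH]; intros x; simpl; [apply E|now rewrite !IH]. }
  rewrite H1. apply Rnot_lt_le; intros N.
  assert (V : vanishes_at_0 (fun t => rdiff k (fun x => F x t) x)).
  { apply vanishes_at_0_rdiff; [|exact Hx]. intros y Hy. unfold F.
    apply vanishes_at_0_minus; apply (vanishes_at_0_lsum (fun a t => Rpower t (a + y) / (a + y)));
      intros a Ha; apply vanishes_at_0_Rpower; [specialize (PA a Ha)|specialize (PB a Ha)]; lra. }
  destruct (V (- rdiff k (fun x => F x 1) x) ltac:(lra)) as [d [Hd HV]].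
  set (t0 := Rmin (d / 2) 1). assert (T0 : 0 < t0 <= 1) by (split; [apply Rmin_glb_lt; lra|apply Rmin_r]).
  assert (T1 : t0 < d) by (pose proof (Rmin_l (d / 2) 1); unfold t0; lra).
  specialize (HV t0 ltac:(lra)). apply Rabs_def2 in HV.
  pose proof (incr_of_derive (fun t => rdiff k (fun x => F x t) x) (fun t => rdiff k (fun x => G x t) x) t0 1 ltac:(lra)) as I.
  cut (rdiff k (fun x => F x t0) x <= rdiff k (fun x => F x 1) x); [lra|]. apply I.
  - intros t Ht. apply is_derive_rdiff; [|exact Hx]. intros y Hy. apply HF; lra.
  - intros t Ht. rewrite HG by lra. apply Rmult_le_pos; [apply pow_le; lra|].
    apply Rmult_le_pos; [left; apply exp_pos|apply Hv; lra].
Qed.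

(** Equal lengths let the entries be paired, and ln ((w + t) / (u + t)) <= (w - u) / (u + t) for
    each pair. *)
Lemma vanishes_at_oo_ln_diff (A B : list R) :
  length A = length B -> List.Forall (fun a => 0 < a) A -> List.Forall (fun b => 0 < b) B ->
  vanishes_at_oo (fun x => lsum (fun b => ln (b + x)) B - lsum (fun a => ln (a + x)) A).
Proof.
  revert B; induction A as [|a A IH]; intros [|b B] HL PA PB; try discriminate.
  - intros eps He; exists 1; split; [lra|]. intros t _. unfold lsum, list_Rsum; simpl. rewrite Rminus_0_r, Rabs_R0; exact He.
  - inversion PA; inversion PB; subst. specialize (IH B ltac:(simpl in HL; lia) H2 H6).
    assert (K : vanishes_at_oo (fun x => ln (a + x) - ln (b + x))).
    { intros eps He. exists (Rabs (b - a) / eps + 1). pose proof (Rabs_pos (b - a)).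
      assert (0 <= Rabs (b - a) / eps) by (apply Rdiv_le_0_compat; lra). split; [lra|]. intros t Ht.
      assert (L : forall u w, 0 < u -> 0 < w -> Rabs (b - a) = Rabs (w - u) -> ln (w + t) - ln (u + t) < eps).
      { intros u w Hu Hw E. rewrite <- ln_div by lra.
        apply Rle_lt_trans with ((w + t) / (u + t) - 1).
        - pose proof (exp_ineq1_le (ln ((w + t) / (u + t)))) as X. rewrite exp_ln in X; [lra|apply Rdiv_lt_0_compat; lra].
        - replace ((w + t) / (u + t) - 1) with ((w - u) / (u + t)) by (field; lra).
          apply Rmult_lt_reg_r with (u + t); [lra|]. unfold Rdiv; rewrite Rmult_assoc, Rinv_l, Rmult_1_r by lra.
          apply Rle_lt_trans with (Rabs (w - u)); [apply Rle_abs|]. rewrite <- E.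
          apply Rmult_lt_compat_l with (r := eps) in Ht; [|exact He].
          replace (eps * (Rabs (b - a) / eps + 1)) with (Rabs (b - a) + eps) in Ht by (field; lra). nra. }
      apply Rabs_def1; [apply L; auto; apply Rabs_minus_sym|]. specialize (L a b ltac:(auto) ltac:(auto) eq_refl). lra. }
    pose proof (vanishes_at_oo_minus _ _ IH K) as V. intros eps He. destruct (V eps He) as [X [PX HX]].
    exists X; split; [exact PX|]. intros t Ht. specialize (HX t Ht).
    replace (lsum (fun b => ln (b + t)) (b :: B) - lsum (fun a => ln (a + t)) (a :: A)) with
      (lsum (fun b => ln (b + t)) B - lsum (fun a => ln (a + t)) A - (ln (a + t) - ln (b + t))); [exact HX|].
    unfold lsum, list_Rsum; simpl. ring.
Qed.

(** Every difference of f tends to 0 at infinity and has a nonpositive derivative by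
    [rdiff_inv_nonneg], hence is nonnegative. *)
Lemma cm_seq_log_ratio (A B : list R) :
  length A = length B -> List.Forall (fun a => 0 < a) A -> List.Forall (fun b => 0 < b) B ->
  (forall t, 0 < t <= 1 -> 0 <= v_fun A B t) ->
  cm_seq (fun n => lsum (fun b => ln (b + INR n)) B - lsum (fun a => ln (a + INR n)) A).
Proof.
  intros HL PA PB Hv k n.
  set (f := fun x => lsum (fun b => ln (b + x)) B - lsum (fun a => ln (a + x)) A).
  set (g := fun x => lsum (fun a => / (a + x)) A - lsum (fun b => / (b + x)) B).
  change (0 <= fdiff k (fun n => f (INR n)) n). rewrite fdiff_rdiff.
  assert (Hd : forall x, 0 <= x -> is_derive f x (- g x)).
  { intros x Hx. unfold f, g. rewrite Forall_forall in PA, PB. rewrite Ropp_minus_distr.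
    assert (D : forall a, 0 < a -> is_derive (fun x => ln (a + x)) x (/ (a + x))).
    { intros a Ha. auto_derive; [lra|field; lra]. }
    apply (is_derive_minus (V := R_NormedModule));
      apply (is_derive_lsum (fun a x => ln (a + x)) (fun a x => / (a + x))); intros a Ha; apply D; auto. }
  apply Rnot_lt_le; intros N.
  destruct (vanishes_at_oo_rdiff f k (vanishes_at_oo_ln_diff A B HL PA PB) (- rdiff k f (INR n)) ltac:(lra)) as [X [PX HX]].
  set (y := Rmax (INR n) (X + 1)). pose proof (Rmax_l (INR n) (X + 1)). pose proof (Rmax_r (INR n) (X + 1)).
  assert (Y := HX y ltac:(unfold y; lra)). apply Rabs_def2 in Y. pose proof (pos_INR n).
  pose proof (incr_of_derive (fun x => - rdiff k f x) (fun x => - rdiff k (fun x => - g x) x) (INR n) y ltac:(unfold y; lra)) as I.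
  cut (- rdiff k f (INR n) <= - rdiff k f y); [lra|]. apply I.
  - intros x Hx. apply (is_derive_opp (V := R_NormedModule)), is_derive_rdiff_diag; [exact Hd|lra].
  - intros x Hx. rewrite rdiff_opp, Ropp_involutive. apply rdiff_inv_nonneg; auto; lra.
Qed.

Definition moment (A B : list R) (n : nat) : R :=
  list_Rprod (map (fun a => pochhammer a n) A) / list_Rprod (map (fun b => pochhammer b n) B).

Lemma pochhammer_pos (a : R) (n : nat) : 0 < a -> 0 < pochhammer a n.
Proof.
  intros Ha; induction n as [|n IH]; simpl; [lra|]. apply Rmult_lt_0_compat; [exact IH|]. pose proof (pos_INR n); lra.
Qed.

Lemma list_Rprod_pos (f : R -> R) (l : list R) : (forall a, In a l -> 0 < f a) -> 0 < list_Rprod (map f l).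
Proof.
  unfold list_Rprod; induction l as [|a l IH]; simpl; intros H; [lra|].
  apply Rmult_lt_0_compat; [apply H; now left|apply IH; intros; apply H; now right].
Qed.

Lemma list_Rprod_mult (f g : R -> R) (l : list R) :
  list_Rprod (map (fun a => f a * g a) l) = list_Rprod (map f l) * list_Rprod (map g l).
Proof. unfold list_Rprod; induction l as [|a l IH]; simpl; [ring|rewrite IH; ring]. Qed.

Lemma exp_lsum_ln (f : R -> R) (l : list R) :
  (forall a, In a l -> 0 < f a) -> exp (lsum (fun a => ln (f a)) l) = list_Rprod (map f l).
Proof.
  unfold lsum, list_Rsum, list_Rprod; induction l as [|a l IH]; simpl; intros H; [apply exp_0|].
  rewrite exp_plus, exp_ln, IH by (auto; apply H; now left). reflexivity.
Qed.

Lemma moment_cm_seq (A B : list R) :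
  length A = length B -> List.Forall (fun a => 0 < a) A -> List.Forall (fun b => 0 < b) B ->
  (forall t, 0 < t <= 1 -> 0 <= v_fun A B t) -> cm_seq (moment A B).
Proof.
  intros HL PA PB Hv. pose proof (cm_seq_log_ratio A B HL PA PB Hv) as Hp.
  rewrite Forall_forall in PA, PB.
  assert (QA : forall n, 0 < list_Rprod (map (fun a => pochhammer a n) A)).
  { intros n; apply list_Rprod_pos; intros; apply pochhammer_pos; auto. }
  assert (QB : forall n, 0 < list_Rprod (map (fun a => pochhammer a n) B)).
  { intros n; apply list_Rprod_pos; intros; apply pochhammer_pos; auto. }
  refine (cm_seq_exp_ratio _ _ Hp _ _); intros n.
  - left; apply Rdiv_lt_0_compat; auto.
  - assert (RA : 0 < list_Rprod (map (fun a => a + INR n) A)).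
    { apply list_Rprod_pos; intros a Ha. pose proof (pos_INR n). specialize (PA a Ha). lra. }
    assert (RB : 0 < list_Rprod (map (fun a => a + INR n) B)).
    { apply list_Rprod_pos; intros a Ha. pose proof (pos_INR n). specialize (PB a Ha). lra. }
    unfold Rminus. rewrite exp_plus, exp_Ropp.
    rewrite (exp_lsum_ln (fun a => a + INR n) A), (exp_lsum_ln (fun a => a + INR n) B)
      by (intros a Ha; pose proof (pos_INR n); [specialize (PA a Ha) || specialize (PB a Ha)]; lra).
    unfold moment. simpl pochhammer.
    rewrite (list_Rprod_mult (fun a => pochhammer a n) (fun a => a + INR n) A),
      (list_Rprod_mult (fun a => pochhammer a n) (fun a => a + INR n) B).
    specialize (QA n). specialize (QB n). field. repeat split; lra.
Qed.

Lemma moment_0 (A B : list R) : moment A B 0 = 1.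
Proof.
  assert (E : forall l, list_Rprod (map (fun a => pochhammer a 0) l) = 1).
  { unfold list_Rprod; induction l as [|a l IH]; simpl in *; [reflexivity|rewrite IH; ring]. }
  unfold moment. rewrite !E. field.
Qed.

(** * Complete monotonicity of the real series *)

(** The coefficients of (1 - y)^(-al), for al of either sign. *)
Definition binc (al : R) (n : nat) : R := pochhammer al n / INR (Factorial.fact n).

Lemma binc_0 (al : R) : binc al 0 = 1.
Proof. unfold binc; simpl; field. Qed.

Lemma binc_succ (al : R) (n : nat) : INR (S n) * binc al (S n) = (al + INR n) * binc al n.
Proof.
  unfold binc. rewrite fact_simpl, mult_INR. simpl pochhammer.
  pose proof (INR_fact_neq_0 n). field. split; [assumption|apply not_0_INR; lia].
Qed.

Lemma binc_pos (al : R) (n : nat) : 0 < al -> 0 < binc al n.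
Proof. intros H; apply Rdiv_lt_0_compat; [now apply pochhammer_pos|apply INR_fact_lt_0]. Qed.

Lemma initial_bound (b : nat -> R) (N : nat) : exists M, forall n, (n <= N)%nat -> b n <= M.
Proof.
  induction N as [|N [M HM]].
  - exists (b 0%nat); intros n Hn; replace n with 0%nat by lia; lra.
  - exists (Rmax M (b (S N))); intros n Hn. destruct (Nat.eq_dec n (S N)) as [->|E]; [apply Rmax_r|].
    eapply Rle_trans; [apply HM; lia|apply Rmax_l].
Qed.

Lemma eventually_decr_bounded (b : nat -> R) (N : nat) :
  (forall n, (N <= n)%nat -> b (S n) <= b n) -> exists M, forall n, b n <= M.
Proof.
  intros H. destruct (initial_bound b N) as [M HM]. exists M; intros n.
  destruct (Nat.le_gt_cases n N) as [h|h]; [now apply HM|].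
  replace n with (N + (n - N))%nat by lia. induction (n - N)%nat as [|k IH].
  - rewrite Nat.add_0_r; now apply HM.
  - rewrite Nat.add_succ_r. eapply Rle_trans; [apply H; lia|exact IH].
Qed.

(** The ratio of successive terms is |al + n| r / (n + 1), at most 1 as soon as n (1 - r) >=
    |al|. *)
Lemma binc_growth (al r : R) : 0 <= r < 1 -> exists M, forall n, Rabs (binc al n) * r ^ n <= M.
Proof.
  intros Hr. destruct (nfloor_ex (Rabs al / (1 - r))) as [N [_ HN]].
  { apply Rdiv_le_0_compat; [apply Rabs_pos|lra]. }
  apply (eventually_decr_bounded _ (S N)). intros n Hn.
  assert (Hn' : INR N + 1 <= INR n) by (rewrite <- S_INR; now apply le_INR).
  assert (K : (Rabs al + INR n) * r <= INR (S n)).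
  { apply Rmult_lt_compat_r with (r := 1 - r) in HN; [|lra].
    replace (Rabs al / (1 - r) * (1 - r)) with (Rabs al) in HN by (field; lra).
    rewrite S_INR. pose proof (Rabs_pos al). nra. }
  assert (P : 0 < INR (S n)) by (apply lt_0_INR; lia).
  assert (E : Rabs (binc al (S n)) * INR (S n) = Rabs (al + INR n) * Rabs (binc al n)).
  { rewrite <- Rabs_mult, <- binc_succ, Rabs_mult, (Rabs_pos_eq (INR (S n))) by lra. ring. }
  apply Rmult_le_reg_l with (INR (S n)); [exact P|].
  replace (INR (S n) * (Rabs (binc al (S n)) * r ^ S n)) with (Rabs (binc al (S n)) * INR (S n) * (r * r ^ n)) by (simpl; ring).
  rewrite E.
  assert (T : Rabs (al + INR n) <= Rabs al + INR n).
  { eapply Rle_trans; [apply Rabs_triang|]. rewrite (Rabs_pos_eq (INR n)) by apply pos_INR. lra. }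
  assert (Z : 0 <= Rabs (binc al n) * r ^ n) by (apply Rmult_le_pos; [apply Rabs_pos|apply pow_le; lra]).
  replace (Rabs (al + INR n) * Rabs (binc al n) * (r * r ^ n)) with (Rabs (al + INR n) * r * (Rabs (binc al n) * r ^ n)) by ring.
  apply Rmult_le_compat_r; [exact Z|]. eapply Rle_trans; [|exact K]. apply Rmult_le_compat_r; lra.
Qed.

Lemma CV_radius_binc_mult (al : R) (d : nat -> R) :
  (forall n, Rabs (d n) <= 1) -> Rbar_le 1 (CV_radius (fun n => binc al n * d n)).
Proof.
  intros Hd. destruct (Rbar_le_lt_dec 1 (CV_radius (fun n => binc al n * d n))) as [h|h]; [exact h|exfalso].
  pose proof (CV_radius_ge_0 (fun n => binc al n * d n)) as P.
  destruct (CV_radius (fun n => binc al n * d n)) as [v| |] eqn:E; simpl in h, P; try contradiction.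
  destruct (binc_growth al ((v + 1) / 2) ltac:(lra)) as [M HM].
  assert (K : Rbar_le ((v + 1) / 2) (CV_radius (fun n => binc al n * d n))).
  { apply (CV_radius_bounded (fun n => binc al n * d n)). exists M; intros n.
    rewrite !Rabs_mult, (Rabs_pos_eq (((v + 1) / 2) ^ n)) by (apply pow_le; lra).
    eapply Rle_trans; [|apply HM]. apply Rmult_le_compat_r; [apply pow_le; lra|].
    specialize (Hd n). pose proof (Rabs_pos (binc al n)). nra. }
  rewrite E in K. simpl in K. lra.
Qed.

(** The sum of c_n (x + 1)^(-be - n), factored so that the calculus of real power series applies at
    1 / (x + 1). *)
Definition sps (be : R) (c : nat -> R) (x : R) : R := Rpower (x + 1) (- be) * PSeries c (/ (x + 1)).

(** The effect of - d/dx on [sps be c], whose exponent becomes be + 1; on power series in u it is be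
    + u d/du. *)
Definition euler_coef (be : R) (c : nat -> R) (n : nat) : R := (be + INR n) * c n.

Lemma euler_coef_split (be : R) (c : nat -> R) (n : nat) :
  euler_coef be c n = PS_plus (PS_scal be c) (PS_incr_1 (PS_derive c)) n.
Proof.
  unfold euler_coef, PS_plus, PS_scal, PS_incr_1, PS_derive. destruct n as [|n].
  - change ((be + INR 0) * c 0%nat = be * c 0%nat + 0). simpl; ring.
  - change ((be + INR (S n)) * c (S n) = be * c (S n) + INR (S n) * c (S n)). ring.
Qed.

Lemma CV_radius_euler_coef (be : R) (c : nat -> R) :
  0 < be -> Rbar_le 1 (CV_radius c) -> Rbar_le 1 (CV_radius (euler_coef be c)).
Proof.
  intros Hb Hc. rewrite (CV_radius_ext _ _ (euler_coef_split be c)).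
  eapply Rbar_le_trans; [|apply CV_radius_plus].
  rewrite CV_radius_scal, CV_radius_incr_1, CV_radius_derive by lra.
  apply Rbar_min_case; exact Hc.
Qed.

Lemma inv_succ_CV (c : nat -> R) (x : R) :
  Rbar_le 1 (CV_radius c) -> 0 < x -> Rbar_lt (Rabs (/ (x + 1))) (CV_radius c).
Proof.
  intros Hc Hx. eapply Rbar_lt_le_trans; [|exact Hc]. simpl.
  rewrite Rabs_pos_eq by (left; apply Rinv_0_lt_compat; lra).
  rewrite <- Rinv_1. apply Rinv_lt_contravar; lra.
Qed.

Lemma PSeries_euler_coef (be : R) (c : nat -> R) (u : R) :
  Rbar_lt (Rabs u) (CV_radius c) ->
  PSeries (euler_coef be c) u = be * PSeries c u + u * PSeries (PS_derive c) u.
Proof.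
  intros Hu. rewrite (PSeries_ext _ _ u (euler_coef_split be c)), PSeries_plus.
  - now rewrite PSeries_scal, PSeries_incr_1.
  - apply ex_pseries_scal; [apply Rmult_comm|now apply CV_radius_inside].
  - apply ex_pseries_incr_1, CV_radius_inside. now rewrite CV_radius_derive.
Qed.

Lemma is_derive_sps (be : R) (c : nat -> R) (x : R) :
  Rbar_le 1 (CV_radius c) -> 0 < x ->
  is_derive (sps be c) x (- sps (be + 1) (euler_coef be c) x).
Proof.
  intros Hc Hx. assert (Hu := inv_succ_CV c x Hc Hx).
  assert (D1 : is_derive (fun x => / (x + 1)) x (- (/ (x + 1) * / (x + 1)))).
  { auto_derive; [lra|field; lra]. }
  assert (D2 : is_derive (fun x => PSeries c (/ (x + 1))) x (- (/ (x + 1) * / (x + 1)) * PSeries (PS_derive c) (/ (x + 1)))).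
  { apply (is_derive_comp (V := R_NormedModule) (PSeries c) (fun x => / (x + 1))); [now apply is_derive_PSeries|exact D1]. }
  assert (D3 : is_derive (fun x => Rpower (x + 1) (- be)) x (- be * Rpower (x + 1) (- (be + 1)))).
  { unfold Rpower. auto_derive; [lra|].
    replace (- (be + 1) * ln (x + 1)) with (- be * ln (x + 1) + - ln (x + 1)) by ring.
    rewrite exp_plus, exp_Ropp, exp_ln by lra. field; lra. }
  unfold sps. rewrite PSeries_euler_coef by exact Hu.
  replace (- (Rpower (x + 1) (- (be + 1)) * (be * PSeries c (/ (x + 1)) + / (x + 1) * PSeries (PS_derive c) (/ (x + 1)))))
    with (- be * Rpower (x + 1) (- (be + 1)) * PSeries c (/ (x + 1)) +
          Rpower (x + 1) (- be) * (- (/ (x + 1) * / (x + 1)) * PSeries (PS_derive c) (/ (x + 1)))).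
  - apply (is_derive_mult (fun x => Rpower (x + 1) (- be)) (fun x => PSeries c (/ (x + 1))) x _ _ D3 D2 Rmult_comm).
  - replace (Rpower (x + 1) (- be)) with (Rpower (x + 1) (- (be + 1)) * (x + 1)); [field; lra|].
    rewrite <- (Rpower_1 (x + 1)) at 2 by lra. rewrite <- Rpower_plus. f_equal; ring.
Qed.

Lemma PSeries_nonneg (c : nat -> R) (u : R) :
  (forall n, 0 <= c n) -> 0 <= u -> Rbar_lt (Rabs u) (CV_radius c) -> c 0%nat <= PSeries c u.
Proof.
  intros Hc Hu Hr. unfold PSeries.
  assert (E := CV_radius_inside c u Hr). apply ex_pseries_R in E.
  rewrite Series_incr_1 by exact E. rewrite pow_O, Rmult_1_r.
  enough (0 <= Series (fun k => c (S k) * u ^ S k)) by lra.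
  apply Rle_trans with (Series (fun _ : nat => 0)).
  - right. symmetry. rewrite (Series_ext _ (fun n => 0 * 0)) by (intros; ring). rewrite Series_scal_l; ring.
  - apply Series_le; [|now apply ex_series_incr_1 in E]. intros n; split; [lra|].
    apply Rmult_le_pos; [apply Hc|now apply pow_le].
Qed.

Lemma sps_ge (be : R) (c : nat -> R) (x : R) :
  (forall n, 0 <= c n) -> Rbar_le 1 (CV_radius c) -> 0 < x ->
  Rpower (x + 1) (- be) * c 0%nat <= sps be c x.
Proof.
  intros Hc Hr Hx. apply Rmult_le_compat_l; [left; apply exp_pos|].
  apply PSeries_nonneg; [exact Hc|left; apply Rinv_0_lt_compat; lra|now apply inv_succ_CV].
Qed.

(** Differentiation keeps the class: the n-th derivative is (-1)^n [sps (be + n)] of nonnegative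
    coefficients, with radius still at least 1. *)
Lemma completely_monotone_sps (be : R) (c : nat -> R) (f : R -> R) :
  0 < be -> (forall n, 0 <= c n) -> Rbar_le 1 (CV_radius c) ->
  (forall x, 0 < x -> f x = sps be c x) -> completely_monotone f.
Proof.
  intros Hb Hc Hr Hf.
  assert (K : forall n, exists c', (forall n, 0 <= c' n) /\ Rbar_le 1 (CV_radius c') /\
    (forall x, 0 < x -> ex_derive_n f n x) /\
    (forall x, 0 < x -> Derive_n f n x = (-1) ^ n * sps (be + INR n) c' x)).
  { induction n as [|n (c' & P & Q & _ & E)].
    - exists c. repeat split; auto. intros x Hx; simpl. now rewrite Rplus_0_r, Rmult_1_l, Hf.
    - exists (euler_coef (be + INR n) c'). pose proof (pos_INR n).
      assert (D : forall x, 0 < x -> is_derive (Derive_n f n) x ((-1) ^ S n * sps (be + INR (S n)) (euler_coef (be + INR n) c') x)).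
      { intros x Hx. apply (is_derive_ext_loc (fun x => (-1) ^ n * sps (be + INR n) c' x)).
        - exists (mkposreal x Hx). intros y Hy. symmetry; apply E.
          change (Rabs (y - x) < x) in Hy. apply Rabs_def2 in Hy. lra.
        - replace ((-1) ^ S n * sps (be + INR (S n)) (euler_coef (be + INR n) c') x)
            with ((-1) ^ n * (- sps (be + INR n + 1) (euler_coef (be + INR n) c') x))
            by (rewrite S_INR, Rplus_assoc; simpl; ring).
          apply (is_derive_scal (fun x => sps (be + INR n) c' x)). now apply is_derive_sps. }
      repeat split.
      + intros m. apply Rmult_le_pos; [pose proof (pos_INR m); lra|apply P].
      + apply CV_radius_euler_coef; [lra|exact Q].
      + intros x Hx. eexists. now apply D.
      + intros x Hx. simpl Derive_n. apply is_derive_unique. now apply D. }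
  intros n x Hx. destruct (K n) as (c' & P & Q & D & E). split; [now apply D|].
  rewrite E by exact Hx. rewrite <- Rmult_assoc, <- Rpow_mult_distr.
  replace (-1 * -1) with 1 by ring. rewrite pow1, Rmult_1_l.
  eapply Rle_trans; [|apply (sps_ge (be + INR n) c' x P Q Hx)].
  apply Rmult_le_pos; [left; apply exp_pos|apply P].
Qed.

(** * Logarithmic derivative of a series with log-convex coefficients *)

(* The coefficients tau_(n-1), ..., tau_0 of S'/S, where S = sum s_k u^k and s 0 = 1. *)
Fixpoint logder_rev (s : nat -> R) (n : nat) : list R :=
  match n with
  | O => nil
  | S m => (INR (S m) * s (S m) - sum_f_R0 (fun j => s (S j) * nth j (logder_rev s m) 0) m) :: logder_rev s m
  end.

Definition logder (s : nat -> R) (n : nat) : R := hd 0 (logder_rev s (S n)).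

Lemma length_logder_rev (s : nat -> R) (n : nat) : length (logder_rev s n) = n.
Proof. induction n as [|n IH]; simpl; [reflexivity|now rewrite IH]. Qed.

Lemma nth_logder_rev (s : nat -> R) (j k : nat) : nth j (logder_rev s (S (j + k))) 0 = logder s k.
Proof. induction j as [|j IH]; [reflexivity|]. rewrite <- IH. reflexivity. Qed.

Lemma logder_0 (s : nat -> R) : logder s 0 = s 1%nat.
Proof. unfold logder; simpl; ring. Qed.

Lemma logder_succ (s : nat -> R) (m : nat) :
  logder s (S m) = INR (S (S m)) * s (S (S m)) - sum_f_R0 (fun j => s (S j) * logder s (m - j)) m.
Proof.
  change (logder s (S m)) with (INR (S (S m)) * s (S (S m)) - sum_f_R0 (fun j => s (S j) * nth j (logder_rev s (S m)) 0) (S m)).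
  (* The list has S m entries, so the last summand reads the default 0. *)
  rewrite tech5, (nth_overflow (logder_rev s (S m))) by (rewrite length_logder_rev; lia).
  rewrite Rmult_0_r, Rplus_0_r. f_equal. apply sum_eq. intros j Hj. f_equal.
  rewrite <- (nth_logder_rev s j (m - j)). do 2 f_equal. lia.
Qed.

Lemma PS_mult_logder (s : nat -> R) (n : nat) : s 0%nat = 1 -> PS_mult s (logder s) n = PS_derive s n.
Proof.
  intros H0. unfold PS_mult, PS_derive. destruct n as [|m].
  - simpl. rewrite H0, logder_0. ring.
  - rewrite decomp_sum by lia. simpl pred. rewrite Nat.sub_0_r, H0, Rmult_1_l, logder_succ.
    change (fun i => s (S i) * logder s (S m - S i)) with (fun j => s (S j) * logder s (m - j)).
    ring.
Qed.

Lemma log_convex_ratio (s : nat -> R) (i j : nat) :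
  (forall n, 0 < s n) -> (forall n, s (S n) * s (S n) <= s n * s (S (S n))) -> (j <= i)%nat ->
  s (S j) * s i <= s (S i) * s j.
Proof.
  intros P L H. induction H as [|i Hi IH]; [lra|].
  pose proof (P i). pose proof (P (S i)). pose proof (P j). specialize (L i).
  apply Rmult_le_reg_r with (s i); [assumption|].
  apply Rle_trans with (s (S i) * (s (S i) * s j)); [nra|].
  replace (s (S (S i)) * s j * s i) with (s j * (s i * s (S (S i)))) by ring. nra.
Qed.

(** Kaluza: log-convexity gives s_(j+1) <= (s_(m+2) / s_(m+1)) s_j for j <= m, so the subtracted sum
    is at most that ratio times (m + 1) s_(m+1), that is (m + 1) s_(m+2); what remains is at least
    s_(m+2). The second alternative is the constant series, where no ratio can be formed. *)
Lemma logder_nonneg (s : nat -> R) (n : nat) :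
  s 0%nat = 1 -> (forall n, 0 <= s n) -> (forall n, s (S n) * s (S n) <= s n * s (S (S n))) ->
  (forall n, 0 < s n) \/ (forall n, s (S n) = 0) -> 0 <= logder s n.
Proof.
  intros H0 P L [Q|Q].
  - induction n as [n IH] using (well_founded_ind Nat.lt_wf_0). destruct n as [|m]; [rewrite logder_0; apply P|].
    rewrite logder_succ.
    assert (E := PS_mult_logder s m H0). unfold PS_mult, PS_derive in E.
    assert (K : sum_f_R0 (fun j => s (S j) * logder s (m - j)) m
                <= s (S (S m)) / s (S m) * (INR (S m) * s (S m))).
    { rewrite <- E, scal_sum. apply sum_Rle. intros j Hj.
      replace (s j * logder s (m - j) * (s (S (S m)) / s (S m))) with (s (S (S m)) / s (S m) * s j * logder s (m - j)) by ring.
      apply Rmult_le_compat_r; [apply IH; lia|].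
      pose proof (log_convex_ratio s (S m) j Q L ltac:(lia)). pose proof (Q (S m)).
      apply Rmult_le_reg_r with (s (S m)); [assumption|].
      replace (s (S (S m)) / s (S m) * s j * s (S m)) with (s (S (S m)) * s j) by (field; lra). assumption. }
    replace (s (S (S m)) / s (S m) * (INR (S m) * s (S m))) with (INR (S m) * s (S (S m))) in K
      by (field; apply Rgt_not_eq, Q).
    specialize (P (S (S m))). rewrite (S_INR (S m)). lra.
  - destruct n as [|m]; [rewrite logder_0, Q; lra|]. rewrite logder_succ, Q.
    rewrite (sum_eq _ (fun _ => 0)) by (intros; rewrite Q; ring).
    rewrite sum_cte. lra.
Qed.

(** As s_0 = 1, tau_n is one term of a convolution with nonnegative terms; this bounds the radius of
    S'/S from below. *)
Lemma logder_le (s : nat -> R) (n : nat) :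
  s 0%nat = 1 -> (forall n, 0 <= s n) -> (forall n, 0 <= logder s n) -> logder s n <= PS_derive s n.
Proof.
  intros H0 P T. rewrite <- PS_mult_logder by exact H0. unfold PS_mult. destruct n as [|m].
  - simpl. rewrite H0; lra.
  - rewrite decomp_sum by lia. rewrite Nat.sub_0_r, H0, Rmult_1_l.
    enough (0 <= sum_f_R0 (fun i => s (S i) * logder s (S m - S i)) (pred (S m))) by lra.
    apply cond_pos_sum. intros j; apply Rmult_le_pos; auto.
Qed.

Lemma CV_radius_dominated (a b : nat -> R) :
  (forall n, Rabs (a n) <= Rabs (b n)) -> Rbar_le (CV_radius b) (CV_radius a).
Proof.
  intros H. apply (CV_radius_bounded b). intros r [M HM]. apply (CV_radius_bounded a). exists M; intros n.
  eapply Rle_trans; [|apply (HM n)]. rewrite !Rabs_mult. apply Rmult_le_compat_r; [apply Rabs_pos|apply H].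
Qed.

Lemma log_completely_monotone_sps (be : R) (s : nat -> R) :
  0 < be -> s 0%nat = 1 -> (forall n, 0 <= s n) -> Rbar_le 1 (CV_radius s) ->
  (forall n, s (S n) * s (S n) <= s n * s (S (S n))) ->
  (forall n, 0 < s n) \/ (forall n, s (S n) = 0) ->
  log_completely_monotone (sps be s).
Proof.
  intros Hb H0 P Hr L Q.
  assert (T : forall n, 0 <= logder s n) by (intros n; now apply logder_nonneg).
  assert (RT : Rbar_le 1 (CV_radius (logder s))).
  { eapply Rbar_le_trans; [|apply (CV_radius_dominated _ (PS_derive s))]; [now rewrite CV_radius_derive|].
    intros n. rewrite !Rabs_pos_eq; [now apply logder_le|apply Rmult_le_pos; [apply pos_INR|apply P]|apply T]. }
  assert (Pos : forall x, 0 < x -> 0 < sps be s x).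
  { intros x Hx. eapply Rlt_le_trans; [|apply (sps_ge be s x P Hr Hx)]. rewrite H0, Rmult_1_r. apply exp_pos. }
  (* With u = 1 / (x + 1), minus the logarithmic derivative is be u + u^2 S'(u) / S(u), which is
     [sps 1 c]. *)
  set (c := fun n => match n with O => be | S m => logder s m end).
  assert (D : forall x, 0 < x -> is_derive (fun t => ln (sps be s t)) x (- sps 1 c x)).
  { intros x Hx. assert (Hu := inv_succ_CV s x Hr Hx). assert (Hv := inv_succ_CV _ x RT Hx).
    assert (PS : 0 < PSeries s (/ (x + 1))).
    { apply Rlt_le_trans with (s 0%nat); [lra|]. apply PSeries_nonneg; [exact P|left; apply Rinv_0_lt_compat; lra|exact Hu]. }
    replace (- sps 1 c x) with (- sps (be + 1) (euler_coef be s) x * / sps be s x).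
    - apply (is_derive_comp (V := R_NormedModule) ln (sps be s)); [|now apply is_derive_sps].
      specialize (Pos x Hx). auto_derive; [exact Pos|field; lra].
    - unfold sps. rewrite PSeries_euler_coef by exact Hu.
      rewrite <- (PSeries_ext _ _ _ (fun n => PS_mult_logder s n H0)), PSeries_mult by assumption.
      assert (Ec : PSeries c (/ (x + 1)) = be + / (x + 1) * PSeries (logder s) (/ (x + 1))).
      { rewrite PSeries_decr_1; [reflexivity|]. apply CV_radius_inside. now rewrite <- CV_radius_decr_1. }
      rewrite Ec, !Rpower_Ropp, Rpower_plus, Rpower_1 by lra.
      assert (0 < Rpower (x + 1) be) by apply exp_pos. field. repeat split; lra. }
  split; [exact Pos|split; [intros x Hx; eexists; now apply D|]].
  apply (completely_monotone_sps 1 c); [lra| | |].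
  - intros [|k]; [simpl; lra|apply T].
  - rewrite <- CV_radius_decr_1; exact RT.
  - intros y Hy. apply D, is_derive_unique in Hy. apply Ropp_eq_compat in Hy.
    rewrite Ropp_involutive in Hy. exact Hy.
Qed.

Lemma completely_monotone_moment_series (sg : R) (d : nat -> R) :
  0 < sg -> cm_seq d -> d 0%nat = 1 ->
  completely_monotone (sps sg (fun n => binc sg n * d n)) /\
  (sg <= 1 -> log_completely_monotone (sps sg (fun n => binc sg n * d n))).
Proof.
  intros Hs Hd D0.
  assert (d_pos : forall n, 0 <= d n) by (intros n; apply (Hd 0%nat)).
  assert (d_decr : forall n, d (S n) <= d n) by (intros n; pose proof (Hd 1%nat n) as X; simpl in X; lra).
  assert (d_le : forall n, d n <= 1).
  { induction n as [|n IH]; [lra|]. specialize (d_decr n); lra. }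
  assert (Hr : Rbar_le 1 (CV_radius (fun n => binc sg n * d n))).
  { apply CV_radius_binc_mult. intros n; rewrite Rabs_pos_eq; auto. }
  assert (P : forall n, 0 <= binc sg n * d n).
  { intros n; apply Rmult_le_pos; [left; now apply binc_pos|apply d_pos]. }
  split; [now apply (completely_monotone_sps sg _ _ Hs P Hr)|].
  intros Hs1. apply log_completely_monotone_sps; auto.
  - rewrite binc_0, D0; ring.
  - intros n. pose proof (cm_seq_log_convex d n Hd) as Ld.
    (* After clearing denominators this is (N + 2) (sg + N) <= (N + 1) (sg + N + 1), that is sg <=
       1. *)
    assert (Lb : binc sg (S n) * binc sg (S n) <= binc sg n * binc sg (S (S n))).
    { pose proof (binc_succ sg n) as E1. pose proof (binc_succ sg (S n)) as E2. rewrite (S_INR (S n)) in E2. rewrite !S_INR in E1, E2.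
      pose proof (binc_pos sg n Hs). pose proof (binc_pos sg (S n) Hs). pose proof (pos_INR n).
      set (N := INR n) in *. set (b0 := binc sg n) in *. set (b1 := binc sg (S n)) in *. set (b2 := binc sg (S (S n))) in *.
      apply Rmult_le_reg_l with ((N + 1 + 1) * (sg + N)); [nra|].
      replace ((N + 1 + 1) * (sg + N) * (b0 * b2)) with ((sg + N) * b0 * ((N + 1 + 1) * b2)) by ring.
      rewrite E2, <- E1. assert (0 <= b1 * b1) by nra. nra. }
    replace (binc sg (S n) * d (S n) * (binc sg (S n) * d (S n))) with (binc sg (S n) * binc sg (S n) * (d (S n) * d (S n))) by ring.
    replace (binc sg n * d n * (binc sg (S (S n)) * d (S (S n)))) with (binc sg n * binc sg (S (S n)) * (d n * d (S (S n)))) by ring.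
    pose proof (d_pos (S n)). pose proof (binc_pos sg (S n) Hs). apply Rmult_le_compat; nra.
  - destruct (classic (forall n, 0 < d n)) as [K|K].
    + left; intros n; apply Rmult_lt_0_compat; [now apply binc_pos|apply K].
    (* A zero of d moves down to index 1 by log-convexity and then up to all later indices by
       monotonicity; A = B is such a case. *)
    + right. apply not_all_ex_not in K as [n Hn]. assert (Z : d n = 0) by (specialize (d_pos n); lra).
      assert (Z1 : d 1%nat = 0).
      { clear Hn. induction n as [|n IH]; [lra|]. destruct n as [|n]; [exact Z|]. apply IH.
        pose proof (cm_seq_log_convex d n Hd) as L. rewrite Z in L. specialize (d_pos (S n)). nra. }
      intros m. replace (d (S m)) with 0; [ring|]. clear - Z1 d_pos d_decr.
      induction m as [|m IH]; [easy|]. specialize (d_pos (S (S m))). specialize (d_decr (S m)). lra.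
Qed.

(** * Binomial series and change of pivot *)

(** Generic sums leave equations typed in a structure carrier; [ring] and [field] expect the type
    C. *)
Ltac in_C := match goal with |- ?x = ?y => change (@eq C x y) end.

Lemma RtoC_neq_0 (x : R) : x <> 0 -> RtoC x <> 0.
Proof. intros H E; apply H; now injection E. Qed.

Lemma csum_scal (k : C) (a : nat -> C) (n : nat) : sum_n (fun j => k * a j)%C n = (k * sum_n a n)%C.
Proof.
  induction n as [|n IH]; [now rewrite !sum_O|]. rewrite !sum_Sn, IH.
  change ((k * sum_n a n + k * a (S n))%C = (k * (sum_n a n + a (S n)))%C). ring.
Qed.

Lemma csum_plus (a b : nat -> C) (n : nat) : sum_n (fun j => a j + b j)%C n = (sum_n a n + sum_n b n)%C.
Proof.
  induction n as [|n IH]; [now rewrite !sum_O|]. rewrite !sum_Sn, IH.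
  change ((sum_n a n + sum_n b n + (a (S n) + b (S n)))%C = (sum_n a n + a (S n) + (sum_n b n + b (S n)))%C). ring.
Qed.

Lemma csum_succ_l (a : nat -> C) (n : nat) : sum_n a (S n) = (a 0%nat + sum_n (fun j => a (S j)) n)%C.
Proof.
  induction n as [|n IH]; [now rewrite sum_Sn, !sum_O|]. rewrite sum_Sn, IH, (sum_Sn (fun j => a (S j))).
  change ((a 0%nat + sum_n (fun j => a (S j)) n + a (S (S n)))%C = (a 0%nat + (sum_n (fun j => a (S j)) n + a (S (S n))))%C). ring.
Qed.

Definition conv (a b : nat -> C) (k : nat) : C := sum_n (fun j => a (k - j)%nat * b j)%C k.

Definition cderc (a : nat -> C) (n : nat) : C := (RtoC (INR (S n)) * a (S n))%C.

(* [cderc] is term-by-term differentiation of power series: Leibniz rule. *)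
Lemma conv_succ (a b : nat -> C) (k : nat) :
  (RtoC (INR (S k)) * conv a b (S k))%C = (conv (cderc a) b k + conv a (cderc b) k)%C.
Proof.
  unfold conv at 1. rewrite <- csum_scal.
  rewrite (sum_n_ext_loc _ (fun j => RtoC (INR (S k - j)) * a (S k - j)%nat * b j + a (S k - j)%nat * (RtoC (INR j) * b j))%C).
  2:{ intros j Hj. replace (INR (S k)) with (INR (S k - j) + INR j) by (rewrite <- plus_INR; f_equal; lia).
      rewrite RtoC_plus. change (((RtoC (INR (S k - j)) + RtoC (INR j)) * (a (S k - j)%nat * b j))%C = (RtoC (INR (S k - j)) * a (S k - j)%nat * b j + a (S k - j)%nat * (RtoC (INR j) * b j))%C). ring. }
  rewrite csum_plus. f_equal.
  - rewrite sum_Sn, Nat.sub_diag.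
    change ((sum_n (fun j => RtoC (INR (S k - j)) * a (S k - j)%nat * b j)%C k + RtoC (INR 0) * a 0%nat * b (S k))%C = conv (cderc a) b k).
    replace (RtoC (INR 0) * a 0%nat * b (S k))%C with (RtoC 0) by (simpl; ring). rewrite Cplus_0_r.
    unfold conv. apply sum_n_ext_loc. intros j Hj. unfold cderc. now rewrite Nat.sub_succ_l.
  - rewrite csum_succ_l. replace (a (S k - 0)%nat * (RtoC (INR 0) * b 0%nat))%C with (RtoC 0) by (simpl; ring).
    rewrite Cplus_0_l. apply sum_n_ext_loc. intros j Hj. reflexivity.
Qed.

Lemma conv_scal_l (c : C) (a b : nat -> C) (k : nat) : conv (fun n => c * a n)%C b k = (c * conv a b k)%C.
Proof.
  unfold conv. rewrite <- csum_scal. apply sum_n_ext. intros j. symmetry; apply Cmult_assoc.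
Qed.

Lemma conv_ext (a a' b b' : nat -> C) (k : nat) :
  (forall n, a n = a' n) -> (forall n, b n = b' n) -> conv a b k = conv a' b' k.
Proof. intros Ha Hb. apply sum_n_ext. intros j. now rewrite Ha, Hb. Qed.

Lemma Cmult_eq_reg_l (c x y : C) : c <> 0 -> (c * x = c * y)%C -> x = y.
Proof.
  intros Hc E. replace x with (/ c * (c * x))%C by (field; exact Hc). rewrite E. field; exact Hc.
Qed.

(** The coefficients of (1 - y)^(-al) (1 - y)^al = 1. Leibniz' rule gives (k + 1) C_(k+1) = k C_k,
    so C_1 = 0 and all later ones vanish. *)
Lemma binc_vandermonde (al : R) (k : nat) :
  conv (fun i => RtoC (binc al i)) (fun j => RtoC (binc (- al) j)) k = RtoC (if k then 1 else 0).
Proof.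
  set (a := fun i => RtoC (binc al i)). set (b := fun j => RtoC (binc (- al) j)).
  assert (K : forall k, (RtoC (INR (S k)) * conv a b (S k) = RtoC (INR k) * conv a b k)%C).
  { intros n. rewrite conv_succ. unfold conv. rewrite <- csum_plus, <- csum_scal. apply sum_n_ext_loc. intros j Hj.
    unfold cderc, a, b.
    rewrite <- !RtoC_mult, !binc_succ, <- RtoC_plus. f_equal.
    match goal with |- ?x = ?y => replace x with
      ((al + INR (n - j) + (- al + INR j)) * (binc al (n - j) * binc (- al) j)) by ring end.
    rewrite minus_INR by exact Hj. ring. }
  induction k as [|k IH].
  - unfold conv, a, b. rewrite sum_O, Nat.sub_diag, !binc_0. ring.
  - apply (Cmult_eq_reg_l (RtoC (INR (S k)))); [apply RtoC_neq_0, not_0_INR; lia|].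
    rewrite K, IH. destruct k; simpl INR; ring.
Qed.

Lemma pochhammer_shift (al : R) (n : nat) : pochhammer al (S n) = al * pochhammer (al + 1) n.
Proof.
  induction n as [|n IH]; [simpl; ring|].
  change (pochhammer al (S (S n))) with (pochhammer al (S n) * (al + INR (S n))).
  rewrite IH, S_INR. simpl. ring.
Qed.

Lemma pochhammer_add (al : R) (i j : nat) : pochhammer al (i + j) = pochhammer al j * pochhammer (al + INR j) i.
Proof.
  induction i as [|i IH]; simpl; [ring|]. rewrite IH, plus_INR. ring.
Qed.

Lemma binc_pascal (al : R) (n : nat) : binc (al + 1) (S n) - binc (al + 1) n = binc al (S n).
Proof.
  apply Rmult_eq_reg_l with (INR (S n)); [|apply not_0_INR; lia].
  rewrite Rmult_minus_distr_l, binc_succ.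
  unfold binc at 3. rewrite pochhammer_shift, fact_simpl, mult_INR, S_INR.
  unfold binc. field. split; [apply INR_fact_neq_0|rewrite <- S_INR; apply not_0_INR; lia].
Qed.

(** (1 - y)^(-al) on the unit disc, given by its series so that no branch of the logarithm
    enters. *)
Definition bser (al : R) : C -> C := cps (fun n => RtoC (binc al n)).

Lemma growth_binc_mult (al : R) (e : nat -> C) (K t r : R) :
  0 <= t -> 0 <= r -> t * r < 1 -> (forall n, Cmod (e n) <= K * t ^ n) ->
  growth (fun n => RtoC (binc al n) * e n)%C r.
Proof.
  intros Ht Hr Htr He. destruct (binc_growth al (t * r)) as [M HM]; [split; [nra|exact Htr]|].
  assert (K0 : 0 <= K) by (specialize (He 0%nat); simpl in He; pose proof (Cmod_ge_0 (e 0%nat)); lra).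
  exists (K * M); intros n. rewrite Cmod_mult, Cmod_R.
  apply Rle_trans with (K * (Rabs (binc al n) * (t * r) ^ n)); [|now apply Rmult_le_compat_l].
  rewrite Rpow_mult_distr.
  replace (K * (Rabs (binc al n) * (t ^ n * r ^ n))) with (Rabs (binc al n) * (K * t ^ n) * r ^ n) by ring.
  apply Rmult_le_compat_r; [now apply pow_le|]. apply Rmult_le_compat_l; [apply Rabs_pos|apply He].
Qed.

Lemma growth_ext (c c' : nat -> C) (r : R) : (forall n, c n = c' n) -> growth c r -> growth c' r.
Proof. intros E [M HM]; exists M; intros n; rewrite <- E; apply HM. Qed.

Lemma cps_ext (c c' : nat -> C) (z z' : C) :
  (forall n, c n * z ^ n = c' n * z' ^ n)%C -> cps c z = cps c' z'.
Proof.
  intros E. unfold cps, Cser. f_equal; apply Series_ext; intros n; now rewrite E.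
Qed.

Lemma growth_binc (al r : R) : 0 <= r < 1 -> growth (fun n => RtoC (binc al n)) r.
Proof.
  intros Hr. apply (growth_ext (fun n => RtoC (binc al n) * RtoC 1)%C); [intros; ring|].
  apply growth_binc_mult with 1 1; try lra. intros n. rewrite Cmod_1, pow1; lra.
Qed.

Lemma bser_cseries (al : R) (y : C) : Cmod y < 1 -> cseries (fun n => RtoC (binc al n) * y ^ n)%C (bser al y).
Proof.
  intros Hy. pose proof (Cmod_ge_0 y). apply cps_cseries with ((Cmod y + 1) / 2); [apply growth_binc; lra|lra].
Qed.

Lemma bser_cdiff (al : R) (y : C) : Cmod y < 1 -> cdiff (bser al) y.
Proof.
  intros Hy. pose proof (Cmod_ge_0 y). apply cps_cdiff with ((Cmod y + 1) / 2); [apply growth_binc; lra|lra].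
Qed.

Lemma cseries_single (a : nat -> C) : (forall n, a (S n) = 0) -> cseries a (a 0%nat).
Proof.
  intros H. apply cseries_eps. intros eps He. exists 0%nat. intros n _.
  replace (sum_n a n) with (a 0%nat).
  - replace (a 0%nat - a 0%nat)%C with (RtoC 0) by ring. now rewrite Cmod_0.
  - induction n as [|n IH]; [now rewrite sum_O|]. rewrite sum_Sn, <- IH, H.
    change (a 0%nat = (a 0%nat + 0)%C). ring.
Qed.

Lemma bser_inverse (al : R) (y : C) : Cmod y < 1 -> (bser al y * bser (- al) y)%C = 1.
Proof.
  intros Hy. pose proof (Cmod_ge_0 y) as Y0. set (r := (Cmod y + 1) / 2).
  assert (Hr : 0 < r < 1) by (unfold r; lra).
  destruct (binc_growth al r ltac:(lra)) as [M1 H1]. destruct (binc_growth (- al) r ltac:(lra)) as [M2 H2].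
  assert (T : 0 <= Cmod y / r < 1).
  { split; [apply Rdiv_le_0_compat; lra|]. apply Rmult_lt_reg_r with r; [lra|].
    unfold Rdiv; rewrite Rmult_assoc, Rinv_l by lra. unfold r; lra. }
  assert (B : forall be M i, (forall n, Rabs (binc be n) * r ^ n <= M) ->
     Cmod (RtoC (binc be i) * y ^ i)%C <= M * (Cmod y / r) ^ i).
  { intros be M i HM. rewrite Cmod_mult, Cmod_R, Cmod_pow. specialize (HM i).
    unfold Rdiv. rewrite Rpow_mult_distr, pow_inv.
    assert (0 < r ^ i) by (apply pow_lt; lra). assert (0 <= Cmod y ^ i) by now apply pow_le.
    replace (Rabs (binc be i) * Cmod y ^ i) with (Rabs (binc be i) * r ^ i * (Cmod y ^ i * / r ^ i)) by (field; lra).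
    apply Rmult_le_compat_r; [|exact HM]. apply Rdiv_le_0_compat; assumption. }
  symmetry. eapply cseries_unique; [|apply cseries_scal, bser_cseries, Hy].
  apply (cseries_triangle (fun i j => (RtoC (binc al i) * y ^ i) * (RtoC (binc (- al) j) * y ^ j))%C _ (M1 * M2) (Cmod y / r)).
  - exact T.
  - intros i j. rewrite Cmod_mult, pow_add.
    replace (M1 * M2 * ((Cmod y / r) ^ i * (Cmod y / r) ^ j)) with (M1 * (Cmod y / r) ^ i * (M2 * (Cmod y / r) ^ j)) by ring.
    apply Rmult_le_compat; try apply Cmod_ge_0; now apply B.
  - intros j. apply cseries_ext with (fun i => (RtoC (binc (- al) j) * y ^ j) * (RtoC (binc al i) * y ^ i))%C; [intros; ring|].
    replace (bser al y * (RtoC (binc (- al) j) * y ^ j))%C with ((RtoC (binc (- al) j) * y ^ j) * bser al y)%C by ring.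
    apply cseries_scal, bser_cseries, Hy.
  - apply cseries_ext with (fun k => y ^ k * RtoC (if k then 1 else 0))%C.
    + intros k. rewrite <- (binc_vandermonde al k). unfold conv. rewrite <- csum_scal.
      apply sum_n_ext_loc. intros j Hj. replace (y ^ k)%C with (y ^ (k - j) * y ^ j)%C; [in_C; ring|].
      rewrite <- Cpow_add_r. f_equal; lia.
    + replace (RtoC 1) with ((fun k => y ^ k * RtoC (if k then 1 else 0)) 0%nat)%C by (simpl; ring).
      apply cseries_single. intros n. ring.
Qed.

Lemma bser_succ (al : R) (y : C) : Cmod y < 1 -> (bser (al + 1) y * (1 - y))%C = bser al y.
Proof.
  intros Hy. eapply cseries_unique; [|apply bser_cseries, Hy].
  assert (S1 := bser_cseries (al + 1) y Hy).
  assert (S2 : cseries (fun n => match n with O => 0 | S m => y * (RtoC (binc (al + 1) m) * y ^ m) end)%C (y * bser (al + 1) y)%C).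
  { apply is_series_decr_1. change (cseries (fun m => y * (RtoC (binc (al + 1) m) * y ^ m))%C (y * bser (al + 1) y + - RtoC 0)%C).
    replace (y * bser (al + 1) y + - RtoC 0)%C with (y * bser (al + 1) y)%C by ring. now apply cseries_scal. }
  replace (bser (al + 1) y * (1 - y))%C with (bser (al + 1) y - y * bser (al + 1) y)%C by ring.
  refine (cseries_ext _ _ _ _ (cseries_minus _ _ _ _ S1 S2)). intros [|m].
  - rewrite !binc_0. simpl. ring.
  - rewrite <- (binc_pascal al m), RtoC_minus. simpl. ring.
Qed.

Lemma bser_add (al : R) (y : C) (j : nat) : Cmod y < 1 -> (bser (al + INR j) y * (1 - y) ^ j)%C = bser al y.
Proof.
  intros Hy; induction j as [|j IH].
  - simpl. rewrite Rplus_0_r. ring.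
  - rewrite S_INR, <- Rplus_assoc. rewrite <- IH, <- (bser_succ (al + INR j) y Hy). simpl. ring.
Qed.

(** The value of the moment functional t^k |-> u_k on t^n (t - p)^j. *)
Fixpoint piv (p : C) (u : nat -> R) (j n : nat) : C :=
  match j with
  | O => RtoC (u n)
  | S j => (piv p u j (S n) - p * piv p u j n)%C
  end.

Lemma piv_shift (p : C) (u : nat -> R) (j n : nat) : piv p (fun n => u (S n)) j n = piv p u j (S n).
Proof. revert n; induction j as [|j IH]; intros n; simpl; [reflexivity|now rewrite !IH]. Qed.

Lemma piv_diff (p : C) (u : nat -> R) (j n : nat) :
  piv p (fun n => u n - u (S n)) j n = (piv p u j n - piv p u j (S n))%C.
Proof. revert n; induction j as [|j IH]; intros n; simpl; [apply RtoC_minus|rewrite !IH; ring]. Qed.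

(* [E - p = (1 - p) E - p (1 - E)] for the shift operator [E], and both
   [E] and [1 - E] preserve complete monotonicity. *)
Lemma piv_bound (p : C) (t : R) (u : nat -> R) (j n : nat) :
  Cmod p <= t -> Cmod (1 - p)%C <= t -> cm_seq u -> Cmod (piv p u j n) <= t ^ j * u n.
Proof.
  intros Hp Hq. revert u n; induction j as [|j IH]; intros u n Hu.
  - simpl. rewrite Cmod_R, Rabs_pos_eq, Rmult_1_l by apply (Hu 0%nat). lra.
  - replace (piv p u (S j) n) with ((1 - p) * piv p (fun n => u (S n)) j n - p * piv p (fun n => u n - u (S n))%R j n)%C
      by (rewrite piv_shift, piv_diff; simpl; ring).
    eapply Rle_trans; [apply Cmod_minus_le|]. rewrite !Cmod_mult.
    assert (H1 : Cmod (piv p (fun n => u (S n)) j n) <= t ^ j * u (S n)).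
    { apply (IH (fun n => u (S n))). intros k m. rewrite fdiff_shift. apply Hu. }
    assert (H2 : Cmod (piv p (fun n => u n - u (S n)) j n) <= t ^ j * (u n - u (S n))).
    { apply (IH (fun n => u n - u (S n))). intros k m. rewrite <- fdiff_succ. apply Hu. }
    pose proof (Cmod_ge_0 p). pose proof (Cmod_ge_0 (1 - p)).
    pose proof (Cmod_ge_0 (piv p (fun n => u (S n)) j n)). pose proof (Cmod_ge_0 (piv p (fun n => u n - u (S n)) j n)).
    replace (t ^ S j * u n) with (t * (t ^ j * u (S n)) + t * (t ^ j * (u n - u (S n)))) by (simpl; ring).
    apply Rplus_le_compat; apply Rmult_le_compat; lra.
Qed.

(** The moments of the unit mass at t = 0. *)
Lemma piv_delta (p : C) (j n : nat) :
  piv p (fun n => if n then 1 else 0) j n = if n then ((- p) ^ j)%C else RtoC 0.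
Proof.
  revert n; induction j as [|j IH]; intros n; simpl; [now destruct n|].
  rewrite !IH. destruct n; ring.
Qed.

Lemma piv_1 (u : nat -> R) (j n : nat) : piv 1 u j n = ((- (1)) ^ j * RtoC (fdiff j u n))%C.
Proof.
  revert n; induction j as [|j IH]; intros n; simpl; [ring|]. rewrite !IH, RtoC_minus. ring.
Qed.

(** The binomial expansion of t^n (p + (t - p))^k, divided by k!. Exponential normalisation makes
    [conv_succ] applicable: [cderc] multiplies p^i / i! by p and turns piv_j / j! into piv_(j+1) /
    j!. *)
Lemma piv_expand (p : C) (u : nat -> R) (k n : nat) :
  conv (fun i => p ^ i / RtoC (INR (Factorial.fact i)))%C (fun j => piv p u j n / RtoC (INR (Factorial.fact j)))%C k
  = (RtoC (u (n + k)%nat) / RtoC (INR (Factorial.fact k)))%C.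
Proof.
  assert (F : forall n, RtoC (INR (Factorial.fact n)) <> 0) by (intros; apply RtoC_neq_0, INR_fact_neq_0).
  assert (N : forall n, RtoC (INR (S n)) <> 0) by (intros; apply RtoC_neq_0, not_0_INR; lia).
  assert (FS : forall n, RtoC (INR (Factorial.fact (S n))) = (RtoC (INR (S n)) * RtoC (INR (Factorial.fact n)))%C).
  { intros m. now rewrite fact_simpl, mult_INR, RtoC_mult. }
  revert n; induction k as [|k IH]; intros n.
  - unfold conv. rewrite sum_O, Nat.add_0_r. simpl. field.
  - refine (Cmult_eq_reg_l (RtoC (INR (S k))) _ _ (N k) _). rewrite conv_succ.
    rewrite (conv_ext _ (fun i => p * (p ^ i / RtoC (INR (Factorial.fact i))))%C _ (fun j => piv p u j n / RtoC (INR (Factorial.fact j)))%C).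
    2:{ intros i. unfold cderc. rewrite FS. simpl (p ^ S i)%C. field; auto. } 2:{ reflexivity. }
    rewrite conv_scal_l.
    unfold conv. rewrite <- csum_scal, <- csum_plus.
    rewrite (sum_n_ext _ (fun j => (p ^ (k - j) / RtoC (INR (Factorial.fact (k - j)))) * (piv p u j (S n) / RtoC (INR (Factorial.fact j))))%C).
    2:{ intros j. unfold cderc. rewrite FS. simpl piv.
        in_C. field; auto. }
    rewrite FS. transitivity (RtoC (u (S n + k)%nat) / RtoC (INR (Factorial.fact k)))%C; [exact (IH (S n))|].
    rewrite Nat.add_succ_r. simpl Nat.add. field; auto.
Qed.

(** Binomial coefficients are at most 2^(i+j), by Pascal's rule. *)
Lemma fact_add_le (i j : nat) :
  INR (Factorial.fact (i + j)) <= 2 ^ (i + j) * (INR (Factorial.fact i) * INR (Factorial.fact j)).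
Proof.
  assert (P2 : forall n, 1 <= 2 ^ n) by (intros; apply pow_R1_Rle; lra).
  assert (F : forall n, 0 < INR (Factorial.fact n)) by apply INR_fact_lt_0.
  remember (i + j)%nat as n eqn:E. revert i j E; induction n as [|n IH]; intros i j E.
  - replace i with 0%nat by lia. replace j with 0%nat by lia. simpl; lra.
  - destruct i as [|i]; [|destruct j as [|j]].
    + replace j with (S n) by lia. specialize (P2 (S n)). specialize (F (S n)). simpl (INR (Factorial.fact 0)). nra.
    + replace (S i) with (S n) by lia. specialize (P2 (S n)). specialize (F (S n)). simpl (INR (Factorial.fact 0)). nra.
    + pose proof (IH i (S j) ltac:(lia)) as H1. pose proof (IH (S i) j ltac:(lia)) as H2.
      rewrite (fact_simpl n), mult_INR. replace (INR (S n)) with (INR (S i) + INR (S j)) by (rewrite <- plus_INR; f_equal; lia).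
      rewrite (fact_simpl j), mult_INR in H1 |- *. rewrite (fact_simpl i), mult_INR in H2 |- *.
      apply Rmult_le_compat_l with (r := INR (S i)) in H1; [|apply pos_INR].
      apply Rmult_le_compat_l with (r := INR (S j)) in H2; [|apply pos_INR].
      simpl (2 ^ S n). nra.
Qed.

(** * Analytic continuation *)

(** The moment functional applied to (1 - z t)^(-al); for u = [moment A B] it is the hypergeometric
    series. *)
Definition hser (al : R) (u : nat -> R) : C -> C := cps (fun k => RtoC (binc al k) * RtoC (u k))%C.

Definition pivser (al : R) (p : C) (u : nat -> R) : C -> C := cps (fun j => RtoC (binc al j) * piv p u j 0)%C.

Lemma hser_growth (al : R) (u : nat -> R) (r : R) :
  (forall n, Rabs (u n) <= 1) -> 0 <= r < 1 -> growth (fun k => RtoC (binc al k) * RtoC (u k))%C r.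
Proof.
  intros Hu Hr. apply growth_binc_mult with 1 1; try lra. intros n. rewrite Cmod_R, pow1, Rmult_1_r. apply Hu.
Qed.

Lemma hser_cseries (al : R) (u : nat -> R) (z : C) :
  (forall n, Rabs (u n) <= 1) -> Cmod z < 1 ->
  cseries (fun k => RtoC (binc al k) * RtoC (u k) * z ^ k)%C (hser al u z).
Proof.
  intros Hu Hz. pose proof (Cmod_ge_0 z). apply cps_cseries with ((Cmod z + 1) / 2); [apply hser_growth; auto; lra|lra].
Qed.

Lemma hser_cdiff (al : R) (u : nat -> R) (z : C) :
  (forall n, Rabs (u n) <= 1) -> Cmod z < 1 -> cdiff (hser al u) z.
Proof.
  intros Hu Hz. pose proof (Cmod_ge_0 z). apply cps_cdiff with ((Cmod z + 1) / 2); [apply hser_growth; auto; lra|lra].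
Qed.

Lemma pochhammer_binc (al : R) (i j : nat) :
  pochhammer al (i + j) / (INR (Factorial.fact i) * INR (Factorial.fact j)) = binc al j * binc (al + INR j) i.
Proof.
  rewrite pochhammer_add. unfold binc. field. split; apply INR_fact_neq_0.
Qed.

(* Expand (1 - z t)^(-al) = (1 - p z)^(-al) (1 - z (t - p) / (1 - p z))^(-al),
   with t^k replaced by [u k] and (t - p)^j by [piv p u j 0]. *)
Lemma hser_pivot (al P : R) (p : C) (u : nat -> R) (z : C) :
  Cmod p <= P -> (forall j, Cmod (piv p u j 0) <= P ^ j) -> (forall n, Rabs (u n) <= 1) ->
  Cmod z * P <= / 8 -> Cmod z < 1 ->
  hser al u z = (bser al (p * z) * pivser al p u (z / (1 - p * z)))%C.
Proof.
  intros Hp He Hu HzP Hz.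
  (* The constant 1/8 is 1/2 cubed: one factor absorbs the binomial coefficients, one the growth of
     [binc], and one remains as the ratio of the double series. *)
  destruct (binc_growth al (/ 2) ltac:(lra)) as [M HM].
  assert (Z0 := Cmod_ge_0 z). assert (P0 : 0 <= P) by (pose proof (Cmod_ge_0 p); lra).
  assert (Hpz : Cmod (p * z)%C <= / 8).
  { rewrite Cmod_mult, Rmult_comm. eapply Rle_trans; [|exact HzP]. now apply Rmult_le_compat_l. }
  assert (H1 : 7 / 8 <= Cmod (1 - p * z)%C).
  { pose proof (Cmod_triangle_minus 1 (p * z)). rewrite Cmod_1 in H. lra. }
  assert (N1 : (1 - p * z)%C <> 0) by (apply Cmod_gt_0; lra).
  set (W := (z / (1 - p * z))%C).
  assert (HW : Cmod W * P < 1).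
  { unfold W. rewrite Cmod_div by exact N1. apply Rmult_lt_reg_r with (Cmod (1 - p * z)%C); [lra|].
    replace (Cmod z / Cmod (1 - p * z)%C * P * Cmod (1 - p * z)%C) with (Cmod z * P) by (field; lra). lra. }
  assert (SW : cseries (fun j => RtoC (binc al j) * piv p u j 0 * W ^ j)%C (pivser al p u W)).
  { assert (E : exists r, Cmod W < r /\ P * r < 1).
    { exists (Cmod W + (1 - Cmod W * P) / (2 * (P + 1))).
      assert (0 < (1 - Cmod W * P) / (2 * (P + 1))) by (apply Rdiv_lt_0_compat; lra). split; [lra|].
      assert (K : (1 - Cmod W * P) / (2 * (P + 1)) * (2 * (P + 1)) = 1 - Cmod W * P) by (field; lra). nra. }
    destruct E as [r [Hr1 Hr2]]. pose proof (Cmod_ge_0 W). apply cps_cseries with r; [|exact Hr1].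
    apply growth_binc_mult with 1 P; try lra. intros n; rewrite Rmult_1_l; apply He. }
  eapply cseries_unique; [|apply cseries_scal, SW].
  set (a := fun i j => (RtoC (pochhammer al (i + j) / (INR (Factorial.fact i) * INR (Factorial.fact j)))
                        * p ^ i * piv p u j 0 * z ^ (i + j))%C).
  apply (cseries_triangle a _ M (/ 2)); [lra| | |].
  - intros i j. unfold a. rewrite !Cmod_mult, !Cmod_pow, Cmod_R.
    set (n := (i + j)%nat).
    assert (F : 0 < INR (Factorial.fact i) * INR (Factorial.fact j)) by (apply Rmult_lt_0_compat; apply INR_fact_lt_0).
    assert (E1 : Rabs (pochhammer al n / (INR (Factorial.fact i) * INR (Factorial.fact j))) <= Rabs (binc al n) * 2 ^ n).
    { pose proof (fact_add_le i j) as T. fold n in T. pose proof (INR_fact_lt_0 n).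
      replace (pochhammer al n / (INR (Factorial.fact i) * INR (Factorial.fact j))) with
        (binc al n * (INR (Factorial.fact n) / (INR (Factorial.fact i) * INR (Factorial.fact j))))
        by (unfold binc; field; repeat split; apply INR_fact_neq_0).
      rewrite Rabs_mult. apply Rmult_le_compat_l; [apply Rabs_pos|].
      rewrite Rabs_pos_eq by (apply Rdiv_le_0_compat; lra).
      apply Rmult_le_reg_r with (INR (Factorial.fact i) * INR (Factorial.fact j)); [exact F|].
      unfold Rdiv. rewrite Rmult_assoc, Rinv_l by lra. lra. }
    assert (E2 : Cmod p ^ i * Cmod (piv p u j 0) <= P ^ n).
    { unfold n; rewrite pow_add. apply Rmult_le_compat; [apply pow_le, Cmod_ge_0|apply Cmod_ge_0| |apply He].
      apply pow_incr; split; [apply Cmod_ge_0|exact Hp]. }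
    assert (E3 : P ^ n * Cmod z ^ n <= (/ 8) ^ n).
    { rewrite <- Rpow_mult_distr. apply pow_incr. split; [nra|lra]. }
    assert (Zn : 0 <= Cmod z ^ n) by now apply pow_le.
    assert (Pn : 0 <= P ^ n) by now apply pow_le.
    rewrite (Rmult_assoc (Rabs _)), Rmult_assoc.
    apply Rle_trans with (Rabs (binc al n) * 2 ^ n * (P ^ n * Cmod z ^ n)).
    { apply Rmult_le_compat; [apply Rabs_pos| |exact E1|].
      - apply Rmult_le_pos; [|exact Zn]. apply Rmult_le_pos; [apply pow_le|]; apply Cmod_ge_0.
      - apply Rmult_le_compat_r; assumption. }
    apply Rle_trans with (Rabs (binc al n) * 2 ^ n * (/ 8) ^ n).
    { apply Rmult_le_compat_l; [|exact E3]. apply Rmult_le_pos; [apply Rabs_pos|apply pow_le; lra]. }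
    replace (Rabs (binc al n) * 2 ^ n * (/ 8) ^ n) with (Rabs (binc al n) * (/ 2) ^ n * (/ 2) ^ n).
    + apply Rmult_le_compat_r; [apply pow_le; lra|apply HM].
    + rewrite !Rmult_assoc, <- !Rpow_mult_distr. do 2 f_equal. lra.
  (* For fixed j the sum over i is the binomial series of (1 - p z)^(-al - j). *)
  - intros j.
    assert (Hy : Cmod (p * z)%C < 1) by lra.
    replace (bser al (p * z) * (RtoC (binc al j) * piv p u j 0 * W ^ j))%C with
      ((RtoC (binc al j) * piv p u j 0 * z ^ j) * bser (al + INR j) (p * z))%C.
    + refine (cseries_ext _ _ _ _ (cseries_scal _ _ _ (bser_cseries (al + INR j) (p * z)%C Hy))).
      intros i. unfold a. rewrite pochhammer_binc, RtoC_mult, Cpow_add_r, Cpow_mult_l. ring.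
    + rewrite <- (bser_add al (p * z)%C j Hy). unfold W, Cdiv. rewrite Cpow_mult_l, Cpow_inv by exact N1.
      field. apply Cpow_nz, N1.
  (* For fixed i + j = k the sum recombines, by [piv_expand], to the k-th term of [hser]. *)
  - refine (cseries_ext _ _ _ _ (hser_cseries al u z Hu Hz)). intros k.
    pose proof (piv_expand p u k 0) as X. unfold conv in X. rewrite Nat.add_0_l in X.
    assert (Fk : RtoC (INR (Factorial.fact k)) <> 0) by apply RtoC_neq_0, INR_fact_neq_0.
    transitivity (RtoC (pochhammer al k) * z ^ k * (RtoC (u k) / RtoC (INR (Factorial.fact k))))%C.
    + unfold binc. rewrite RtoC_div by apply INR_fact_neq_0. in_C. field. exact Fk.
    + rewrite <- X, <- csum_scal. apply sum_n_ext_loc. intros j Hj. unfold a.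
      replace (k - j + j)%nat with k by lia.
      rewrite RtoC_div, RtoC_mult by (apply Rmult_integral_contrapositive; split; apply INR_fact_neq_0).
      in_C. field. split; apply RtoC_neq_0, INR_fact_neq_0.
Qed.

(** Equivalent to |p z| < |1 - p z|, that is |p| |w| < 1 for w = z / (1 - p z). *)
Definition halfplane (p z : C) : Prop := Re (p * z)%C < / 2.

Lemma Cmod_lt_reflect (y : C) : Re y < / 2 -> Cmod y < Cmod (1 - y)%C.
Proof.
  destruct y as [a b]; simpl; intros H. unfold Cmod; simpl. apply sqrt_lt_1_alt. split; nra.
Qed.

Lemma Cmod_le_reflect (y : C) : / 2 <= Re y -> Cmod (1 - y)%C <= Cmod y.
Proof.
  destruct y as [a b]; simpl; intros H. unfold Cmod; simpl. apply sqrt_le_1_alt. nra.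
Qed.

Lemma halfplane_convex (p : C) : cconvex (halfplane p).
Proof.
  intros [u1 u2] [v1 v2] s. destruct p as [p1 p2]. unfold halfplane; simpl. intros Hu Hv Hs.
  destruct (Req_dec s 0) as [->|N]; nra.
Qed.

Lemma halfplane_open (p : C) : copen (halfplane p).
Proof.
  intros z Hz. unfold halfplane in *. exists ((/ 2 - Re (p * z)%C) / (Cmod p + 1)).
  pose proof (Cmod_ge_0 p). split; [apply Rdiv_lt_0_compat; lra|]. intros w Hw.
  assert (E : Re (p * w)%C = Re (p * z)%C + Re (p * (w - z))%C) by (destruct p, z, w; simpl; ring).
  rewrite E. pose proof (Rle_trans _ _ _ (Rle_abs _) (re_le_Cmod (p * (w - z)))) as K. rewrite Cmod_mult in K.
  apply Rmult_lt_compat_l with (r := Cmod p + 1) in Hw; [|lra].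
  replace ((Cmod p + 1) * ((/ 2 - Re (p * z)%C) / (Cmod p + 1))) with (/ 2 - Re (p * z)%C) in Hw by (field; lra).
  pose proof (Cmod_ge_0 (w - z)). lra.
Qed.

Lemma halfplane_0 (p : C) : halfplane p 0.
Proof. unfold halfplane. destruct p; simpl. lra. Qed.

Lemma cconvex_inter (U V : C -> Prop) : cconvex U -> cconvex V -> cconvex (fun z => U z /\ V z).
Proof. intros HU HV u v s [? ?] [? ?] Hs; split; auto. Qed.

Lemma copen_inter (U V : C -> Prop) : copen U -> copen V -> copen (fun z => U z /\ V z).
Proof.
  intros HU HV z [Hz1 Hz2]. destruct (HU z Hz1) as [d1 [P1 H1]], (HV z Hz2) as [d2 [P2 H2]].
  exists (Rmin d1 d2); split; [now apply Rmin_glb_lt|]. intros w Hw.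
  pose proof (Rmin_l d1 d2); pose proof (Rmin_r d1 d2). split; [apply H1|apply H2]; lra.
Qed.

Lemma disc_convex : cconvex (fun z => Cmod z < 1).
Proof.
  intros u v s Hu Hv Hs; cbv beta in *. eapply Rle_lt_trans; [apply Cmod_triangle|].
  rewrite !Cmod_mult, !Cmod_R, !Rabs_pos_eq by lra. destruct (Rle_lt_or_eq_dec 0 s) as [h|<-]; [lra| |lra].
  pose proof (Rmult_le_pos (1 - s) (1 - Cmod u)). pose proof (Rmult_lt_0_compat s (1 - Cmod v)). lra.
Qed.

Lemma disc_open : copen (fun z => Cmod z < 1).
Proof.
  intros z Hz. exists (1 - Cmod z); split; [lra|]. intros w Hw.
  pose proof (Cmod_triangle_minus w z). lra.
Qed.

(* Continuation of [hser al u] to the half-plane Re (p z) < 1/2. *)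
Definition hcont (al : R) (u : nat -> R) (p z : C) : C :=
  (bser (- al) (- p * (z / (1 - p * z))) * pivser al p u (z / (1 - p * z)))%C.

Lemma halfplane_ratio (p z : C) :
  halfplane p z -> (1 - p * z)%C <> 0 /\ Cmod p * Cmod (z / (1 - p * z))%C < 1.
Proof.
  intros Hz. pose proof (Cmod_lt_reflect (p * z)%C Hz) as K. pose proof (Cmod_ge_0 (p * z)).
  assert (N : (1 - p * z)%C <> 0) by (apply Cmod_gt_0; lra). split; [exact N|].
  rewrite Cmod_div by exact N. rewrite Cmod_mult in K, H.
  apply Rmult_lt_reg_r with (Cmod (1 - p * z)%C); [lra|].
  replace (Cmod p * (Cmod z / Cmod (1 - p * z)%C) * Cmod (1 - p * z)%C) with (Cmod p * Cmod z) by (field; lra). lra.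
Qed.

Lemma piv_bound_0 (p : C) (u : nat -> R) (j : nat) :
  / 2 <= Re p -> cm_seq u -> u 0%nat = 1 -> Cmod (piv p u j 0) <= Cmod p ^ j.
Proof.
  intros Hp Hu U0. rewrite <- (Rmult_1_r (Cmod p ^ j)), <- U0. apply piv_bound; [lra|now apply Cmod_le_reflect|exact Hu].
Qed.

Lemma cm_seq_le_1 (u : nat -> R) (n : nat) : cm_seq u -> u 0%nat = 1 -> Rabs (u n) <= 1.
Proof.
  intros Hu U0. rewrite Rabs_pos_eq by apply (Hu 0%nat).
  induction n as [|n IH]; [lra|]. pose proof (Hu 1%nat n) as X; simpl in X; lra.
Qed.

Lemma Cmod_pos_of_Re (p : C) : / 2 <= Re p -> 0 < Cmod p.
Proof. intros Hp. pose proof (Rle_trans _ _ _ (Rle_abs _) (re_le_Cmod p)). lra. Qed.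

Lemma hcont_cdiff (al : R) (u : nat -> R) (p z : C) :
  / 2 <= Re p -> cm_seq u -> u 0%nat = 1 -> halfplane p z -> cdiff (hcont al u p) z.
Proof.
  intros Hp Hu U0 Hz. destruct (halfplane_ratio p z Hz) as [N K].
  assert (Dw : cdiff (fun z => z / (1 - p * z))%C z).
  { apply cdiff_div; [exact N|apply cdiff_id|]. apply cdiff_minus; [apply cdiff_const|].
    apply cdiff_mult; [apply cdiff_const|apply cdiff_id]. }
  pose proof (Cmod_pos_of_Re p Hp) as P0. pose proof (Cmod_ge_0 (z / (1 - p * z))%C) as W0.
  unfold hcont. apply cdiff_mult.
  - apply (cdiff_comp (bser (- al)) (fun z => - p * (z / (1 - p * z)))%C).
    + apply bser_cdiff. now rewrite Cmod_mult, Cmod_opp.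
    + apply cdiff_mult; [apply cdiff_const|exact Dw].
  - apply (cdiff_comp (pivser al p u) (fun z => z / (1 - p * z))%C); [|exact Dw].
    set (w := (z / (1 - p * z))%C) in *.
    assert (K' : Cmod w < / Cmod p).
    { apply Rmult_lt_reg_l with (Cmod p); [exact P0|]. rewrite Rinv_r by lra. exact K. }
    apply cps_cdiff with ((Cmod w + / Cmod p) / 2); [|lra].
    apply growth_binc_mult with 1 (Cmod p); [lra|lra| |].
    + apply Rlt_le_trans with (Cmod p * / Cmod p); [apply Rmult_lt_compat_l; lra|right; field; lra].
    + intros n; rewrite Rmult_1_l. now apply piv_bound_0.
Qed.

Lemma hser_delta (al : R) (z : C) : Cmod z < 1 -> hser al (fun n => if n then 1 else 0) z = 1.
Proof.
  intros Hz. apply (cseries_unique (fun k => RtoC (binc al k) * RtoC (if k then 1 else 0) * z ^ k)%C).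
  - apply hser_cseries; [|exact Hz]. intros [|n]; [rewrite Rabs_R1|rewrite Rabs_R0]; lra.
  - replace (RtoC 1) with ((fun k => RtoC (binc al k) * RtoC (if k then 1 else 0) * z ^ k)%C 0%nat)
      by (simpl; rewrite binc_0; ring).
    apply cseries_single. intros n; ring.
Qed.

(** [hser_pivot] has the prefactor (1 - p z)^(-al), whose series needs |p z| < 1. As 1 - p z = 1 /
    (1 + p w), it equals (1 + p w)^al, whose series converges on the whole half-plane; hence the
    form of [hcont]. *)
Lemma hcont_local (al : R) (u : nat -> R) (p z : C) :
  / 2 <= Re p -> cm_seq u -> u 0%nat = 1 -> Cmod z * Cmod p <= / 8 -> Cmod z < 1 ->
  hser al u z = hcont al u p z.
Proof.
  intros Hp Hu U0 Hzp Hz.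
  assert (Hh : halfplane p z).
  { unfold halfplane. pose proof (Rle_trans _ _ _ (Rle_abs _) (re_le_Cmod (p * z))). rewrite Cmod_mult in H. lra. }
  destruct (halfplane_ratio p z Hh) as [N K]. unfold hcont.
  rewrite (hser_pivot al (Cmod p) p u z);
    [|lra|intros; now apply piv_bound_0|intros; now apply cm_seq_le_1|exact Hzp|exact Hz].
  f_equal. set (w := (z / (1 - p * z))%C) in *.
  (* [hser_pivot] for the unit mass at 0, where the left side is 1, yields this product rule for the
     two binomial series. *)
  assert (D : (bser al (p * z) * bser al (- p * w))%C = 1).
  { rewrite <- (hser_delta al z Hz), (hser_pivot al (Cmod p) p (fun n => if n then 1 else 0) z); [|lra| | |exact Hzp|exact Hz].
    - f_equal. apply cps_ext. intros n. fold w. rewrite piv_delta, Cpow_mult_l. ring.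
    - intros j. rewrite piv_delta, Cmod_pow, Cmod_opp. lra.
    - intros [|n]; [rewrite Rabs_R1|rewrite Rabs_R0]; lra. }
  assert (I : (bser al (- p * w) * bser (- al) (- p * w))%C = 1).
  { apply bser_inverse. now rewrite Cmod_mult, Cmod_opp. }
  replace (bser al (p * z)) with (bser al (p * z) * (bser al (- p * w) * bser (- al) (- p * w)))%C by (rewrite I; ring).
  rewrite Cmult_assoc, D. ring.
Qed.

(** Two half-planes meet in a convex set around 0, and near 0 both continuations are [hser]; the
    radius 1 / (8 m) meets the smallness condition of [hcont_local] for both pivots. *)
Lemma hcont_agree (al : R) (u : nat -> R) (p q z : C) :
  / 2 <= Re p -> / 2 <= Re q -> cm_seq u -> u 0%nat = 1 -> halfplane p z -> halfplane q z ->
  hcont al u p z = hcont al u q z.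
Proof.
  intros Hp Hq Hu U0 Zp Zq.
  pose proof (Cmod_pos_of_Re p Hp). pose proof (Cmod_pos_of_Re q Hq).
  set (m := Cmod p + Cmod q + 1). assert (0 < m) by (unfold m; lra).
  apply (identity_theorem (fun z => halfplane p z /\ halfplane q z) _ _ (/ (8 * m))).
  - apply cconvex_inter; apply halfplane_convex.
  - apply copen_inter; apply halfplane_open.
  - split; apply halfplane_0.
  - intros w [? ?]; now apply hcont_cdiff.
  - intros w [? ?]; now apply hcont_cdiff.
  - apply Rinv_0_lt_compat; lra.
  - intros w Hw. assert (Hm : Cmod w * m < / 8).
    { apply Rmult_lt_compat_r with (r := m) in Hw; [|assumption].
      replace (/ (8 * m) * m) with (/ 8) in Hw by (field; lra). exact Hw. }
    pose proof (Cmod_ge_0 w).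
    rewrite <- !hcont_local; auto; unfold m in Hm; nra.
  - now split.
Qed.

Lemma hcont_hser (al : R) (u : nat -> R) (p z : C) :
  / 2 <= Re p -> cm_seq u -> u 0%nat = 1 -> halfplane p z -> Cmod z < 1 ->
  hcont al u p z = hser al u z.
Proof.
  intros Hp Hu U0 Zp Hz. pose proof (Cmod_pos_of_Re p Hp).
  assert (U1 : forall n, Rabs (u n) <= 1) by (intros; now apply cm_seq_le_1).
  apply (identity_theorem (fun z => halfplane p z /\ Cmod z < 1) _ _ (/ (8 * (Cmod p + 1)))).
  - apply cconvex_inter; [apply halfplane_convex|apply disc_convex].
  - apply copen_inter; [apply halfplane_open|apply disc_open].
  - split; [apply halfplane_0|rewrite Cmod_0; lra].
  - intros w [? ?]; now apply hcont_cdiff.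
  - intros w [? ?]; now apply hser_cdiff.
  - apply Rinv_0_lt_compat; lra.
  - intros w Hw. assert (Hm : Cmod w * (Cmod p + 1) < / 8).
    { apply Rmult_lt_compat_r with (r := Cmod p + 1) in Hw; [|lra].
      replace (/ (8 * (Cmod p + 1)) * (Cmod p + 1)) with (/ 8) in Hw by (field; lra). exact Hw. }
    pose proof (Cmod_ge_0 w). symmetry; apply hcont_local; auto; nra.
  - now split.
Qed.

(* Every point off the cut lies in the half-plane of some pivot on Re p = 1/2. *)
Definition pivot (z : C) : C := (/ 2, if Req_EM_T (Im z) 0 then 0 else Re z / (2 * Im z)).

Lemma Re_pivot (z : C) : / 2 <= Re (pivot z).
Proof. apply Rle_refl. Qed.

(** For real z the pivot 1/2 gives z / 2 < 1/2; otherwise the imaginary part of the pivot is chosen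
    to make Re (p z) = 0. *)
Lemma halfplane_pivot (z : C) : ~ (Im z = 0 /\ 1 <= Re z) -> halfplane (pivot z) z.
Proof.
  destruct z as [x y]; unfold halfplane, pivot, Re, Im; simpl. intros H.
  destruct (Req_EM_T y 0) as [->|N].
  - assert (x < 1) by (apply Rnot_le_lt; intros K; apply H; now split). lra.
  - replace (/ 2 * x - x / (2 * y) * y) with 0 by (field; exact N). lra.
Qed.

Lemma halfplane_off_cut (p z : C) : / 2 <= Re p -> halfplane p z -> ~ (Im z = 0 /\ 1 <= Re z).
Proof.
  destruct p as [a b], z as [x y]; unfold halfplane; simpl. intros Hp Hz [-> Hx]. nra.
Qed.

Definition slit_ext (al : R) (u : nat -> R) (z : C) : C := hcont al u (pivot z) z.

(** The pivot in [slit_ext] moves with z; freezing it on a half-plane is what makes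
    differentiability local to one [hcont]. *)
Lemma slit_ext_hcont (al : R) (u : nat -> R) (p z : C) :
  / 2 <= Re p -> cm_seq u -> u 0%nat = 1 -> halfplane p z -> slit_ext al u z = hcont al u p z.
Proof.
  intros Hp Hu U0 Hz. apply (hcont_agree al u (pivot z) p z); try assumption.
  - apply Re_pivot.
  - apply halfplane_pivot, (halfplane_off_cut p); assumption.
Qed.

(** * Existence and uniqueness of the hypergeometric extension *)

Lemma hyp_coef_moment (sigma : R) (A B : list R) (n : nat) :
  List.Forall (fun b => 0 < b) B -> hyp_coef sigma A B n = binc sigma n * moment A B n.
Proof.
  intros PB. unfold hyp_coef, binc, moment. rewrite Forall_forall in PB.
  assert (0 < list_Rprod (map (fun b => pochhammer b n) B)).
  { apply list_Rprod_pos; intros; apply pochhammer_pos; auto. }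
  field. split; [lra|apply INR_fact_neq_0].
Qed.

Lemma hyp_coef_pseries (sigma : R) (A B : list R) (z l : C) :
  List.Forall (fun b => 0 < b) B ->
  is_pseries (K := C_AbsRing) (V := C_NormedModule) (fun n => RtoC (hyp_coef sigma A B n)) z l <->
  cseries (fun k => RtoC (binc sigma k) * RtoC (moment A B k) * z ^ k)%C l.
Proof.
  intros PB.
  assert (E : forall n, scal (pow_n (K := C_AbsRing) z n) (RtoC (hyp_coef sigma A B n) : C_NormedModule)
     = (RtoC (binc sigma n) * RtoC (moment A B n) * z ^ n)%C).
  { intros n. rewrite hyp_coef_moment, RtoC_mult by exact PB.
    replace (pow_n (K := C_AbsRing) z n) with (z ^ n)%C.
    - change ((z ^ n * (RtoC (binc sigma n) * RtoC (moment A B n)))%C = (RtoC (binc sigma n) * RtoC (moment A B n) * z ^ n)%C). ring.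
    - induction n as [|n IH]; [reflexivity|]. simpl. now rewrite IH. }
  split; intros H; refine (is_series_ext _ _ _ _ H); intros n; now rewrite E.
Qed.

Lemma slit_ext_is_hyp_extension (sigma : R) (A B : list R) :
  List.Forall (fun b => 0 < b) B -> cm_seq (moment A B) ->
  is_hyp_extension sigma A B (slit_ext sigma (moment A B)).
Proof.
  intros PB Hm. assert (M0 := moment_0 A B). split.
  - intros z Hz. apply hyp_coef_pseries; [exact PB|].
    assert (Hc : ~ (Im z = 0 /\ 1 <= Re z)).
    { intros [_ K]. pose proof (Rle_trans _ _ _ (Rle_abs _) (re_le_Cmod z)). lra. }
    unfold slit_ext. rewrite hcont_hser; try assumption; [|apply Re_pivot|now apply halfplane_pivot].
    apply hser_cseries; [intros; now apply cm_seq_le_1|exact Hz].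
  - intros z Hz. apply cdiff_ex_derive. apply halfplane_pivot in Hz.
    pose proof (Re_pivot z) as Hp. set (p := pivot z) in *.
    destruct (halfplane_open p z Hz) as [d [Hd Hd']].
    apply cdiff_ext_loc with (hcont sigma (moment A B) p) d; [exact Hd| |now apply hcont_cdiff].
    intros w Hw. symmetry. apply slit_ext_hcont; try assumption. now apply Hd'.
Qed.

(** Uniqueness, for whichever extension [epsilon] selects: F and [hcont] are differentiable on the
    half-plane and both equal the series near 0. *)
Lemma is_hyp_extension_hcont (sigma : R) (A B : list R) (F : C -> C) (p z : C) :
  List.Forall (fun b => 0 < b) B -> cm_seq (moment A B) -> is_hyp_extension sigma A B F ->
  / 2 <= Re p -> halfplane p z -> F z = hcont sigma (moment A B) p z.
Proof.
  intros PB Hm [HF1 HF2] Hp Hz. assert (M0 := moment_0 A B). pose proof (Cmod_pos_of_Re p Hp).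
  apply (identity_theorem (halfplane p) F _ (Rmin 1 (/ (8 * (Cmod p + 1))))); auto.
  - apply halfplane_convex.
  - apply halfplane_open.
  - apply halfplane_0.
  - intros w Hw. apply cdiff_ex_derive, HF2, (halfplane_off_cut p); assumption.
  - intros w Hw. now apply hcont_cdiff.
  - apply Rmin_glb_lt; [lra|apply Rinv_0_lt_compat; lra].
  - intros w Hw. pose proof (Rmin_l 1 (/ (8 * (Cmod p + 1)))). pose proof (Rmin_r 1 (/ (8 * (Cmod p + 1)))).
    assert (Hm' : Cmod w * (Cmod p + 1) < / 8).
    { assert (Hw' : Cmod w < / (8 * (Cmod p + 1))) by lra.
      apply Rmult_lt_compat_r with (r := Cmod p + 1) in Hw'; [|lra].
      replace (/ (8 * (Cmod p + 1)) * (Cmod p + 1)) with (/ 8) in Hw' by (field; lra). exact Hw'. }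
    pose proof (Cmod_ge_0 w). rewrite <- hcont_local; auto; [|nra|lra].
    apply (cseries_unique (fun k => RtoC (binc sigma k) * RtoC (moment A B k) * w ^ k)%C).
    + apply hyp_coef_pseries, HF1; [exact PB|lra].
    + apply hser_cseries; [intros; now apply cm_seq_le_1|lra].
Qed.

(** * Evaluation on the negative axis and conclusion *)

Lemma cps_RtoC (c : nat -> C) (z : C) (a : nat -> R) (x : R) :
  (forall n, c n * z ^ n = RtoC (a n * x ^ n))%C -> cps c z = RtoC (PSeries a x).
Proof.
  intros E. apply injective_projections.
  - apply Series_ext; intros n. now rewrite E.
  - change (Series (fun n => Im (c n * z ^ n)%C) = 0).
    rewrite (Series_ext _ (fun n => 0 * 0)) by (intros n; rewrite E; simpl; ring). rewrite Series_scal_l; ring.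
Qed.

(** The recurrence of [binc] is the equation (1 - t) S' = al S, so S(t) (1 - t)^al has derivative
    0. *)
Lemma binomial_series (al v : R) : 0 <= v < 1 -> PSeries (binc al) v = Rpower (1 - v) (- al).
Proof.
  intros Hv.
  assert (Hr : Rbar_le 1 (CV_radius (binc al))).
  { rewrite (CV_radius_ext _ (fun n => binc al n * 1)) by (intros; ring).
    apply CV_radius_binc_mult. intros; rewrite Rabs_R1; lra. }
  assert (Hin : forall t, 0 <= t <= v -> Rbar_lt (Rabs t) (CV_radius (binc al))).
  { intros t Ht. eapply Rbar_lt_le_trans; [|exact Hr]. simpl. rewrite Rabs_pos_eq; lra. }
  assert (D : forall t, 0 <= t <= v -> is_derive (fun t => PSeries (binc al) t * Rpower (1 - t) al) t 0).
  { intros t Ht. assert (Hc := Hin t Ht).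
    assert (E : (1 - t) * PSeries (PS_derive (binc al)) t = al * PSeries (binc al) t).
    { pose proof (PSeries_euler_coef al (binc al) t Hc) as X.
      rewrite <- (PSeries_ext (PS_derive (binc al))) in X by (intros n; apply binc_succ). lra. }
    assert (D2 : is_derive (fun t => Rpower (1 - t) al) t (- al * (Rpower (1 - t) al * / (1 - t)))).
    { unfold Rpower. auto_derive; [lra|]. unfold Rminus. field; lra. }
    replace 0 with (PSeries (PS_derive (binc al)) t * Rpower (1 - t) al + PSeries (binc al) t * (- al * (Rpower (1 - t) al * / (1 - t)))).
    - exact (is_derive_mult (PSeries (binc al)) (fun t => Rpower (1 - t) al) t _ _ (is_derive_PSeries _ _ Hc) D2 Rmult_comm).
    - replace (PSeries (PS_derive (binc al)) t) with (al * PSeries (binc al) t * / (1 - t)) by (rewrite <- E; field; lra). ring. }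
  assert (K : PSeries (binc al) v * Rpower (1 - v) al = 1).
  { assert (K0 : PSeries (binc al) 0 * Rpower (1 - 0) al = 1).
    { rewrite PSeries_0, binc_0, Rminus_0_r. unfold Rpower. rewrite ln_1, Rmult_0_r, exp_0. ring. }
    destruct (Req_dec v 0) as [->|N]; [exact K0|].
    transitivity (PSeries (binc al) 0 * Rpower (1 - 0) al); [symmetry|exact K0].
    apply (eq_is_derive (V := R_NormedModule) (fun t => PSeries (binc al) t * Rpower (1 - t) al) 0 v); [|lra].
    intros t Ht. now apply D. }
  rewrite Rpower_Ropp. assert (0 < Rpower (1 - v) al) by apply exp_pos.
  apply Rmult_eq_reg_r with (Rpower (1 - v) al); [|lra]. rewrite K. field; lra.
Qed.

(** With pivot 1 and z = -1/x one has w = -v for v = 1 / (x + 1). The signs in [piv_1] and (-v)^n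
    cancel, and x^(-sigma) (1 - v)^sigma = (x + 1)^(-sigma). *)
Lemma hcont_negative_axis (sigma : R) (u : nat -> R) (x : R) :
  0 < x ->
  (RtoC (Rpower x (- sigma)) * hcont sigma u 1 (RtoC (- (1 / x))))%C
  = RtoC (sps sigma (fun n => binc sigma n * fdiff n u 0) x).
Proof.
  intros Hx. set (v := / (x + 1)).
  assert (Hv : 0 <= v < 1).
  { split; [left; apply Rinv_0_lt_compat; lra|]. unfold v. rewrite <- Rinv_1. apply Rinv_lt_contravar; lra. }
  assert (W : (RtoC (- (1 / x)) / (1 - 1 * RtoC (- (1 / x))))%C = RtoC (- v)).
  { rewrite Cmult_1_l, <- RtoC_minus, <- RtoC_div.
    - f_equal. unfold v. field. lra.
    - replace (1 - - (1 / x)) with ((x + 1) / x) by (field; lra).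
      apply Rgt_not_eq, Rdiv_lt_0_compat; lra. }
  unfold hcont. rewrite W.
  assert (E1 : bser (- sigma) (- (1) * RtoC (- v))%C = RtoC (Rpower (1 - v) sigma)).
  { replace (- (1) * RtoC (- v))%C with (RtoC v) by (rewrite RtoC_opp; ring).
    rewrite <- (Ropp_involutive sigma) at 2. rewrite <- binomial_series by exact Hv.
    apply cps_RtoC. intros n. now rewrite RtoC_mult, RtoC_pow. }
  assert (E2 : pivser sigma 1 u (RtoC (- v)) = RtoC (PSeries (fun n => binc sigma n * fdiff n u 0) v)).
  { apply cps_RtoC. intros n. rewrite piv_1, !RtoC_mult, RtoC_pow.
    replace (RtoC (- v)) with (- (1) * RtoC v)%C by (rewrite RtoC_opp; ring). rewrite Cpow_mult_l.
    replace ((- (1)) ^ n)%C with (RtoC ((-1) ^ n)) by (rewrite RtoC_pow; f_equal; rewrite <- RtoC_opp; reflexivity).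
    transitivity (RtoC (((-1) ^ n) * ((-1) ^ n)) * (RtoC (binc sigma n) * RtoC (fdiff n u 0) * RtoC v ^ n))%C;
      [rewrite RtoC_mult; ring|].
    rewrite <- Rpow_mult_distr. replace (-1 * -1) with 1 by ring. rewrite pow1. ring. }
  rewrite E1, E2, <- !RtoC_mult. f_equal. unfold sps. fold v. rewrite <- Rmult_assoc. f_equal.
  unfold Rpower. rewrite <- exp_plus. f_equal.
  replace (1 - v) with (x / (x + 1)) by (unfold v; field; lra).
  unfold Rdiv. rewrite ln_mult, ln_Rinv by (try apply Rinv_0_lt_compat; lra). ring.
Qed.

Theorem theorem4 (q : nat) (A B : list R) (sigma : R)
  (hq : (1 <= q)%nat) (hA : length A = q) (hB : length B = q)
  (posA : List.Forall (fun a => 0 < a) A) (posB : List.Forall (fun b => 0 < b) B)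
  (hsigma : 0 < sigma) :
  (weak_supermajorization B A ->
     forall t : R, 0 < t <= 1 -> 0 <= v_fun A B t) /\
  ((forall t : R, 0 < t <= 1 -> 0 <= v_fun A B t) ->
     exists f : R -> R,
       (forall x : R, 0 < x ->
          RtoC (f x)
          = Cmult (RtoC (Rpower x (- sigma)))
                  (hypF sigma A B (RtoC (- (1 / x))))) /\
       completely_monotone f /\
       (sigma <= 1 -> log_completely_monotone f)).
Proof.
  split.
  - intros Hw t Ht. now apply weak_supermajorization_v_fun.
  - intros Hv.
    assert (Hm : cm_seq (moment A B)) by (apply moment_cm_seq; congruence || assumption).
    exists (sps sigma (fun n => binc sigma n * fdiff n (moment A B) 0)).
    destruct (completely_monotone_moment_series sigma (fun n => fdiff n (moment A B) 0)) as [C1 C2];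
      [exact hsigma|now apply cm_seq_fdiff0|apply moment_0|].
    split; [|now split].
    intros x Hx. rewrite <- hcont_negative_axis by exact Hx. f_equal. symmetry.
    apply (is_hyp_extension_hcont sigma A B); auto.
    (* Exhibiting one extension is what gives [hypF] its defining property. *)
    + unfold hypF. apply epsilon_spec. eexists. now apply slit_ext_is_hyp_extension.
    + simpl; lra.
    + unfold halfplane. simpl. assert (0 < 1 / x) by (apply Rdiv_lt_0_compat; lra). lra.
Qed.
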